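(* Let $m\in\mathbb{N}$, and let $f:S\oplus V\to\mathbb{R}_{0,2m+1}$ be a function of class $\mathcal{C}^{2m+1}$. Let $B$ be the closed unit ball of $S\oplus V\cong\mathbb{R}^{2m+2}$. Then for every $x$ in the interior of $B$, $$f(x)=\int_{\partial B}\bigl(\Delta^m N(y-x)\bigr)\,\gamma(y)\,f(y)-\sum_{k=1}^m\int_{\partial B}\Bigl(\frac{\partial}{\partial n}\Delta^{m-k}N(y-x)\Bigr)\,D\Delta^{k-1}f(y)\,d\sigma_y$$ $$\qquad+\sum_{k=1}^m\int_{\partial B}\bigl(\Delta^{m-k}N(y-x)\bigr)\,\frac{\partial}{\partial n}D\Delta^{k-1}f(y)\,d\sigma_y-\int_B N(y-x)\,D\Delta^m f(y)\,\omega(y).$$ In particular, if $f$ is (left) holomorphic Cliffordian, then for every $x$ in the interior of $B$, $$f(x)=\int_{\partial B}\bigl(\Delta^m N(y-x)\bigr)\,\gamma(y)\,f(y)-\sum_{k=1}^m\int_{\partial B}\Bigl(\frac{\partial}{\partial n}\Delta^{m-k}N(y-x)\Bigr)\,D\Delta^{k-1}f(y)\,d\sigma_y+\sum_{k=1}^m\int_{\partial B}\bigl(\Delta^{m-k}N(y-x)\bigr)\,\frac{\partial}{\partial n}D\Delta^{k-1}f(y)\,d\sigma_y.$$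
   Context: $\mathbb{R}_{0,2m+1}$ is the Clifford algebra of a real vector space $V$ of dimension $2m+1$ with a negative definite quadratic form; $e_1,\dots,e_{2m+1}$ is an orthonormal basis of $V$ (so $e_i^2=-1$, $e_ie_j=-e_je_i$ for $i\ne j$, $i,j\geq 1$) and $e_0=1$. $S=\mathbb{R}$ is the space of scalars. A point $(x_0,\dots,x_{2m+1})\in\mathbb{R}^{2m+2}$ is identified with $x=\sum_{i=0}^{2m+1}e_ix_i\in S\oplus V\subset\mathbb{R}_{0,2m+1}$; $x^*=x_0-\sum_{i=1}^{2m+1}e_ix_i$, $xx^*=x^*x=|x|^2$ (Euclidean norm squared), so $x^{-1}=x^*/|x|^2$ for $x\neq0$. $D=\sum_{i=0}^{2m+1}e_i\frac{\partial}{\partial x_i}$ (acting from the left) and $\Delta=\sum_{i=0}^{2m+1}\frac{\partial^2}{\partial x_i^2}$. A function $f:\Omega\to\mathbb{R}_{0,2m+1}$, $\Omega\subset S\oplus V$ open, is (left) holomorphic Cliffordian in $\Omega$ if $D\Delta^mf=0$ on $\Omega$, where $\Delta^m$ is the $m$-times iterated Laplacian. $N(x)=\varepsilon_m\,x^{-1}$ for $x\neq 0$, with $\varepsilon_m=\dfrac{(-1)^m}{2^{2m+1}\,m!\,\pi^{m+1}}$. $\omega(y)=dy_0\wedge\cdots\wedge dy_{2m+1}$ and $\gamma(y)=\sum_{i=0}^{2m+1}(-1)^ie_i\,dy_0\wedge\cdots\wedge\widehat{dy_i}\wedge\cdots\wedge dy_{2m+1}$; $\partial B$ carries the orientation induced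 as boundary of $B$ (so $\gamma(y)$ restricts on $\partial B$ to $n(y)\,d\sigma_y$). $d\sigma_y$ is the surface measure on $\partial B$, $\partial/\partial n$ is the derivative with respect to $y$ along the outward unit normal, and all operators $\Delta$, $D$ in the integrals act in $y$. Products are taken in $\mathbb{R}_{0,2m+1}$ in the order written. *)

(* Defs.v *)
From HB Require Import structures.
From mathcomp Require Import all_boot all_order all_algebra.
Set Implicit Arguments.
Unset Strict Implicit.
Unset Printing Implicit Defensive.
Import Order.TTheory GRing.Theory Num.Theory.
Local Open Scope ring_scope.

Definition symdiff (T : finType) (A B : {set T}) := (A :\: B) :|: (B :\: A).

(* The Clifford algebra of a negative definite quadratic form on R^n: an element
   is its family of coordinates on the basis e_A = e_(i1) ... e_(ik), indexed by
   the subsets A = {i1 < ... < ik} of 'I_n. The products of basis vectors are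
   e_A e_B = +/- e_(A symdiff B); see cliff_gen_sqr, cliff_gen_anticomm and
   bladeE for the defining relations. Index i : 'I_n stands for e_(i+1). *)
Definition cliff (R : comNzRingType) (n : nat) := {ffun {set 'I_n} -> R^o}.

HB.instance Definition _ (R : comNzRingType) (n : nat) :=
  GRing.Lmodule.copy (cliff R n) {ffun {set 'I_n} -> R^o}.

Section cliff_ring.
Variables (R : comNzRingType) (n : nat).
Implicit Types (A B C : {set 'I_n}) (x y z : cliff R n).

Definition blade A : cliff R n := [ffun B => (B == A)%:R].

(* Exponent of -1 in e_A e_B: a pair j < i costs a transposition e_i e_j =
   - e_j e_i, and a pair j = i costs a square e_i^2 = -1. *)
Definition swap_count A B : nat := (\sum_(i in A) \sum_(j in B) (j <= i))%N.

Definition cliff_mul x y : cliff R n :=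
  \sum_A \sum_B (x A * y B * (-1) ^+ swap_count A B) *: blade (symdiff A B).

Lemma cliffE x : x = \sum_A x A *: blade A.
Proof.
apply/ffunP => B; rewrite sum_ffunE (bigD1 B) //= big1 ?addr0.
  by rewrite !ffunE eqxx [_ *: _]mulr1.
by move=> A neAB; rewrite !ffunE eq_sym (negbTE neAB) [_ *: _]mulr0.
Qed.

Lemma odd_sum_symdiff (T : finType) (g : T -> nat) (A B : {set T}) :
  odd (\sum_(i in symdiff A B) g i) =
  odd (\sum_(i in A) g i) (+) odd (\sum_(i in B) g i).
Proof.
rewrite -oddD (big_setID B (A := A)) (big_setID A (A := B)) /=.
rewrite (setIC B A) addnACA addnn oddD odd_double /=.
rewrite /symdiff (big_setID A) /=; congr (odd (_ + _)%N); apply: eq_bigl => i.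
  by rewrite !inE; do !case: (i \in _).
by rewrite !inE; do !case: (i \in _).
Qed.

Lemma odd_swap_countDl A B C :
  odd (swap_count (symdiff A B) C) =
  odd (swap_count A C) (+) odd (swap_count B C).
Proof. exact: odd_sum_symdiff. Qed.

Lemma odd_swap_countDr A B C :
  odd (swap_count A (symdiff B C)) =
  odd (swap_count A B) (+) odd (swap_count A C).
Proof.
by rewrite /swap_count exchange_big odd_sum_symdiff /=
  (exchange_big _ _ _ _ (mem B)) (exchange_big _ _ _ _ (mem C)).
Qed.

Lemma symdiffA (A B C : {set 'I_n}) :
  symdiff A (symdiff B C) = symdiff (symdiff A B) C.
Proof. by apply/setP => i; rewrite !inE; do !case: (i \in _). Qed.

Lemma cliff_mulDl : left_distributive cliff_mul +%R.
Proof.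
move=> x y z; rewrite -big_split; apply: eq_bigr => A _ /=.
by rewrite -big_split; apply: eq_bigr => B _ /=; rewrite ffunE !mulrDl scalerDl.
Qed.

Lemma cliff_mulDr : right_distributive cliff_mul +%R.
Proof.
move=> x y z; rewrite -big_split; apply: eq_bigr => A _ /=.
rewrite -big_split; apply: eq_bigr => B _ /=.
by rewrite ffunE mulrDr !mulrDl scalerDl.
Qed.

Lemma cliff_mulZl a x y : cliff_mul (a *: x) y = a *: cliff_mul x y.
Proof.
rewrite scaler_sumr; apply: eq_bigr => A _; rewrite scaler_sumr.
by apply: eq_bigr => B _; rewrite ffunE scalerA !mulrA.
Qed.

Lemma cliff_mulZr a x y : cliff_mul x (a *: y) = a *: cliff_mul x y.
Proof.
rewrite scaler_sumr; apply: eq_bigr => A _; rewrite scaler_sumr.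
by apply: eq_bigr => B _; rewrite ffunE scalerA !mulrA [x A * a]mulrC.
Qed.

Lemma cliff_mul0l x : cliff_mul 0 x = 0.
Proof. by rewrite -(scale0r (0 : cliff R n)) cliff_mulZl !scale0r. Qed.

Lemma cliff_mul0r x : cliff_mul x 0 = 0.
Proof. by rewrite -(scale0r (0 : cliff R n)) cliff_mulZr !scale0r. Qed.

Lemma cliff_mul_suml I (r : seq I) (P : pred I) (F : I -> cliff R n) y :
  cliff_mul (\sum_(i <- r | P i) F i) y = \sum_(i <- r | P i) cliff_mul (F i) y.
Proof.
exact: (big_morph (cliff_mul^~ y)
  (fun u v => cliff_mulDl u v y) (cliff_mul0l y)).
Qed.

Lemma cliff_mul_sumr I (r : seq I) (P : pred I) (F : I -> cliff R n) x :
  cliff_mul x (\sum_(i <- r | P i) F i) = \sum_(i <- r | P i) cliff_mul x (F i).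
Proof. exact: (big_morph _ (cliff_mulDr x) (cliff_mul0r x)). Qed.

Lemma cliff_mul_blade A B :
  cliff_mul (blade A) (blade B) = (-1) ^+ swap_count A B *: blade (symdiff A B).
Proof.
rewrite /cliff_mul (bigD1 A) //= [X in _ + X]big1 ?addr0 => [|A' neA].
  rewrite (bigD1 B) //= [X in _ + X]big1 ?addr0 => [|B' neB].
    by rewrite !ffunE !eqxx !mul1r.
  by rewrite !ffunE (negbTE neB) mulr0 mul0r scale0r.
by apply: big1 => B' _; rewrite !ffunE (negbTE neA) !mul0r scale0r.
Qed.

Lemma cliff_mulA : associative cliff_mul.
Proof.
move=> x y z; rewrite (cliffE x) (cliff_mul_suml _ _ _ (cliff_mul y z)).
rewrite (cliff_mul_suml _ _ _ y) (cliff_mul_suml _ _ _ z).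
apply: eq_bigr => A _.
rewrite !cliff_mulZl; congr (_ *: _).
rewrite (cliffE y) (cliff_mul_suml _ _ _ z) !(cliff_mul_sumr _ _ _ (blade A)).
rewrite (cliff_mul_suml _ _ _ z).
apply: eq_bigr => B _; rewrite cliff_mulZl !cliff_mulZr cliff_mulZl.
congr (_ *: _); rewrite (cliffE z) (cliff_mul_sumr _ _ _ (blade B)).
rewrite !(cliff_mul_sumr _ _ _ (blade A)).
rewrite (cliff_mul_sumr _ _ _ (cliff_mul (blade A) (blade B))).
apply: eq_bigr => C _.
rewrite !cliff_mulZr; congr (_ *: _).
rewrite !cliff_mul_blade cliff_mulZl cliff_mulZr !cliff_mul_blade !scalerA.
rewrite symdiffA -!exprD; congr (_ *: _).
rewrite -[LHS]signr_odd -[RHS]signr_odd !oddD odd_swap_countDl odd_swap_countDr.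
by case: (odd _) => /=; case: (odd _); case: (odd _).
Qed.

Lemma cliff_mul1l : left_id (blade set0) cliff_mul.
Proof.
move=> x; rewrite {1}(cliffE x) cliff_mul_sumr [RHS]cliffE.
apply: eq_bigr => A _; rewrite cliff_mulZr cliff_mul_blade.
by rewrite /swap_count big_set0 scale1r /symdiff set0D setD0 set0U.
Qed.

Lemma cliff_mul1r : right_id (blade set0) cliff_mul.
Proof.
move=> x; rewrite {1}(cliffE x) cliff_mul_suml [RHS]cliffE.
apply: eq_bigr => A _; rewrite cliff_mulZl cliff_mul_blade.
rewrite /swap_count big1 => [|i _]; last by rewrite big_set0.
by rewrite scale1r /symdiff set0D setD0 setU0.
Qed.

Lemma cliff_1_neq0 : blade set0 != 0.
Proof.
by apply/eqP => /ffunP/(_ set0)/eqP; rewrite !ffunE eqxx oner_eq0.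
Qed.

HB.instance Definition _ := GRing.Zmodule_isNzRing.Build (cliff R n)
  cliff_mulA cliff_mul1l cliff_mul1r cliff_mulDl cliff_mulDr cliff_1_neq0.

HB.instance Definition _ := GRing.Lmodule_isLalgebra.Build R (cliff R n)
  (fun a x y => esym (cliff_mulZl a x y)).

HB.instance Definition _ := GRing.Lalgebra_isAlgebra.Build R (cliff R n)
  (fun a x y => esym (cliff_mulZr a x y)).

Definition cliff_gen (i : 'I_n) : cliff R n := blade [set i].

Lemma cliff_gen_sqr i : cliff_gen i * cliff_gen i = - 1.
Proof.
rewrite /cliff_gen [LHS]cliff_mul_blade /swap_count !big_set1 leqnn expr1.
by rewrite scaleN1r /symdiff setDv setU0.
Qed.

Lemma cliff_gen_anticomm i j : i != j ->
  cliff_gen i * cliff_gen j = - (cliff_gen j * cliff_gen i).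
Proof.
move=> neij; rewrite /cliff_gen ![_ * _]cliff_mul_blade /swap_count !big_set1.
rewrite {2}/symdiff setUC -/(symdiff _ _).
by case: ltngtP neij => [_|_|/val_inj->];
  rewrite ?eqxx // !scaleN1r ?opprK !scale1r.
Qed.

Lemma bladeE A : blade A = \prod_(i <- enum A) cliff_gen i.
Proof.
have trO : transitive (relpre (@nat_of_ord n) ltn).
  by move=> ? ? ?; exact: ltn_trans.
have : sorted (relpre (@nat_of_ord n) ltn) (enum A).
  apply: sorted_filter => //.
  by rewrite -enumT -sorted_map val_enum_ord iota_ltn_sorted.
rewrite -[A in LHS]set_enum; elim: (enum A) => [|i s IHs].
  by rewrite big_nil (_ : [set:: [::]] = set0) //; apply/setP => i; rewrite !inE.
move=> /= ps; rewrite big_cons -IHs ?(path_sorted ps) // /cliff_gen.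
rewrite [RHS]cliff_mul_blade /swap_count big_set1 big1 => [|j]; last first.
  rewrite inE => js; have := order_path_min _ ps.
  by move=> /(_ trO)/allP/(_ j js) /=; rewrite ltnNge => /negbTE->.
rewrite scale1r; congr blade; apply/setP => j; rewrite !inE.
case: eqP => [->|]; rewrite ?andbF ?andbT //=.
have := order_path_min _ ps.
move=> /(_ trO)/allP/(_ i) /=.
by rewrite ltnn; case: (i \in s) => // /(_ isT).
Qed.
End cliff_ring.

From mathcomp Require Import all_classical all_reals all_analysis.
From mathcomp Require Import measurable_realfun.
Import numFieldNormedType.Exports.
Local Open Scope classical_set_scope.

Section borel.
Variable R : realType.

Section rV_measurable.
Variable n : nat.

(* 'rV[R]_n carries the sigma-algebra generated by the coordinates. *)
Definition rV_coord (i : 'I_n) (x : 'rV[R]_n) : measurableTypeR R := x 0 i.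

Let rV_set0 : g_sigma_preimage rV_coord set0.
Proof. exact: sigma_algebra0. Qed.

Let rV_setC A : g_sigma_preimage rV_coord A -> g_sigma_preimage rV_coord (~` A).
Proof. exact: sigma_algebraC. Qed.

Let rV_bigcup (F : (set 'rV[R]_n)^nat) :
  (forall i, g_sigma_preimage rV_coord (F i)) ->
  g_sigma_preimage rV_coord (\bigcup_i (F i)).
Proof. exact: sigma_algebra_bigcup. Qed.

HB.instance Definition _ :=
  @isMeasurable.Build (measure_tuple_display default_measure_display)
    'rV[R]_n (g_sigma_preimage rV_coord) rV_set0 rV_setC rV_bigcup.
End rV_measurable.

Definition rV_cons n (p : measurableTypeR R * 'rV[R]_n) : 'rV[R]_n.+1 :=
  \row_i oapp (fun j => p.2 0 j) p.1 (unlift ord0 i).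

Lemma measurable_rV_coord n i : measurable_fun setT (@rV_coord n i).
Proof.
move=> _ Y mY; rewrite setTI; apply: sub_sigma_algebra => /=.
rewrite -bigcup_seq/=; exists i => /=; first by rewrite mem_index_enum.
by exists Y => //; rewrite setTI.
Qed.

Lemma measurable_fun_rV d (T : measurableType d) n (f : T -> 'rV[R]_n) :
  (forall i, measurable_fun setT (fun t => f t 0 i : measurableTypeR R)) ->
  measurable_fun setT f.
Proof.
move=> mf.
have sub : g_sigma_preimage (fun i => @rV_coord n i \o f) `<=` measurable.
  apply: smallest_sub; first exact: sigma_algebra_measurable.
  by rewrite -bigcup_seq/=; apply: bigcup_sub => i _ A [B mB <-]; exact: mf.
move=> _ A mA; apply: sub; rewrite (g_sigma_preimage_comp (@rV_coord n)).
by exists A.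
Qed.

Definition rV_behead n (x : 'rV[R]_n.+1) : 'rV[R]_n :=
  \row_j x 0 (lift ord0 j).

Lemma measurable_rV_cons n : measurable_fun setT (@rV_cons n).
Proof.
apply: measurable_fun_rV => i.
rewrite (_ : (fun _ => _) =
    oapp (fun j => @rV_coord n j \o snd) fst (unlift ord0 i)).
  case: unliftP => [j|] _ /=; last exact: measurable_fst.
  by apply: measurableT_comp; [exact: measurable_rV_coord|
                               exact: measurable_snd].
by apply/funext => p; rewrite /= mxE; case: (unlift _ _).
Qed.

Lemma measurable_rV_behead n : measurable_fun setT (@rV_behead n).
Proof.
apply: measurable_fun_rV => i.
under eq_fun do rewrite mxE.
exact: (measurable_rV_coord (lift ord0 i)).
Qed.

Section step.
Variables (n : nat) (mu : {sigma_finite_measure set 'rV[R]_n -> \bar R}).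

(* Product of the Lebesgue measure on R and of mu, moved to 'rV[R]_n.+1. *)
Definition leb_cons : set 'rV[R]_n.+1 -> \bar R :=
  pushforward (lebesgue_measure \x mu)%E (@rV_cons n).

Let leb_cons0 : leb_cons set0 = 0%E.
Proof. by have mf := @measurable_rV_cons n; exact: measure0. Qed.

Let leb_cons_ge0 A : (0 <= leb_cons A)%E.
Proof. by have mf := @measurable_rV_cons n; exact: measure_ge0. Qed.

Let leb_cons_sigma_additive : semi_sigma_additive leb_cons.
Proof.
have mf := @measurable_rV_cons n; exact: measure_semi_sigma_additive.
Qed.

HB.instance Definition _ := isMeasure.Build _ _ _ leb_cons
  leb_cons0 leb_cons_ge0 leb_cons_sigma_additive.

Let leb_cons_sigma_finite : sigma_finite setT leb_cons.
Proof.
have /sigma_finiteP[F [TF ndF Foo]] := sigma_finiteT (@lebesgue_measure R).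
have /sigma_finiteP[G [TG ndG Goo]] := sigma_finiteT mu.
exists (fun k => rV_coord ord0 @^-1` F k `&` @rV_behead n @^-1` G k).
  rewrite predeqE => x; split=> // _.
  have [i _ Fi] : (\bigcup_k F k) (rV_coord ord0 x) by rewrite -TF.
  have [j _ Gj] : (\bigcup_k G k) (rV_behead x) by rewrite -TG.
  exists (maxn i j) => //; split.
  - by have /subsetPset := ndF _ _ (leq_maxl i j); exact.
  - by have /subsetPset := ndG _ _ (leq_maxr i j); exact.
move=> k; have [mF Fk] := Foo k; have [mG Gk] := Goo k; split.
  by apply: measurableI; rewrite -[X in measurable X]setTI;
    [exact: measurable_rV_coord|exact: measurable_rV_behead].
rewrite /leb_cons /pushforward.
rewrite (_ : _ @^-1` _ = F k `*` G k); last first.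
  have consE t u : rV_behead (@rV_cons n (t, u)) = u.
    by apply/rowP => j; rewrite !mxE liftK.
  apply/funext => -[t u] /=.
  by rewrite /preimage /= consE /rV_coord mxE unlift_none.
by rewrite product_measure1E// lte_mul_pinfty// ge0_fin_numE.
Qed.

HB.instance Definition _ := Measure_isSigmaFinite.Build _ _ _ leb_cons
  leb_cons_sigma_finite.
End step.

Fixpoint lebesgue_rV n : {sigma_finite_measure set 'rV[R]_n -> \bar R} :=
  match n with
  | 0 => \d_(0 : 'rV[R]_0)
  | n.+1 => leb_cons (lebesgue_rV n)
  end.
End borel.

Section sphere_measure.
Variables (R : realType) (n : nat).
Implicit Types (x : 'rV[R]_n) (A : set 'rV[R]_n).

(* The norm provided by the library on 'rV[R]_n is the sup norm; it is used for
   the topology only. *)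
Definition enorm x : R := Num.sqrt (\sum_i x 0 i ^+ 2).

Definition unit_ball : set 'rV[R]_n := [set x | enorm x <= 1].

Definition unit_sphere : set 'rV[R]_n := [set x | enorm x = 1].

Definition radial_proj x : 'rV[R]_n := (enorm x)^-1 *: x.

Definition punctured_ball : set 'rV[R]_n := [set x | 0 < enorm x <= 1].

(* Surface measure of the unit sphere of R^n: n times the Lebesgue measure of the
   cone {t a | a in A, 0 < t <= 1}, the normalization for which polar coordinates
   read dx = r^(n-1) dr dsigma. *)
Definition sphere_measure A : \bar R :=
  (n%:R%:E * lebesgue_rV R n (punctured_ball `&` radial_proj @^-1` A))%E.

Lemma measurable_enorm : measurable_fun setT enorm.
Proof.
apply: (@measurableT_comp _ _ _ _ _ _ (@Num.sqrt R)).
  by apply: continuous_measurable_fun => t; exact: sqrt_continuous.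
by apply: measurable_sum => i; apply: measurable_funX;
  exact: measurable_rV_coord.
Qed.

Lemma measurable_radial_proj : measurable_fun setT radial_proj.
Proof.
apply: measurable_fun_rV => i.
under eq_fun do rewrite mxE -powR_inv1 ?sqrtr_ge0//.
apply: measurable_funM; last exact: measurable_rV_coord.
exact: (measurableT_comp (measurable_powR _) measurable_enorm).
Qed.

Lemma measurable_punctured_ball : measurable punctured_ball.
Proof.
rewrite (_ : punctured_ball = setT `&` enorm @^-1` `]0, 1]%classic).
  by apply: measurable_enorm => //; exact: measurable_itv.
by apply/seteqP; split => x /=; rewrite /punctured_ball /= in_itv /= => // -[].
Qed.

Let mpre A : measurable A ->
  measurable (punctured_ball `&` radial_proj @^-1` A).
Proof.
move=> mA; apply: measurableI; first exact: measurable_punctured_ball.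
by rewrite -[X in measurable X]setTI; exact: measurable_radial_proj.
Qed.

Let sphere_measure0 : sphere_measure set0 = 0%E.
Proof. by rewrite /sphere_measure preimage_set0 setI0 measure0 mule0. Qed.

Let sphere_measure_ge0 A : (0 <= sphere_measure A)%E.
Proof. by rewrite mule_ge0// lee_fin. Qed.

Let sphere_measure_sigma_additive : semi_sigma_additive sphere_measure.
Proof.
move=> F mF tF mUF; rewrite /sphere_measure preimage_bigcup setI_bigcupr.
under eq_fun do rewrite -ge0_sume_distrr//.
apply: cvgeZl => //; apply: measure_semi_sigma_additive.
- by move=> i; exact: mpre.
- apply/trivIsetP => i j _ _ ij; rewrite setIACA setIid -preimage_setI.
  by move/trivIsetP : tF => /(_ _ _ _ _ ij) ->//; rewrite preimage_set0 setI0.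
- by rewrite -setI_bigcupr -preimage_bigcup; exact: mpre.
Qed.

HB.instance Definition _ := isMeasure.Build _ _ _ sphere_measure
  sphere_measure0 sphere_measure_ge0 sphere_measure_sigma_additive.
End sphere_measure.
Arguments unit_ball : clear implicits.
Arguments unit_sphere : clear implicits.
Arguments sphere_measure : clear implicits.

Section clifford_analysis.
Variables (R : realType) (n : nat).
Implicit Types (x y v : 'rV[R]_n.+1) (f : 'rV[R]_n.+1 -> cliff R n).

(* e_0 = 1, e_1, ..., e_n *)
Definition cliff_basis (i : 'I_n.+1) : cliff R n :=
  oapp (@cliff_gen R n) 1 (unlift ord0 i).

Definition paravector_conj x : cliff R n :=
  x 0 ord0 *: 1 - \sum_(i < n) x 0 (lift ord0 i) *: cliff_gen R i.

(* (x_0 + e_1 x_1 + ... + e_n x_n)^-1 = x^* / |x|^2 for x != 0 *)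
Definition paravector_inv x : cliff R n :=
  (enorm x ^+ 2)^-1 *: paravector_conj x.

(* Functions into the Clifford algebra are differentiated and integrated
   coordinatewise. *)
Definition cderive v f x : cliff R n := [ffun A => 'D_v (fun y => f y A : R) x].

Definition cpartial i f x : cliff R n := cderive (delta_mx 0 i) f x.

Fixpoint classC k f : Prop :=
  (forall A, continuous (fun y => f y A : R)) /\
  match k with
  | 0 => True
  | k'.+1 =>
    (forall A i x, derivable (fun y => f y A : R) x (delta_mx 0 i)) /\
    (forall i, classC k' (cpartial i f))
  end.

Definition dirac_op f x : cliff R n := \sum_i cliff_basis i * cpartial i f x.

Definition laplacian f x : cliff R n := \sum_i cpartial i (cpartial i f) x.

Definition laplacian_iter k f := iter k laplacian f.

Definition cintegral (mu : {measure set 'rV[R]_n.+1 -> \bar R})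
    (D : set 'rV[R]_n.+1) f : cliff R n :=
  [ffun A => \int[mu]_(y in D) (f y A : R)].

(* Outward unit normal at a point of the unit sphere. *)
Definition outer_normal y : 'rV[R]_n.+1 := y.

Definition normal_derive f y : cliff R n := cderive (outer_normal y) f y.

(* The rows of V are an orthonormal basis of the tangent space of the unit sphere
   at y, positive for the orientation induced as boundary of the ball (outward
   normal first). *)
Definition oriented_frame y (V : 'M[R]_(n, n.+1)) :=
  [/\ V *m V^T = 1%:M, V *m (outer_normal y)^T = 0 &
      0 < \det (col_mx (outer_normal y) V : 'M[R]_n.+1)].

Definition tangent_frame y : 'M[R]_(n, n.+1) := xget 0 (oriented_frame y).

(* Integral over the oriented unit sphere of a differential form w of degree n on
   R^(n+1): w y V is the value of w at y on the tangent vectors given by the rows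
   of V, and w restricts to the density w(positive orthonormal frame) dsigma. The
   value of an alternating n-form does not depend on the choice of the frame. *)
Definition sphere_form_integral
    (w : 'rV[R]_n.+1 -> 'M[R]_(n, n.+1) -> cliff R n) : cliff R n :=
  cintegral (sphere_measure R n.+1) (unit_sphere R n.+1)
    (fun y => w y (tangent_frame y)).

(* gamma = sum_i (-1)^i e_i dy_0 /\ ... (omitting dy_i) ... /\ dy_n, evaluated on
   the rows of V: deleting column i and taking the determinant evaluates the wedge
   product of the other dy_j. *)
Definition gamma_form (V : 'M[R]_(n, n.+1)) : cliff R n :=
  \sum_(i < n.+1) ((-1) ^+ i * \det (col' i V)) *: cliff_basis i.
End clifford_analysis.

Definition epsilon (R : realType) (m : nat) : R :=
  (-1) ^+ m / (2 ^+ m.*2.+1 * m`!%:R * pi ^+ m.+1).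

Definition kernel_N (R : realType) (m : nat) (x : 'rV[R]_m.*2.+2) :
    cliff R m.*2.+1 := epsilon R m *: paravector_inv x.

Definition holomorphic_cliffordian (R : realType) (m : nat)
    (Omega : set 'rV[R]_m.*2.+2) (f : 'rV[R]_m.*2.+2 -> cliff R m.*2.+1) :=
  forall x, Omega x -> dirac_op (laplacian_iter m f) x = 0.

(* Main.v *)
Require Import Defs.
From mathcomp Require Import all_boot all_order all_algebra.
From mathcomp Require Import all_classical all_reals all_analysis.
From mathcomp Require Import measurable_realfun ring lra.
Set Implicit Arguments.
Unset Strict Implicit.
Unset Printing Implicit Defensive.
Import Order.TTheory GRing.Theory Num.Theory.
Import numFieldNormedType.Exports.
Local Open Scope classical_set_scope.
Local Open Scope ring_scope.

(** Up to a constant, [Delta^j N(y - x)] is the sum over [i] of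
    [z_i |z|^(-2j-2) e_i^*] with [z = y - x], because
    [Delta (z_i |z|^(-2p-2)) = 4 (p+1) (p-m) z_i |z|^(-2p-4)].  Replacing [|z|^2]
    by [|z|^2 + e] makes these kernels smooth, and Gauss' theorem on the ball
    applies to them; as [e -> 0] everything converges dominatedly, since all the
    singularities in the volume integrals are [O(|z|^(1-dim))].
    For [j = m] the products [e_i^* e_l], antisymmetric off the diagonal, leave
    only the divergence of the regularized kernel, an approximate identity of
    mass the area of the sphere: this is a Cauchy-Pompeiu formula.  For [j < m]
    one gets Green's second identity for the kernel and [D Delta^(k-1) f].  As
    [D] and [Delta] commute (symmetry of mixed partial derivatives), the
    volume terms of these identities telescope.  The constant is right because
    [epsilon_m (-4)^m m!^2 |S| = 1], where the area [|S|] comes from the Gaussian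
    integral.  Gauss' theorem on the ball follows from the translation invariance
    of the Lebesgue measure applied to a cut-off function, the derivative of the
    cut-off concentrating on the sphere. *)

(** * Lebesgue measure on row vectors *)

Section borel_rV.
Variable R : realType.

(** The kernel is regularized, rather than a small ball around [x] cut out, so that Gauss' theorem
    is needed on the unit ball only. The obstacle is that first derivatives of Delta^m N have size
    |z|^(-dim), not integrable at [x]: in the limit, derivatives of the kernels may survive only on
    the sphere, at positive distance from [x]. In Green's identity the products of first derivatives
    cancel at fixed e; what remains in the ball is the kernel of order j and its Laplacian, both
    bounded by a multiple of |z|^(1-dim) when j < m. For j = m that bound on the Laplacian fails,
    and a single divergence is used instead: the matrix of first derivatives of the regularized
    kernel is symmetric, the algebra removes its off-diagonal part at fixed e, and its trace carries
    an explicit factor e. The index k counts the Laplacians moved from N to f: the telescoping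
    starts at the volume term of the Cauchy-Pompeiu formula and ends at that of the statement.
    Everything is done for one coordinate of the Clifford algebra at a time, left multiplication by
    e_i^* being a constant real matrix. *)

Lemma measurable_open_rV n (U : set 'rV[R]_n) : open U -> measurable U.
Proof.
move=> oU.
(* The sigma-algebra is generated by the coordinates, so open sets must be exhausted by countably
   many boxes: rational centre, radius 1/(k+1). *)
pose box (p : 'rV[rat]_n * nat) : set 'rV[R]_n :=
  [set x | forall i, `|x 0 i - ratr (p.1 0 i)| < p.2.+1%:R^-1].
have mbox p : measurable (box p).
  have -> : box p = \bigcap_(i in [set: 'I_n])
      (setT `&` rV_coord i @^-1` ball (ratr (p.1 0 i) : R) p.2.+1%:R^-1).
    apply/seteqP; split => x.
      move=> bx i _; split => //; rewrite /= /ball /= distrC.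
      exact: bx.
    by move=> bx i; have [_] := bx i Logic.I; rewrite /= /ball /= distrC.
  apply: fin_bigcap_measurable => // i _.
  apply: measurable_rV_coord => //.
  by apply: open_measurable; exact: ball_open.
pose F k : set 'rV[R]_n :=
  if unpickle k is Some p then
    if asbool (box p `<=` U) then box p else set0 else set0.
have -> : U = \bigcup_k F k.
  apply/seteqP; split => x; last first.
    move=> [k _]; rewrite /F; case: (unpickle k) => [p|]//.
    by case: asboolP => // sub /sub.
  move=> Ux; have /nbhs_ballP[e /= e0 eU] := open_nbhs_nbhs (conj oU Ux).
  have e2 : 0 < e / 2 by rewrite divr_gt0.
  have [k _ kP] := (near_infty_natSinv_lt (PosNum e2)).
  have {}kP := kP k (leqnn k).
  have k0 : 0 < k.+1%:R^-1 :> R by rewrite invr_gt0.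
  have qP i : exists q : rat, `|x 0 i - ratr q| < k.+1%:R^-1.
    have : x 0 i < x 0 i + k.+1%:R^-1 by rewrite ltrDl.
    move=> /rat_in_itvoo[q]; rewrite in_itv/= => /andP[q1 q2].
    by exists q; rewrite ler0_norm ?subr_le0 1?ltW// opprB ltrBlDl.
  pose q : 'rV[rat]_n := \row_i xchoose (qP i).
  have qE i : `|x 0 i - ratr (q 0 i)| < k.+1%:R^-1.
    by rewrite /q mxE; exact: (xchooseP (qP i)).
  have sub : box (q, k) `<=` U.
    move=> y yb; apply: eU; split => // i j; rewrite ord1 /ball /=.
    rewrite -(subrKA (ratr (q 0 j))) (le_lt_trans (ler_normD _ _))//.
    rewrite (splitr e) ltrD//; first exact: lt_trans (qE j) kP.
    by rewrite distrC; exact: lt_trans (yb j) kP.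
  exists (pickle (q, k)) => //; rewrite /F pickleK.
  by case: asboolP => // _ i; exact: qE.
apply: bigcupT_measurable => k; rewrite /F.
by case: (unpickle k) => [p|]//; case: asboolP.
Qed.

Lemma measurable_continuous_rV n (f : 'rV[R]_n -> R) : continuous f ->
  measurable_fun setT (f : _ -> measurableTypeR R).
Proof.
move=> cf; apply: (measurability _ (RGenOpens.measurableE R)).
move=> _ [_ [a [b ->] <-]]; rewrite setTI; apply: measurable_open_rV.
by move/continuousP : cf; apply; exact: interval_open.
Qed.

End borel_rV.


(** * Affine changes of variables *)

Section affine.
Variable R : realType.
Local Notation mR := (measurableTypeR R).

Lemma measurable_fun_affine (r b : R) :
  measurable_fun setT ((fun x => r * x + b) : mR -> mR).
Proof. by apply: measurable_funD => //; exact: measurable_funM. Qed.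

(** Uniqueness of the Lebesgue measure: [r] times the image measure agrees with it on half-open
    intervals. *)
Lemma lebesgue_measure_affine (r b : R) (A : set mR) : 0 < r -> measurable A ->
  pushforward lebesgue_measure ((fun x => r * x + b) : mR -> mR) A =
  ((r^-1)%:E * lebesgue_measure A)%E.
Proof.
move=> r0 mA; have mphi := measurable_fun_affine r b.
have -> : lebesgue_measure A =
    mscale (NngNum (ltW r0)) (pushforward lebesgue_measure
      ((fun x => r * x + b) : mR -> mR)) A.
  move=> mphi'; apply: lebesgue_measure_unique => //= _ [[x y]] _ <-.
  change (lebesgue_measure (`]x, y]%classic : set mR) = (r%:E *
    lebesgue_measure ((fun t : mR => (r * t + b)%R) @^-1` `]x, y]%classic))%E).
  have -> : (fun t : mR => r * t + b) @^-1` `]x, y]%classic =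
      `](x - b) / r, (y - b) / r]%classic.
    apply/seteqP; split => t /=;
    by rewrite !in_itv/= ltr_pdivrMr// ler_pdivlMr// mulrC ltrBlDr lerBrDr.
  rewrite !lebesgue_measure_itv/= !lte_fin ltr_pM2r ?invr_gt0// ltrD2r.
  case: ifPn => _; last by rewrite mule0.
  by rewrite -!EFinD -EFinM; congr (_%:E); field; rewrite gt_eqF.
by rewrite /mscale muleA -EFinM mulVf ?gt_eqF// mul1e.
Qed.

(** Induction on the dimension by slicing along the first coordinate: the induction hypothesis
    treats the slices, the one-dimensional case the outer integral. *)
Lemma lebesgue_rV_affine n (r : R) (b : 'rV[R]_n) (A : set 'rV[R]_n) :
  0 < r -> measurable A ->
  lebesgue_rV R n ((fun x => r *: x + b) @^-1` A) =
  ((r ^- n)%:E * lebesgue_rV R n A)%E.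
Proof.
move=> r0; elim: n b A => [|n IHn] b A mA.
  rewrite /= expr0 invr1 mul1e /dirac !indicE; congr (_%:E).
  by rewrite (_ : _ @^-1` A = A)//; apply/seteqP; split => x /=;
    rewrite !thinmx0.
pose C := @rV_cons R n @^-1` A.
have mC : measurable C by rewrite -[C]setTI; exact: measurable_rV_cons.
pose b' := rV_behead b.
rewrite /= /leb_cons /pushforward.
have -> : @rV_cons R n @^-1` ((fun x => r *: x + b) @^-1` A) =
   (fun p => (r * p.1 + b 0 ord0, r *: p.2 + b')) @^-1` C.
  apply/funext => -[t u]; rewrite /C /preimage/=; congr A.
  apply/rowP => i; rewrite !mxE.
  by case: unliftP => [j|] -> /=; rewrite ?mxE.
have mA' : measurable_fun setT
    (fun t : mR => lebesgue_rV R n (xsection C t)).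
  exact: measurable_fun_xsection.
have mphi := measurable_fun_affine r (b 0 ord0).
transitivity (\int[lebesgue_measure]_(t in setT)
    ((r ^- n)%:E * lebesgue_rV R n (xsection C (r * t + b 0 ord0)%R)))%E.
  apply: eq_integral => t _ /=.
  rewrite -(IHn b'); last exact: measurable_xsection.
  by congr (lebesgue_rV R n _).
rewrite ge0_integralZl//; last 2 first.
- exact: (measurableT_comp mA' mphi).
- by rewrite lee_fin invr_ge0 exprn_ge0// ltW.
rewrite -(@ge0_integral_pushforward _ _ _ _ _ _ mphi lebesgue_measure setT
  (fun t => lebesgue_rV R n (xsection C t)))//.
have r0' : 0 < r^-1 by rewrite invr_gt0.
rewrite (@eq_measure_integral _ _ _ _ (mscale (NngNum (ltW r0')) lebesgue_measure)); last first.
  move=> B mB _.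
  by have := lebesgue_measure_affine (b 0 ord0) r0 mB.
rewrite ge0_integral_mscale//=.
by rewrite muleA -EFinM exprSr invfM mulrC.
Qed.
End affine.

(** * Transport of integrals along a map *)

Section transfer_integral.
Context d1 d2 (X : measurableType d1) (Y : measurableType d2) (R : realType).
Variables (mu : {measure set X -> \bar R}) (nu : {measure set Y -> \bar R}).
Variables (D : set Y) (E : set X) (phi : X -> Y) (c : R).
Hypotheses (mD : measurable D) (mE : measurable E) (c0 : 0 < c).
Hypothesis phiE : forall x, E x -> D (phi x).
Hypothesis mphi : measurable_fun E phi.
Hypothesis H : forall f : Y -> \bar R, measurable_fun D f ->
  (forall y, D y -> (0 <= f y)%E) ->
  (\int[nu]_(y in D) f y = c%:E * \int[mu]_(x in E) f (phi x))%E.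

(** Common to affine maps and to polar coordinates: [H] for nonnegative functions, applied to |f|,
    transfers finiteness in both directions because [c] is positive; positive and negative parts
    then give the signed integrals. *)
Lemma integrable_transfer (f : Y -> \bar R) : measurable_fun D f ->
  nu.-integrable D f <-> mu.-integrable E (f \o phi).
Proof.
move=> mf; have mfE : measurable_fun E (f \o phi).
  apply: (measurable_comp mD) => //.
  by move=> _ [x Ex <-]; exact: phiE.
have HA : (\int[nu]_(y in D) `|f y| = c%:E * \int[mu]_(x in E) `|f (phi x)|)%E.
  by rewrite H//; exact: measurableT_comp.
split=> /integrableP[_ foo]; apply/integrableP; split => //.
  move: foo; rewrite HA /=; set I := (\int[mu]_(x in E) _)%E.
  have I0 : (0 <= I)%E by exact: integral_ge0.
  
  by rewrite !ltey; apply: contra => /eqP ->; rewrite gt0_muley// lte_fin.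
by rewrite HA lte_mul_pinfty// lee_fin ltW.
Qed.

Lemma Rintegral_transfer (f : Y -> R) : nu.-integrable D (EFin \o f) ->
  \int[nu]_(y in D) f y = c * \int[mu]_(x in E) f (phi x).
Proof.
move=> intf; have mf := measurable_int _ intf.
have intE : mu.-integrable E (EFin \o (f \o phi)).
  by apply/(@integrable_transfer (EFin \o f)).
rewrite /Rintegral -[c]/(fine c%:E) -fineM//; last first.
  exact: integrable_fin_num.
congr fine; rewrite integralE [in RHS]integralE muleBr//; last first.
  apply: fin_num_adde_defl; rewrite fin_numN.
  exact: integrable_neg_fin_num.
have Hp := H (measurable_funepos mf) (fun y _ => funepos_ge0 _ y).
have Hn := H (measurable_funeneg mf) (fun y _ => funeneg_ge0 _ y).
rewrite [X in (X - _)%E = _]Hp.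
rewrite [X in (_ - X)%E = _]Hn.
by congr (_ * _ - _ * _)%E; apply: eq_integral => x _;
  rewrite ?funeposE ?funenegE.
Qed.
End transfer_integral.

Lemma ge0_integral_pushforward_scale d1 d2 (X : measurableType d1)
    (Y : measurableType d2) (R : realType) (mu : {measure set X -> \bar R})
    (nu : {measure set Y -> \bar R}) (phi : X -> Y) (c : R) (D : set Y)
    (f : Y -> \bar R) :
  0 <= c -> measurable_fun setT phi -> measurable D ->
  (forall A, measurable A -> A `<=` D ->
    nu A = (c%:E * mu (phi @^-1` A))%E) ->
  measurable_fun D f -> (forall y, D y -> (0 <= f y)%E) ->
  (\int[nu]_(y in D) f y = c%:E * \int[mu]_(x in phi @^-1` D) f (phi x))%E.
Proof.
move=> c0 mphi mD nuE mf f0.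
have fin0 : {in D, forall y, (0 <= f y)%E} by move=> y /set_mem; exact: f0.
rewrite -[X in _ = (_ * X)%E](ge0_integral_pushforward mphi mu mD mf fin0).
rewrite -[c]/((NngNum c0)%:num) -ge0_integral_mscale//.
by apply: eq_measure_integral => A mA AD; exact: nuE.
Qed.

(** * Balls for the Euclidean norm *)

Section balls.
Variable R : realType.

Definition ssq n (x : 'rV[R]_n) : R := \sum_i x 0 i ^+ 2.

Lemma ssq_ge0 n (x : 'rV[R]_n) : 0 <= ssq x.
Proof. by apply: sumr_ge0 => i _; exact: sqr_ge0. Qed.

Lemma enorm_sqr n (x : 'rV[R]_n) : enorm x ^+ 2 = ssq x.
Proof. by rewrite sqr_sqrtr// ssq_ge0. Qed.

Lemma enorm_ge0 n (x : 'rV[R]_n) : 0 <= enorm x.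
Proof. exact: sqrtr_ge0. Qed.

Lemma enormZ n (r : R) (x : 'rV[R]_n) : enorm (r *: x) = `|r| * enorm x.
Proof.
rewrite /enorm -sqrtr_sqr -sqrtrM ?sqr_ge0// mulr_sumr; congr Num.sqrt.
by apply: eq_bigr => i _; rewrite mxE exprMn.
Qed.

Lemma ssq_eq0 n (x : 'rV[R]_n) : (ssq x == 0) = (x == 0).
Proof.
apply/eqP/eqP => [/psumr_eq0P x0|->].
  apply/rowP => i; rewrite mxE; apply/eqP.
  by rewrite -[_ == _](expf_eq0 _ 2) x0// => ? _; exact: sqr_ge0.
by rewrite /ssq big1// => i _; rewrite mxE expr0n.
Qed.

Lemma enorm_eq0 n (x : 'rV[R]_n) : (enorm x == 0) = (x == 0).
Proof. by rewrite -sqrf_eq0 enorm_sqr ssq_eq0. Qed.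

Lemma enorm_le_ssq n (x : 'rV[R]_n) r : 0 <= r -> (enorm x <= r) = (ssq x <= r ^+ 2).
Proof. by move=> r0; rewrite -enorm_sqr ler_sqr ?nnegrE ?enorm_ge0. Qed.

Lemma enorm_lt_ssq n (x : 'rV[R]_n) r : 0 <= r -> (enorm x < r) = (ssq x < r ^+ 2).
Proof. by move=> r0; rewrite -enorm_sqr ltr_sqr ?nnegrE ?enorm_ge0. Qed.

Definition eball n (r : R) : set 'rV[R]_n := [set x | enorm x <= r].

Lemma measurable_ssq n : measurable_fun setT (@ssq n).
Proof.
by apply: measurable_sum => i; apply: measurable_funX;
  exact: measurable_rV_coord.
Qed.

Lemma measurable_eball n r : measurable (@eball n r).
Proof.
rewrite (_ : eball r = setT `&` @enorm R n @^-1` `]-oo, r]%classic).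
  by apply: measurable_enorm => //; exact: measurable_itv.
by apply/seteqP; split => x /=; rewrite /eball /= in_itv //= => -[].
Qed.

(** The unit ball lies in the product of [-1, 1] and the unit ball of one dimension less. *)
Lemma lebesgue_unit_ball_lty n : (lebesgue_rV R n (eball 1) < +oo)%E.
Proof.
elim: n => [|n IHn]; first by rewrite /= /dirac indicE ltry.
rewrite /= /leb_cons /pushforward.
have mI : measurable (`[-1, 1]%classic : set (measurableTypeR R)) by [].
have mB := @measurable_eball n 1.
apply: (@le_lt_trans _ _ ((lebesgue_measure \x lebesgue_rV R n)
    (`[(-1)%R, 1%R]%classic `*` @eball n 1))%E).
  apply: le_measure; rewrite ?inE.
  - by rewrite -[X in measurable X]setTI; apply: measurable_rV_cons => //;
      exact: measurable_eball.
  - exact: measurableX.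
  - move=> [t u]; rewrite /eball /= enorm_le_ssq// expr1n => tu1.
    have : t ^+ 2 + ssq u <= 1.
      apply: le_trans tu1; rewrite /ssq big_ord_recl !mxE unlift_none lerD2l.
      by apply: ler_sum => i _; rewrite !mxE liftK.
    move=> {}tu1; rewrite enorm_le_ssq// expr1n; split.
      rewrite in_itv /= -ler_norml -(@expr_le1 _ 2)// real_normK ?num_real//.
      by apply: le_trans tu1; rewrite lerDl ssq_ge0.
    by apply: le_trans tu1; rewrite lerDr sqr_ge0.
rewrite product_measure1E// lte_mul_pinfty//.
by rewrite ge0_fin_numE// /= lebesgue_measure_itv/=; case: ifP => // _; rewrite ltry.
Qed.

End balls.

Section affine_integral.
Variables (R : realType) (n : nat).
Local Notation lam := (lebesgue_rV R n).

Lemma measurable_affine_rV (r : R) (b : 'rV[R]_n) :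
  measurable_fun setT (fun x : 'rV[R]_n => r *: x + b).
Proof.
apply: measurable_fun_rV => i.
under eq_fun do rewrite !mxE.
by apply: measurable_funD => //; apply: measurable_funM => //;
  exact: measurable_rV_coord.
Qed.

Variables (r : R) (b : 'rV[R]_n) (D : set 'rV[R]_n).
Hypotheses (r0 : 0 < r) (mD : measurable D).
Let phi x := r *: x + b.

Lemma measurable_preimage_affine : measurable (phi @^-1` D).
Proof. by rewrite -[X in measurable X]setTI; exact: measurable_affine_rV. Qed.

Lemma ge0_integral_affine (f : 'rV[R]_n -> \bar R) : measurable_fun D f ->
  (forall y, D y -> (0 <= f y)%E) ->
  (\int[lam]_(y in D) f y =
   (r ^+ n)%:E * \int[lam]_(x in phi @^-1` D) f (phi x))%E.
Proof.
move=> mf f0; apply: ge0_integral_pushforward_scale => //.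
- by rewrite exprn_ge0// ltW.
- exact: measurable_affine_rV.
- move=> A mA _; rewrite [X in _ = (_ * X)%E](lebesgue_rV_affine b r0 mA).
  by rewrite muleA -EFinM divff ?mul1e// expf_neq0// gt_eqF.
Qed.

Lemma integrable_affine (f : 'rV[R]_n -> \bar R) : measurable_fun D f ->
  lam.-integrable D f <-> lam.-integrable (phi @^-1` D) (f \o phi).
Proof.
move=> mf; apply: (@integrable_transfer _ _ _ _ _ _ _ D _ phi (r ^+ n)) => //.
- by rewrite exprn_gt0.
- exact: measurable_funTS (measurable_affine_rV r b).
- exact: ge0_integral_affine.
Qed.

Lemma Rintegral_affine (f : 'rV[R]_n -> R) : lam.-integrable D (EFin \o f) ->
  \int[lam]_(y in D) f y = r ^+ n * \int[lam]_(x in phi @^-1` D) f (phi x).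
Proof.
apply: Rintegral_transfer => //.
- exact: measurable_preimage_affine.
- by rewrite exprn_gt0.
- exact: measurable_funTS (measurable_affine_rV r b).
- exact: ge0_integral_affine.
Qed.

End affine_integral.

(** * Integrals over the sphere *)

Section sphere_integral.
Variables (R : realType) (n : nat).
Local Notation lam := (lebesgue_rV R n.+1).
Local Notation sigma := (sphere_measure R n.+1).
Local Notation S := (unit_sphere R n.+1).

Lemma measurable_unit_sphere : measurable S.
Proof.
rewrite (_ : S = setT `&` @enorm R n.+1 @^-1` [set 1]).
  by apply: measurable_enorm => //; exact: measurable_set1.
by apply/seteqP; split => x //= -[].
Qed.

Lemma enorm_radial_proj (x : 'rV[R]_n.+1) : x != 0 -> enorm (radial_proj x) = 1.
Proof.
move=> x0; rewrite /radial_proj enormZ ger0_norm ?invr_ge0 ?enorm_ge0//.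
by rewrite mulVf// enorm_eq0.
Qed.

(* Extends the radial projection by 0, a point off the sphere. *)
Let psi (x : 'rV[R]_n.+1) : 'rV[R]_n.+1 :=
  \1_(@punctured_ball R n.+1) x *: radial_proj x.

Let mpsi : measurable_fun setT psi.
Proof.
apply: measurable_fun_rV => i.
under eq_fun do rewrite mxE.
apply: measurable_funM.
  by apply: measurable_indic; exact: measurable_punctured_ball.
exact: (measurableT_comp (measurable_rV_coord i)
         (@measurable_radial_proj R n.+1)).
Qed.

Let psiE (A : set 'rV[R]_n.+1) : A `<=` S ->
  psi @^-1` A = @punctured_ball R n.+1 `&` @radial_proj R n.+1 @^-1` A.
Proof.
move=> AS; apply/seteqP; split => x /=; rewrite /psi indicE.
  case: (boolP (x \in _)) => [xb|xb]; last first.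
    rewrite scale0r => /AS; rewrite /unit_sphere /= => /eqP.
    by rewrite (eqP (_ : enorm 0 == 0)) ?enorm_eq0// eq_sym oner_eq0.
  by rewrite scale1r; move: xb; rewrite inE.
by move=> [xb Ax]; rewrite mem_set// scale1r.
Qed.

(** On subsets of the sphere, [sphere_measure] is [n.+1] times the image of [lam] under [psi], since
    the cone over a set is its preimage. *)
Lemma ge0_integral_sphere (f : 'rV[R]_n.+1 -> \bar R) : measurable_fun S f ->
  (forall y, S y -> (0 <= f y)%E) ->
  (\int[sigma]_(y in S) f y =
   n.+1%:R%:E * \int[lam]_(x in @punctured_ball R n.+1) f (radial_proj x))%E.
Proof.
move=> mf f0; have mS := measurable_unit_sphere.
rewrite (@ge0_integral_pushforward_scale _ _ _ _ _ lam _ psi n.+1%:R)//; last first.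
  by move=> A mA AS; rewrite psiE.
congr (_ * _)%E.
rewrite psiE//.
rewrite (_ : _ `&` _ = @punctured_ball R n.+1).
  by apply: eq_integral => x xb; rewrite /= /psi indicE xb scale1r.
apply/seteqP; split => x //=; first by move=> [].
move=> /[dup] xb /andP[x0 _]; split => //.
by rewrite /unit_sphere /= enorm_radial_proj// -enorm_eq0 gt_eqF.
Qed.

Lemma radial_proj_sphere x : punctured_ball x -> S (radial_proj x).
Proof.
move=> /andP[x0 _].
by rewrite /unit_sphere /= enorm_radial_proj// -enorm_eq0 gt_eqF.
Qed.

Lemma Rintegral_sphere (f : 'rV[R]_n.+1 -> R) : sigma.-integrable S (EFin \o f) ->
  \int[sigma]_(y in S) f y =
  n.+1%:R * \int[lam]_(x in @punctured_ball R n.+1) f (radial_proj x).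
Proof.
apply: Rintegral_transfer => //.
- exact: measurable_unit_sphere.
- exact: measurable_punctured_ball.
- exact: radial_proj_sphere.
- exact: measurable_funTS (@measurable_radial_proj R n.+1).
- exact: ge0_integral_sphere.
Qed.

Lemma sphere_measure_lty : (sigma S < +oo)%E.
Proof.
change (n.+1%:R%:E * lam (@punctured_ball R n.+1 `&` @radial_proj R n.+1 @^-1` S) < +oo)%E.
rewrite lte_mul_pinfty//.
apply: le_lt_trans (lebesgue_unit_ball_lty R n.+1).
apply: le_measure; rewrite ?inE.
- apply: measurableI; first exact: measurable_punctured_ball.
  rewrite -[X in measurable X]setTI.
  by apply: measurable_radial_proj => //; exact: measurable_unit_sphere.
- exact: measurable_eball.
- by move=> x [/andP[_]].
Qed.

End sphere_integral.

(** * Dominated convergence and compactness *)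

Section dct.
Context d (T : measurableType d) (R : realType) (mu : {measure set T -> \bar R}).

Lemma Rintegral_dominated_cvg (D : set T) (f_ : nat -> T -> R) (f g : T -> R) :
  measurable D ->
  (forall k, measurable_fun D (f_ k)) -> measurable_fun D f ->
  {ae mu, forall x, D x -> f_ ^~ x @ \oo --> f x} ->
  mu.-integrable D (EFin \o g) ->
  (forall k x, D x -> `|f_ k x| <= g x) ->
  mu.-integrable D (EFin \o f) /\
  \int[mu]_(x in D) f_ k x @[k --> \oo] --> \int[mu]_(x in D) f x.
Proof.
move=> mD mf_ mf cf ig fg.
have [|||||intf _ cv] := @dominated_convergence _ _ _ mu D mD
  (fun k => EFin \o f_ k) (EFin \o f) (EFin \o g).
- by move=> k; exact/measurable_EFinP.
- exact/measurable_EFinP.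
- by apply: filterS cf => x cx Dx; apply: cvg_EFin; [exact: nearW|exact: cx].
- exact: ig.
- by apply: aeW => x /= Dx k; rewrite lee_fin; exact: fg.
split => //; rewrite /Rintegral.
apply: (@fine_cvg _ _ _ _ _ (fine (\int[mu]_(x in D) (f x)%:E))).
by rewrite fineK//; exact: integrable_fin_num.
Qed.
End dct.

Section compactness.
Variables (R : realType) (n : nat).
Implicit Types (f : 'rV[R]_n -> R).

Lemma continuous_ssq : continuous (@ssq R n).
Proof.
apply: (continuous_big add_continuous) => i _ x.
apply: (cvg_comp (fun y : 'rV[R]_n => y 0 i) (fun t => t ^+ 2)).
  exact: coord_continuous.
exact: exprn_continuous.
Qed.

Lemma continuous_enorm : continuous (@enorm R n).
Proof.
move=> x; apply: (cvg_comp (@ssq R n) Num.sqrt).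
  exact: continuous_ssq.
exact: sqrt_continuous.
Qed.

Lemma normr_coord_le (x : 'rV[R]_n) i : `|x 0 i| <= enorm x.
Proof.
rewrite -ler_sqr ?nnegrE ?enorm_ge0// enorm_sqr real_normK ?num_real//.
by rewrite /ssq (bigD1 i)//= lerDl sumr_ge0// => j _; exact: sqr_ge0.
Qed.

Lemma compact_eball r : compact (@eball R n r).
Proof.
apply: bounded_closed_compact; last first.
  apply: (@closed_comp _ _ (@enorm R n) [set t | t <= r]) => //.
  by move=> x _; exact: continuous_enorm.
exists r; split; first exact: num_real.
move=> M rM x xr; rewrite /Num.norm /= mx_normrE.
apply: bigmax_le => [|ij _]; first exact: le_trans (enorm_ge0 x) (le_trans xr (ltW rM)).
by rewrite [ij.1]ord1 (le_trans (normr_coord_le _ _))// (le_trans xr)// ltW.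
Qed.

Lemma continuous_bounded_eball f r : continuous f ->
  exists M, forall x, enorm x <= r -> `|f x| <= M.
Proof.
move=> cf; have /compact_bounded[M [_ HM]] : compact (f @` @eball R n r).
  apply: continuous_compact; last exact: compact_eball.
  by apply: continuous_subspaceT => x; exact: cf.
exists (M + 1) => x xr; apply: HM; first by rewrite ltrDl.
by exists x.
Qed.

Lemma compact_unit_sphere : compact (unit_sphere R n).
Proof.
apply: (subclosed_compact _ (@compact_eball 1)); last first.
  by move=> x; rewrite /unit_sphere /eball /= => ->.
apply: (@closed_comp _ _ (@enorm R n) [set t | t = 1]).
  by move=> x _; exact: continuous_enorm.
exact: closed_eq.
Qed.

(** Compactness of the sphere makes radial continuity uniform in [x], as needed to compare integrals
    over thin shells with integrals over the sphere. *)
Lemma near_radial_continuous f (e : R) : continuous f -> 0 < e ->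
  \forall t \near (1 : R), forall x, unit_sphere R n x -> `|f (t *: x) - f x| < e.
Proof.
move=> cf e0.
have /compact_near_coveringP := compact_unit_sphere.
move=> /(_ R (nbhs (1 : R)) (fun t x => `|f (t *: x) - f x| < e) _).
apply => x Sx.
have e2 : 0 < e / 2 by rewrite divr_gt0.
have c1 : (fun p : 'rV[R]_n * R => f (p.2 *: p.1)) p @[p --> (x, 1 : R)] --> f x.
  rewrite -{2}[x]scale1r.
  apply: (cvg_comp (fun p : 'rV[R]_n * R => p.2 *: p.1) f); last exact: cf.
  by apply: (@cvgZ _ _ _ _ _ (fun p : 'rV[R]_n * R => p.2)
    (fun p : 'rV[R]_n * R => p.1)); [exact: cvg_snd|exact: cvg_fst].
have c2 : (fun p : 'rV[R]_n * R => f p.1) p @[p --> (x, 1 : R)] --> f x.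
  apply: (cvg_comp (fun p : 'rV[R]_n * R => p.1) f); [exact: cvg_fst|exact: cf].
have c3 : (fun p : 'rV[R]_n * R => f (p.2 *: p.1) - f p.1) p
    @[p --> (x, 1 : R)] --> f x - f x by apply: cvgB.
move/cvgrPdist_lt : c3 => /(_ _ e0).
rewrite subrr; apply: filterS => -[y t] /=.
by rewrite sub0r normrN.
Qed.

End compactness.

(** * Gauss' theorem on the unit ball *)

Section translation_derivative.
Variables (R : realType) (n : nat).
Local Notation lam := (lebesgue_rV R n).
Local Notation V := 'rV[R]_n.

Lemma Rintegral_translation (f : V -> R) (b : V) :
  lam.-integrable setT (EFin \o f) ->
  lam.-integrable setT (EFin \o (fun x => f (x + b))) /\
  \int[lam]_x f (x + b) = \int[lam]_x f x.
Proof.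
move=> intf; have mT : measurable [set: V] by [].
have E : (fun x => f (1 *: x + b)) = (fun x => f (x + b)).
  by apply/funext => x; rewrite scale1r.
split.
  have /(integrable_affine b ltr01 mT) := measurable_int _ intf.
  by move=> [/(_ intf) + _]; rewrite preimage_setT -E.
have := Rintegral_affine b ltr01 mT intf.
by rewrite expr1n mul1r preimage_setT E.
Qed.

(** By translation invariance every difference quotient has integral 0, and domination by [G] passes
    this to the limit. Convergence is asked almost everywhere only, because the cut-off has kinks on
    two spheres. *)
Lemma Rintegral_translation_derivative (f df G : V -> R) (v : V) :
  lam.-integrable setT (EFin \o f) -> measurable_fun setT df ->
  lam.-integrable setT (EFin \o G) ->
  (forall k x, `|k.+1%:R * (f (x + k.+1%:R^-1 *: v) - f x)| <= G x) ->
  {ae lam, forall x,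
    k.+1%:R * (f (x + k.+1%:R^-1 *: v) - f x) @[k --> \oo] --> df x} ->
  \int[lam]_x df x = 0.
Proof.
move=> intf mdf intG fG cv.
have /measurable_EFinP mf := measurable_int _ intf.
have mT : measurable [set: V] by [].
pose F k x := k.+1%:R * (f (x + k.+1%:R^-1 *: v) - f x).
have mF k : measurable_fun setT (F k).
  apply: measurable_funM => //; apply: measurable_funB => //.
  have [/(measurable_int _)/measurable_EFinP] := Rintegral_translation (k.+1%:R^-1 *: v) intf.
  by [].
have [] := @Rintegral_dominated_cvg _ _ _ lam setT F df G mT mF mdf _ intG _.
- by apply: filterS cv => x + _.
- by move=> k x _; exact: fG.
move=> _.
have -> : (fun k => \int[lam]_x F k x) = (fun=> 0).
  apply/funext => k.
  have [i1 i2] := Rintegral_translation (k.+1%:R^-1 *: v) intf.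
  rewrite RintegralZl//; last exact: (integrableB mT i1 intf).
  by rewrite RintegralB// i2 subrr mulr0.
by move=> /cvg_lim => <-//; rewrite lim_cst.
Qed.

Lemma cvg_is_derive_seq (f : V -> R) (x v : V) (df : R) : is_derive x v f df ->
  k.+1%:R * (f (x + k.+1%:R^-1 *: v) - f x) @[k --> \oo] --> df.
Proof.
move=> [fd <-].
have /cvg_ex[l fl] := fd.
have -> : 'D_v f x = l by apply: cvg_lim.
rewrite (_ : (fun k : nat => _) =
    fun k => k.+1%:R^-1^-1 *: ((f \o shift x) (k.+1%:R^-1 *: v) - f x)); last first.
  by apply/funext => k /=; rewrite invrK [_ + x]addrC.
move/cvg_dnbhs_at_right/cvg_at_rightP : fl => /(_ (fun k => k.+1%:R^-1)); apply.
split; first by move=> k; rewrite invr_gt0.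
exact: cvg_harmonic.
Qed.

End translation_derivative.

Section sphere_null.
Variables (R : realType) (n : nat).
Local Notation lam := (lebesgue_rV R n.+1).

Lemma lebesgue_eball r : 0 < r ->
  lam (eball r) = ((r ^+ n.+1)%:E * lam (eball 1))%E.
Proof.
move=> r0; have rV : 0 < r^-1 by rewrite invr_gt0.
have := lebesgue_rV_affine 0 rV (@measurable_eball R n.+1 1).
rewrite exprVn invrK => <-; congr (lam _).
apply/seteqP; split => x; rewrite /eball /= addr0 enormZ gtr0_norm//;
by rewrite ler_pdivrMl// mulr1.
Qed.

Lemma lebesgue_eball_lty r : 0 < r -> (lam (eball r) < +oo)%E.
Proof.
move=> r0; rewrite lebesgue_eball// lte_mul_pinfty//.
- by rewrite lee_fin exprn_ge0// ltW.
- exact: lebesgue_unit_ball_lty.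
Qed.

(** The sphere lies between the balls of radii r q and r, a shell whose volume is a multiple of 1 -
    q^(n+1); then q tends to 1. *)
Lemma lebesgue_sphere0 r : 0 < r -> lam [set x | enorm x = r] = 0%E.
Proof.
move=> r0; pose A := [set x : 'rV[R]_n.+1 | enorm x = r].
have mA : measurable A.
  rewrite (_ : A = setT `&` @enorm R n.+1 @^-1` [set r]).
    by apply: measurable_enorm => //; exact: measurable_set1.
  by apply/seteqP; split => x //= -[].
have mB := @measurable_eball R n.+1.
pose q (k : nat) : R := 1 - k.+2%:R^-1.
have q0 k : 0 < q k by rewrite subr_gt0 invf_lt1// ltr1n.
have q1 k : q k < 1 by rewrite ltrBlDr ltrDl invr_gt0.
have V : lam (eball 1) \is a fin_num.
  by rewrite ge0_fin_numE//; exact: lebesgue_unit_ball_lty.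
have le k : (lam A <= ((1 - q k ^+ n.+1) * (r ^+ n.+1 * fine (lam (eball 1))))%:E)%E.
  have sub : A `<=` eball r `\` eball (r * q k).
    move=> x; rewrite /A /eball /= => ->; split => //.
    by rewrite leNgt gtr_pMr// q1.
  apply: (le_trans (le_measure _ _ _ sub)); rewrite ?inE//.
    exact: measurableD.
  rewrite measureD//; last exact: lebesgue_eball_lty.
  rewrite setIidr; last first.
    by move=> x; rewrite /eball /= => /le_trans; apply; rewrite ger_pMr// ltW.
  rewrite [X in (X - _ <= _)%E](lebesgue_eball r0).
  rewrite [X in (_ - X <= _)%E](lebesgue_eball (mulr_gt0 r0 (q0 k))) -(fineK V) -!EFinM -EFinD lee_fin.
  by rewrite exprMn le_eqVlt; apply/orP; left; apply/eqP; ring.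
apply/eqP; rewrite -measure_le0.
have cvq : (fun k => (1 - q k ^+ n.+1) * (r ^+ n.+1 * fine (lam (eball 1)))) @ \oo --> (0 : R).
  rewrite -[X in _ --> X](mul0r (r ^+ n.+1 * fine (lam (eball 1)))).
  apply: cvgM; last exact: cvg_cst.
  rewrite -[X in _ --> X](subrr (1 ^+ n.+1)) [X in _ --> X - _]expr1n.
  apply: cvgB; first exact: cvg_cst.
  apply: (cvg_comp q (fun t => t ^+ n.+1)); last exact: exprn_continuous.
  have cq : q k @[k --> \oo] --> (1 - 0 : R).
    apply: cvgB; first exact: cvg_cst.
    by have := @cvg_harmonic R; rewrite -cvg_shiftS.
  by move: cq; rewrite subr0.
have -> : (0 = lim ((fun k => ((1 - q k ^+ n.+1) * (r ^+ n.+1 * fine (lam (eball 1))))%:E) @ \oo))%E.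
  by apply/esym/cvg_lim => //; apply: cvg_EFin => //; apply: nearW.
apply: lime_ge; last by apply: nearW => k; exact: le.
by apply: cvgP; apply: cvg_EFin cvq; apply: nearW.
Qed.

End sphere_null.

(** * The cut-off function *)

Section cutoff.
Variables (R : realType) (n : nat) (r : R).
Hypotheses (r0 : 0 < r) (r1 : r < 1).
Implicit Types (y : 'rV[R]_n).

Let c0 : 0 < 1 - r ^+ 2.
Proof. by rewrite subr_gt0 expr_lt1// ltW. Qed.

(** Equal to 1 on the ball of radius [r] and to 0 off the unit ball. In between it is affine in
    |y|^2 rather than in |y|, so that its gradient there is -2 y / (1 - r^2), without a division by
    |y|. *)
Definition cutoff y : R := Num.min 1 (Num.max 0 ((1 - ssq y) / (1 - r ^+ 2))).

Lemma clamp_lip (a b : R) :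
  `|Num.min 1 (Num.max 0 a) - Num.min 1 (Num.max 0 b)| <= `|a - b|.
Proof.
have [ab|ba] := leP a b.
  rewrite (ler0_norm (_ : a - b <= 0)) ?subr_le0// ler_norml.
  rewrite /Num.min /Num.max; do !case: ifPn; rewrite -?leNgt; lra.
rewrite (gtr0_norm (_ : 0 < a - b)) ?subr_gt0// ler_norml.
rewrite /Num.min /Num.max; do !case: ifPn; rewrite -?leNgt; lra.
Qed.

Lemma cutoff_ge0 y : 0 <= cutoff y.
Proof. by rewrite le_min ler01 le_max lexx. Qed.

Lemma cutoff_le1 y : cutoff y <= 1.
Proof. by rewrite ge_min lexx. Qed.

Lemma cutoff_lip y y' : `|cutoff y - cutoff y'| <= `|ssq y - ssq y'| / (1 - r ^+ 2).
Proof.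
apply: le_trans (clamp_lip _ _) _.
rewrite -mulrBl normrM [`|_^-1|]gtr0_norm ?invr_gt0// ler_pM2r ?invr_gt0//.
by rewrite (_ : _ - _ = - (ssq y - ssq y')) ?normrN//; ring.
Qed.

Lemma cutoff_out y : 1 <= ssq y -> cutoff y = 0.
Proof.
move=> y1; rewrite /cutoff (_ : Num.max 0 _ = 0); first by rewrite min_r.
by rewrite max_l// mulr_le0_ge0// ?subr_le0// invr_ge0 ltW.
Qed.

Lemma cutoff_mid y : r ^+ 2 <= ssq y <= 1 ->
  cutoff y = (1 - ssq y) / (1 - r ^+ 2).
Proof.
move=> /andP[ry y1]; rewrite /cutoff max_r ?min_r//.
  by rewrite ler_pdivrMr// mul1r lerD2l lerN2.
by apply: divr_ge0; [rewrite subr_ge0|exact: ltW].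
Qed.

Lemma cutoff_in y : ssq y <= r ^+ 2 -> cutoff y = 1.
Proof.
move=> yr; rewrite /cutoff min_l// le_max; apply/orP; right.
by rewrite ler_pdivlMr// mul1r lerD2l lerN2.
Qed.

Lemma measurable_cutoff : measurable_fun setT cutoff.
Proof.
apply: measurable_minr => //; apply: measurable_maxr => //.
apply: measurable_funM => //; apply: measurable_funB => //.
exact: measurable_ssq.
Qed.

End cutoff.

Section derivation_rules.
Variables (R : realType) (n : nat) (y v : 'rV[R]_n).
Implicit Types (f g : 'rV[R]_n -> R).

Lemma is_derive_coord i : is_derive y v (fun z : 'rV[R]_n => z 0 i) (v 0 i).
Proof.
have H : (fun h : R => h^-1 *: (((fun z : 'rV[R]_n => z 0 i) \o shift y) (h *: v)
    - y 0 i)) @ 0^' --> v 0 i.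
  apply: cvg_near_cst; near=> h.
  rewrite /= !mxE addrK [_ *: _]mulrA mulVf ?mul1r//.
  by near: h; exact: nbhs_dnbhs_neq.
by apply: DeriveDef; [apply/cvg_ex; exists (v 0 i)|exact: cvg_lim].
Unshelve. all: by end_near. Qed.

Lemma isdD f g df dg : is_derive y v f df -> is_derive y v g dg ->
  is_derive y v (fun z => f z + g z) (df + dg).
Proof. exact: is_deriveD. Qed.

Lemma isdB f g df dg : is_derive y v f df -> is_derive y v g dg ->
  is_derive y v (fun z => f z - g z) (df - dg).
Proof. exact: is_deriveB. Qed.

Lemma isdM f g df dg : is_derive y v f df -> is_derive y v g dg ->
  is_derive y v (fun z => f z * g z) (f y * dg + g y * df).
Proof. exact: is_deriveM. Qed.

Lemma isdX f df k : is_derive y v f df ->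
  is_derive y v (fun z => f z ^+ k.+1) (k.+1%:R * f y ^+ k * df).
Proof. by move=> fd; have := @is_deriveX _ _ f k.+1 y v df fd; rewrite exprfctE. Qed.

Lemma isd_cst (c : R) : is_derive y v (fun=> c) 0.
Proof. exact: is_derive_cst. Qed.

Lemma isd_sum k (h : 'I_k -> 'rV[R]_n -> R) (dh : 'I_k -> R) :
  (forall i, is_derive y v (h i) (dh i)) ->
  is_derive y v (fun z => \sum_(i < k) h i z) (\sum_(i < k) dh i).
Proof.
move=> hd; have := @is_derive_sum _ _ _ k h y v dh hd.
by rewrite fct_sumE.
Qed.

Lemma isdV f df : f y != 0 -> is_derive y v f df ->
  is_derive y v (fun z => (f z)^-1) (- (f y)^-1 ^+ 2 * df).
Proof.
move=> fy fd; apply: DeriveDef.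
  by apply: derivableV => //; case: fd.
by rewrite deriveV//; case: fd => _ ->; rewrite exprVn.
Qed.

End derivation_rules.

Lemma is_derive_ssq (R : realType) n (y : 'rV[R]_n) i :
  is_derive y (delta_mx 0 i) (@ssq R n) (2 * y 0 i).
Proof.
have := isd_sum (fun j => isdX 1 (is_derive_coord y (delta_mx 0 i) j)).
move=> /is_derive_eq; apply.
rewrite (bigD1 i)//= big1 => [|j ji]; last by rewrite mxE (negbTE ji) andbF mulr0.
by rewrite mxE !eqxx/= expr1 mulr1 addr0.
Qed.

Lemma is_derive_line (R : realType) n (g : 'rV[R]_n -> R) (y v : 'rV[R]_n) t d :
  is_derive (y + t *: v) v g d -> is_derive t 1 (fun t => g (y + t *: v)) d.
Proof.
move=> [gd <-].
have E : (fun h : R => h^-1 *: (((fun t => g (y + t *: v)) \o shift t) (h *: 1) -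
    g (y + t *: v))) = (fun h => h^-1 *: ((g \o shift (y + t *: v)) (h *: v) - g (y + t *: v))).
  apply/funext => h /=; congr (_ *: (g _ - _)).
  by rewrite [h *: 1]mulr1 scalerDl addrCA.
by apply: DeriveDef; rewrite /derivable /derive E.
Qed.

Lemma ssq_add_delta (R : realType) n (y : 'rV[R]_n) i t :
  ssq (y + t *: delta_mx 0 i) = ssq y + 2 * t * y 0 i + t ^+ 2.
Proof.
rewrite /ssq (bigD1 i)//= [in RHS](bigD1 i)//= !mxE !eqxx/= mulr1.
rewrite (eq_bigr (fun j => y 0 j ^+ 2)) => [|j ji]; first by ring.
by rewrite !mxE (negbTE ji) andbF mulr0 addr0.
Qed.

Lemma near_enorm_lt (R : realType) n (y : 'rV[R]_n) r : enorm y < r ->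
  \forall z \near y, enorm z < r.
Proof. by move=> yr; exact: (cvgr_lt (enorm y) (@continuous_enorm R n y) r yr). Qed.

Lemma near_enorm_gt (R : realType) n (y : 'rV[R]_n) r : r < enorm y ->
  \forall z \near y, r < enorm z.
Proof. by move=> yr; exact: (cvgr_gt (enorm y) (@continuous_enorm R n y) r yr). Qed.

Section cutoff_derivative.
Variables (R : realType) (n : nat) (r : R) (i : 'I_n).
Hypotheses (r0 : 0 < r) (r1 : r < 1).
Variables (g dg : 'rV[R]_n -> R).
Hypothesis gd : forall y, is_derive y (delta_mx 0 i) g (dg y).

Definition shell : set 'rV[R]_n := [set y | r < enorm y <= 1].

(** Product rule for the cut-off times [g], valid off the two spheres |y| = r and |y| = 1; the
    values chosen there form part of a null set. *)
Definition cutoffM_derivative y : R :=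
  cutoff r y * dg y - 2 / (1 - r ^+ 2) * (\1_shell y * (y 0 i * g y)).

Let c0 : 0 < 1 - r ^+ 2.
Proof. by rewrite subr_gt0 expr_lt1// ltW. Qed.

Lemma is_derive_cutoffM y : enorm y != r -> enorm y != 1 ->
  is_derive y (delta_mx 0 i) (fun z => cutoff r z * g z) (cutoffM_derivative y).
Proof.
move=> yr y1; rewrite /cutoffM_derivative indicE.
have r00 := ltW r0.
have [yr'|ry] := ltP (enorm y) r.
  rewrite memNset; last by rewrite /shell /= ltNge (ltW yr').
  rewrite mul0r mulr0 subr0 (cutoff_in r0 r1); last by rewrite -enorm_le_ssq// ltW.
  rewrite mul1r; apply: near_eq_is_derive (gd y).
  have := near_enorm_lt yr'.
  apply: filterS => z zr; rewrite (cutoff_in r0 r1) ?mul1r//.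
  by rewrite -enorm_le_ssq// ltW.
have {}ry : r < enorm y by rewrite lt_neqAle eq_sym yr.
have [y1'|y1'] := leP (enorm y) 1; last first.
  rewrite memNset; last by rewrite /shell /= leNgt y1' andbF.
  rewrite mul0r mulr0 subr0 (cutoff_out r0 r1); last first.
    by rewrite leNgt -(expr1n _ 2) -enorm_lt_ssq// -leNgt ltW.
  rewrite mul0r; apply: near_eq_is_derive (isd_cst _ _ 0).
  have := near_enorm_gt y1'.
  apply: filterS => z zr; rewrite (cutoff_out r0 r1) ?mul0r//.
  by rewrite leNgt -(expr1n _ 2) -enorm_lt_ssq// -leNgt ltW.
have {}y1' : enorm y < 1 by rewrite lt_neqAle y1.
rewrite mem_set; last by rewrite /shell /= ry ltW.
have mid z : r < enorm z -> enorm z < 1 -> r ^+ 2 <= ssq z <= 1.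
  move=> rz z1; rewrite -enorm_sqr ler_sqr ?nnegrE ?enorm_ge0// (ltW rz)/=.
  by rewrite enorm_sqr -(expr1n _ 2) -enorm_le_ssq// ltW.
have d1 := isdM (isdM (isdB (isd_cst y _ 1) (is_derive_ssq y i))
  (isd_cst y (delta_mx 0 i) (1 - r ^+ 2)^-1)) (gd y).
rewrite (cutoff_mid r0 r1) ?mid//.
have d2 : is_derive y (delta_mx 0 i) (fun z => cutoff r z * g z)
    ((1 - ssq y) / (1 - r ^+ 2) * dg y + g y * ((1 - ssq y) * 0 + (1 - r ^+ 2)^-1 * (0 - 2 * y 0 i))).
  apply: near_eq_is_derive d1.
  have c1 := near_enorm_lt y1'.
  have c2 := near_enorm_gt ry.
  near=> z; rewrite (cutoff_mid r0 r1)// mid//; near: z; [exact: c2|exact: c1].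
apply: (is_derive_eq d2); set c := (1 - r ^+ 2)^-1; rewrite mulr1n; ring.
Unshelve. all: by end_near. Qed.

(** The dominating function for the difference quotients. The mean value theorem is applied to [g]
    alone, the cut-off being only Lipschitz. For |y| <= 2 the segment stays in the ball of radius 3,
    and 5 bounds (2 h y_i + h^2) / h in absolute value. *)
Lemma cutoffM_increment_bound (M dM : R) :
  (forall y, enorm y <= 3 -> `|g y| <= M) ->
  (forall y, enorm y <= 3 -> `|dg y| <= dM) ->
  forall h y, 0 < h <= 1 ->
  `|h^-1 * (cutoff r (y + h *: delta_mx 0 i) * g (y + h *: delta_mx 0 i)
      - cutoff r y * g y)| <=
  (dM + 5 / (1 - r ^+ 2) * M) * \1_(eball 2) y.
Proof.
Proof.
move=> gM dgM h y /andP[h0 h1]; set y' := y + _.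
have yi := normr_coord_le y i.
have sE t : ssq (y + t *: delta_mx 0 i) = ssq y + 2 * t * y 0 i + t ^+ 2.
  exact: ssq_add_delta.
have sy' := sE h; rewrite -/y' in sy'.
rewrite indicE; have [y2|y2] := leP (enorm y) 2; last first.
  rewrite memNset; last by rewrite /eball /= leNgt y2.
  (* Off the ball of radius 2 a step h <= 1 stays outside the unit ball, so both products vanish:
     |y'|^2 >= (|y| - h)^2 >= 1. *)
  have : 1 <= ssq y'.
    rewrite sy' -enorm_sqr; move: yi y2 h0 h1; rewrite ler_norml.
    set a := enorm y; set b := y 0 i => /andP[ab _] a2 h0 h1.
    have : h * (a + b) >= 0 by apply: mulr_ge0; [exact: ltW|lra].
    have : (a - h - 1) * (a - h + 1) >= 0 by apply: mulr_ge0; lra.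
    by lra.
  move=> y'1; have y1 : 1 <= ssq y.
    rewrite -(expr1n _ 2) -enorm_sqr ler_sqr ?nnegrE ?enorm_ge0//.
    by apply: le_trans (ltW y2); rewrite ler1n.
  by rewrite !(cutoff_out r0 r1)// !mul0r subrr !mulr0 normr0.
rewrite mem_set// mulr1.
have le3 t : 0 <= t <= h -> enorm (y + t *: delta_mx 0 i) <= 3.
  move=> /andP[t0 th]; rewrite enorm_le_ssq// sE -enorm_sqr.
  have := enorm_ge0 y.
  move: yi y2; rewrite ler_norml.
  set a := enorm y; set b := y 0 i => /andP[_ ab] a2 a0.
  have : t * (2 - b) >= 0 by apply: mulr_ge0; lra.
  have : (2 - a) * (a + 2) >= 0 by apply: mulr_ge0; lra.
  have : (1 - t) * (1 + t) >= 0 by apply: mulr_ge0; lra.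
  by lra.
have [c ch gE] : exists2 c, c \in `[0, h] & g y' - g y = dg (y + c *: delta_mx 0 i) * h.
  have [t _|t|c ch] := @MVT_segment _ (fun t => g (y + t *: delta_mx 0 i))
    (fun t => dg (y + t *: delta_mx 0 i)) 0 h (ltW h0).
  - by apply: is_derive_line; exact: gd.
  - move: t; apply: continuous_subspaceT => t.
    apply: differentiable_continuous; apply/derivable1_diffP.
    by have [] := is_derive_line (gd (y + t *: delta_mx 0 i)).
  - by rewrite scale0r addr0 subr0 => ?; exists c.
have -> : h^-1 * (cutoff r y' * g y' - cutoff r y * g y) =
   cutoff r y' * dg (y + c *: delta_mx 0 i) +
   h^-1 * (cutoff r y' - cutoff r y) * g y.
  rewrite (_ : _ - cutoff r y * g y =
    cutoff r y' * (g y' - g y) + (cutoff r y' - cutoff r y) * g y); last by ring.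
  by rewrite gE; field; rewrite gt_eqF.
apply: le_trans (ler_normD _ _) _; apply: lerD.
  rewrite normrM -[leRHS]mul1r ler_pM//.
    by rewrite ger0_norm ?cutoff_ge0// cutoff_le1.
  by apply: dgM; apply: le3; move: ch; rewrite in_itv.
rewrite normrM ler_pM//; last first.
  by apply: gM; apply: le_trans y2 _; rewrite ler_nat.
rewrite normrM gtr0_norm ?invr_gt0// ler_pdivrMl//.
apply: le_trans (cutoff_lip r0 r1 _ _) _.
rewrite mulrA ler_pM2r ?invr_gt0// sy' ler_norml.
move: yi; rewrite ler_norml => /andP[yi1 yi2].
set b := y 0 i in yi1 yi2 *; set a := enorm y in yi1 yi2 y2.
have : h * (b + 2) >= 0 by apply: mulr_ge0; lra.
have : h * (2 - b) >= 0 by apply: mulr_ge0; lra.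
have : h * (1 - h) >= 0 by apply: mulr_ge0; lra.
have : h * h >= 0 by apply: mulr_ge0; lra.
by lra.
Qed.


End cutoff_derivative.

Section integrable_facts.
Context d (T : measurableType d) (R : realType) (mu : {measure set T -> \bar R}).

Lemma RintegrableB (D : set T) (f g : T -> R) : measurable D ->
  mu.-integrable D (EFin \o f) -> mu.-integrable D (EFin \o g) ->
  mu.-integrable D (EFin \o (fun x => f x - g x)).
Proof. by move=> mD intf intg; exact: (integrableB mD intf intg). Qed.

Lemma RintegrableZl (D : set T) (c : R) (f : T -> R) : measurable D ->
  mu.-integrable D (EFin \o f) ->
  mu.-integrable D (EFin \o (fun x => c * f x)).
Proof. by move=> mD intf; exact: (integrableZl mD c intf). Qed.

Lemma Rintegrable_sum (D : set T) (I : Type) (s : seq I) (P : pred I)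
    (F : I -> T -> R) : measurable D ->
  (forall i, P i -> mu.-integrable D (EFin \o F i)) ->
  mu.-integrable D (EFin \o (fun x => \sum_(i <- s | P i) F i x)).
Proof.
move=> mD intF; have := @integrable_sum _ _ _ mu D mD I s P (fun i => EFin \o F i) intF.
by congr (mu.-integrable _ _); apply/funext => x /=; rewrite sumEFin.
Qed.

Lemma Rintegral_sum (D : set T) (I : Type) (s : seq I) (P : pred I)
    (F : I -> T -> R) : measurable D ->
  (forall i, P i -> mu.-integrable D (EFin \o F i)) ->
  \int[mu]_(x in D) (\sum_(i <- s | P i) F i x) =
  \sum_(i <- s | P i) \int[mu]_(x in D) F i x.
Proof.
move=> mD intF; elim: s => [|j s IHs].
  under eq_Rintegral do rewrite big_nil.
  by rewrite Rintegral_cst// mul0r big_nil.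
under eq_Rintegral do rewrite big_cons.
rewrite big_cons; case: ifPn => Pj //.
by rewrite RintegralD ?IHs//; [exact: intF|exact: Rintegrable_sum].
Qed.

Lemma bounded_integrable (D : set T) (f : T -> R) (M : R) :
  measurable D -> (mu D < +oo)%E -> measurable_fun D f ->
  (forall x, D x -> `|f x| <= M) -> mu.-integrable D (EFin \o f).
Proof.
move=> mD fD mf fM; apply: measurable_bounded_integrable => //.
exists M; split; first exact: num_real.
by move=> M' MM' x Dx; rewrite /= (le_trans (fM _ Dx))// ltW.
Qed.

Lemma Rintegral_support (D : set T) (f : T -> R) :
  (forall x, ~ D x -> f x = 0) -> \int[mu]_x f x = \int[mu]_(x in D) f x.
Proof.
move=> f0; rewrite [RHS]Rintegral_mkcond; congr Rintegral; apply/funext => x.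
by rewrite patchE; case: ifPn => // /negP; rewrite inE => /f0.
Qed.

Lemma integrable_support (D : set T) (f : T -> R) : measurable D ->
  (forall x, ~ D x -> f x = 0) -> mu.-integrable D (EFin \o f) ->
  mu.-integrable setT (EFin \o f).
Proof.
move=> mD f0 /integrable_mkcond => /(_ mD); congr (mu.-integrable _ _).
by apply/funext => x; rewrite patchE; case: ifPn => // /negP; rewrite inE => /f0 /= ->.
Qed.

Lemma Rintegral_indicM (D P : set T) (f : T -> R) : P `<=` D ->
  \int[mu]_(x in D) (\1_P x * f x) = \int[mu]_(x in P) f x.
Proof.
move=> PD; rewrite -[in RHS](setIidr PD) Rintegral_mkcondr.
apply: eq_Rintegral => x _; rewrite patchE indicE.
by case: ifPn; rewrite ?mul1r// mul0r.
Qed.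

Lemma le_normr_Rintegral_bound (D : set T) (f : T -> R) (M : R) :
  measurable D -> (mu D < +oo)%E -> mu.-integrable D (EFin \o f) ->
  (forall x, D x -> `|f x| <= M) ->
  `|\int[mu]_(x in D) f x| <= M * fine (mu D).
Proof.
move=> mD fD intf fM; apply: le_trans (le_normr_Rintegral mD intf) _.
rewrite -(Rintegral_cst mu mD); apply: le_Rintegral => //.
  exact: integrable_norm.
apply: (@bounded_integrable _ _ `|M|) => //.
Qed.

End integrable_facts.

Section continuity_rules.
Variables (R : realType) (T : topologicalType).
Implicit Types f g : T -> R.

Lemma ctsD f g : continuous f -> continuous g -> continuous (fun x => f x + g x).
Proof. by move=> cf cg x; apply: cvgD; [exact: cf|exact: cg]. Qed.

Lemma ctsB f g : continuous f -> continuous g -> continuous (fun x => f x - g x).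
Proof. by move=> cf cg x; apply: cvgB; [exact: cf|exact: cg]. Qed.

Lemma ctsM f g : continuous f -> continuous g -> continuous (fun x => f x * g x).
Proof. by move=> cf cg x; apply: cvgM; [exact: cf|exact: cg]. Qed.

Lemma ctsX f k : continuous f -> continuous (fun x => f x ^+ k).
Proof.
move=> cf; elim: k => [|k IHk].
  by under eq_fun do rewrite expr0; exact: cst_continuous.
by under eq_fun do rewrite exprS; exact: ctsM.
Qed.

Lemma ctsV f : (forall x, f x != 0) -> continuous f ->
  continuous (fun x => (f x)^-1).
Proof. by move=> f0 cf x; apply: cvgV => //; exact: cf. Qed.

Lemma cts_sum (I : Type) (s : seq I) (P : pred I) (F : I -> T -> R) :
  (forall i, P i -> continuous (F i)) ->
  continuous (fun x => \sum_(i <- s | P i) F i x).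
Proof. exact: (continuous_big add_continuous). Qed.

End continuity_rules.

(** * From the cut-off to the sphere *)

Section divergence_theorem.
Variables (R : realType) (n : nat) (i : 'I_n.+1).
Local Notation lam := (lebesgue_rV R n.+1).
Local Notation sigma := (sphere_measure R n.+1).
Local Notation S := (unit_sphere R n.+1).
Variables (g dg : 'rV[R]_n.+1 -> R).
Hypotheses (gc : continuous g) (dgc : continuous dg).
Hypothesis gd : forall y, is_derive y (delta_mx 0 i) g (dg y).

Let mg : measurable_fun setT g := measurable_continuous_rV gc.
Let mdg : measurable_fun setT dg := measurable_continuous_rV dgc.
Let F (y : 'rV[R]_n.+1) := y 0 i * g y.
(** The boundary integrand extended constantly along rays, so that its integrals over shells are
    governed by scaling. *)
Let H (y : 'rV[R]_n.+1) := F (radial_proj y).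

Let cF : continuous F.
Proof.
by apply: ctsM => //; exact: coord_continuous.
Qed.

Let mF : measurable_fun setT F := measurable_continuous_rV cF.
Let mH : measurable_fun setT H.
Proof. exact: (measurableT_comp mF (@measurable_radial_proj R n.+1)). Qed.

Let mB r := @measurable_eball R n.+1 r.
Let B1oo := lebesgue_unit_ball_lty R n.+1.

Lemma measurable_enorm_eq (r : R) : measurable [set y : 'rV[R]_n.+1 | enorm y = r].
Proof.
rewrite (_ : mkset _ = setT `&` @enorm R n.+1 @^-1` [set r]).
  by apply: measurable_enorm => //; exact: measurable_set1.
by apply/seteqP; split => x //= -[].
Qed.

Lemma shell_sub (r : R) : shell r `<=` @eball R n.+1 1.
Proof. by move=> x /andP[]. Qed.

Lemma shellE (r : R) : shell r = @eball R n.+1 1 `\` eball r.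
Proof.
apply/seteqP; split => x; rewrite /shell /eball /=.
  by move=> /andP[rx x1]; split => //; apply/negP; rewrite -ltNge.
by move=> [x1 /negP]; rewrite -ltNge => ->.
Qed.

Lemma measurable_shell (r : R) : measurable (@shell R n.+1 r).
Proof. by rewrite shellE; exact: measurableD. Qed.

Lemma lebesgue_shell (r : R) : 0 < r < 1 ->
  fine (lam (shell r)) = (1 - r ^+ n.+1) * fine (lam (eball 1)).
Proof.
move=> /andP[r0 r1]; rewrite shellE measureD// setIidr; last first.
  by move=> x; rewrite /eball /= => /le_trans; apply; exact: ltW.
have V : lam (eball 1) \is a fin_num by rewrite ge0_fin_numE.
rewrite [X in fine (_ - X)%E](_ : _ = (r ^+ n.+1 * fine (lam (eball 1)))%:E); last first.
  by rewrite EFinM (fineK V); exact: lebesgue_eball.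
rewrite [X in fine (X - _)%E](_ : _ = (fine (lam (eball 1)))%:E); last first.
  by rewrite (fineK V).
by rewrite -EFinB /=; ring.
Qed.

(** The derivative of the compactly supported product has total integral 0; its two terms are the
    two sides. *)
Lemma Rintegral_cutoffM (r : R) : 0 < r < 1 ->
  \int[lam]_(y in eball 1) (cutoff r y * dg y) =
  2 / (1 - r ^+ 2) * \int[lam]_(y in shell r) F y.
Proof.
move=> /andP[r0 r1].
have [M gM] := continuous_bounded_eball 3 gc.
have [dM dgM] := continuous_bounded_eball 3 dgc.
have mcut := @measurable_cutoff R n.+1 r.
have out y : ~ eball 1 y -> cutoff r y = 0.
  move=> /negP; rewrite -ltNge => y1; apply: cutoff_out => //.
  by rewrite leNgt -(expr1n _ 2) -enorm_lt_ssq// -leNgt ltW.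
have mI : measurable_fun setT (fun y => \1_(@shell R n.+1 r) y * F y).
  by apply: measurable_funM => //; apply: measurable_indic; exact: measurable_shell.
have le13 y : eball 1 y -> enorm y <= 3 by move=> /le_trans; apply; rewrite ler1n.
have M0 : 0 <= M by apply: le_trans (gM 0 _); rewrite // (eqP (_ : enorm 0 == 0)) ?enorm_eq0.
have dM0 : 0 <= dM by apply: le_trans (dgM 0 _); rewrite // (eqP (_ : enorm 0 == 0)) ?enorm_eq0.
have FM y : enorm y <= 1 -> `|F y| <= M.
  move=> y1; rewrite normrM -[leRHS]mul1r ler_pM//.
    exact: le_trans (normr_coord_le _ _) y1.
  exact/gM/le13.
have i1 : lam.-integrable (eball 1) (EFin \o (fun y => cutoff r y * dg y)).
  apply: (@bounded_integrable _ _ _ _ _ _ dM) => //.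
    by apply: measurable_funTS; apply: measurable_funM.
  move=> y y1; rewrite normrM -[leRHS]mul1r ler_pM//; last exact/dgM/le13.
  by rewrite ger0_norm ?cutoff_ge0// cutoff_le1.
have i2 : lam.-integrable (eball 1) (EFin \o (fun y => \1_(@shell R n.+1 r) y * F y)).
  apply: (@bounded_integrable _ _ _ _ _ _ M) => //.
    exact: measurable_funTS.
  move=> y y1; rewrite normrM -[leRHS]mul1r ler_pM// ?FM//.
  by rewrite indicE; case: (_ \in _); rewrite ?normr1// normr0.
have : \int[lam]_y (cutoffM_derivative r i g dg y) = 0.
  apply: (@Rintegral_translation_derivative _ _ (fun y => cutoff r y * g y) _
    (fun y => (dM + 5 / (1 - r ^+ 2) * M) * \1_(eball 2) y) (delta_mx 0 i)).
  - apply: (@integrable_support _ _ _ _ (eball 1)) => //.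
      by move=> y /out ->; rewrite mul0r.
    apply: (@bounded_integrable _ _ _ _ _ _ M) => //.
      by apply: measurable_funTS; apply: measurable_funM.
    move=> y y1; rewrite normrM -[leRHS]mul1r ler_pM//; last exact/gM/le13.
    by rewrite ger0_norm ?cutoff_ge0// cutoff_le1.
  - apply: measurable_funB; first exact: measurable_funM.
    by apply: measurable_funM.
  - apply: (@integrable_support _ _ _ _ (eball 2)) => //.
      by move=> y y2; rewrite indicE memNset// mulr0.
    apply: (@bounded_integrable _ _ _ _ _ _ (dM + 5 / (1 - r ^+ 2) * M)) => //.
    + exact: lebesgue_eball_lty.
    + by apply: measurable_funTS; apply: measurable_funM => //; apply: measurable_indic.
    + move=> y y2; rewrite indicE mem_set// mulr1 ger0_norm//.
      by rewrite addr_ge0// mulr_ge0// divr_ge0// subr_ge0 expr_le1// ltW.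
  - move=> k y; rewrite -[k.+1%:R in X in X * _]invrK.
    apply: (cutoffM_increment_bound r0 r1 gd gM dgM).
    by rewrite invr_gt0 ltr0n/= invf_le1// ler1n.
  (* The exceptional null set consists of the two spheres where the cut-off has kinks. *)
  - exists ([set y | enorm y = r] `|` [set y | enorm y = 1]); split.
    + by apply: measurableU; exact: measurable_enorm_eq.
    + by rewrite null_set_setU//; first [exact: measurable_enorm_eq|exact: lebesgue_sphere0].
    + move=> y /= ncv; apply: contrapT => /not_orP[/eqP yr /eqP y1].
      by apply: ncv; exact: (cvg_is_derive_seq (is_derive_cutoffM r0 r1 gd yr y1)).
rewrite (Rintegral_support _ (D := eball 1)); last first.
  move=> y y1; rewrite /cutoffM_derivative out// indicE memNset; last first.
    by move=> /shell_sub.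
  by rewrite !mul0r mulr0 subr0.
rewrite /cutoffM_derivative RintegralB//; last first.
  by apply: (integrableZl _ (2 / (1 - r ^+ 2)) i2).
rewrite RintegralZl// Rintegral_indicM; last exact: shell_sub.
by move/eqP; rewrite subr_eq0 => /eqP.
Qed.

Let q (k : nat) : R := 1 - k.+2%:R^-1.
Let q01 k : 0 < q k < 1.
Proof.
by rewrite subr_gt0 invf_lt1 ?ltr1n//= ltrBlDr ltrDl invr_gt0.
Qed.

Let cvgq : q k @[k --> \oo] --> (1 : R).
Proof.
have cq : q k @[k --> \oo] --> (1 - 0 : R).
  apply: cvgB; first exact: cvg_cst.
  by have := @cvg_harmonic R; rewrite -cvg_shiftS.
by move: cq; rewrite subr0.
Qed.

Let i1 (f : 'rV[R]_n.+1 -> R) : continuous f ->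
  lam.-integrable (eball 1) (EFin \o f).
Proof.
move=> cf; have [M fM] := continuous_bounded_eball 1 cf.
apply: (@bounded_integrable _ _ _ _ _ _ M) => //.
exact: measurable_funTS (measurable_continuous_rV cf).
Qed.

Let iH : lam.-integrable (eball 1) (EFin \o H).
Proof.
have [M FM] := continuous_bounded_eball 1 cF.
apply: (@bounded_integrable _ _ _ _ _ _ M) => //.
  exact: measurable_funTS.
move=> x _; apply: FM; rewrite /radial_proj enormZ ger0_norm ?invr_ge0 ?enorm_ge0//.
have [->|x0] := eqVneq (enorm x) 0; first by rewrite mulr0.
by rewrite mulVf.
Qed.

Lemma cvg_Rintegral_cutoffM :
  \int[lam]_(y in eball 1) (cutoff (q k) y * dg y) @[k --> \oo] -->
  \int[lam]_(y in eball 1) dg y.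
Proof.
have [dM dgM] := continuous_bounded_eball 1 dgc.
apply: (proj2 (@Rintegral_dominated_cvg _ _ _ lam (eball 1)
  (fun k y => cutoff (q k) y * dg y) dg (fun y => `|dg y|) (mB 1) _ _ _ _ _)).
- by move=> k; apply: measurable_funTS; apply: measurable_funM => //;
    exact: measurable_cutoff.
- exact: measurable_funTS.
- exists [set y | enorm y = 1]; split.
  + exact: measurable_enorm_eq.
  + exact: lebesgue_sphere0.
  + move=> y /= ncv; apply: contrapT => /eqP y1; apply: ncv => y1'.
    have {}y1' : enorm y < 1 by rewrite lt_neqAle y1.
    apply: cvg_near_cst; near=> k.
    have /andP[q0 q1] := q01 k.
    rewrite (cutoff_in q0 q1) ?mul1r// -enorm_le_ssq; last exact: ltW.
    by apply: ltW; near: k; exact: (cvgr_gt (1 : R) cvgq).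
- exact: integrable_norm (i1 dgc).
- move=> k y y1; rewrite normrM -[leRHS]mul1r ler_wpM2r//.
  have /andP[q0 q1] := q01 k.
  by rewrite ger0_norm ?cutoff_ge0// cutoff_le1.
Unshelve. all: by end_near. Qed.

(** Since [H] is invariant under dilations, its integral over the punctured ball of radius r is
    r^(n+1) times that over the unit one; the shell is the difference of the two. *)
Lemma Rintegral_shell_homogeneous (r : R) : 0 < r < 1 ->
  \int[lam]_(y in shell r) H y =
  (1 - r ^+ n.+1) * \int[lam]_(y in @punctured_ball R n.+1) H y.
Proof.
move=> /andP[r0 r1].
pose pb s := [set y : 'rV[R]_n.+1 | 0 < enorm y <= s].
have mpb s : measurable (pb s).
  rewrite (_ : pb s = setT `&` @enorm R n.+1 @^-1` `]0, s]%classic).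
    by apply: measurable_enorm => //; exact: measurable_itv.
  by apply/seteqP; split => x /=; rewrite /pb /= in_itv /= => // -[].
have E : pb 1 = pb r `|` shell r.
  apply/seteqP; split => x; rewrite /pb /shell /=.
    by move=> /andP[x0 x1]; have [xr|rx] := leP (enorm x) r; [left|right]; rewrite ?x0 ?rx.
  move=> [/andP[-> xr]|/andP[rx ->]] /=; first by rewrite (le_trans xr)// ltW.
  by rewrite (lt_trans r0 rx).
have ipb : lam.-integrable (pb 1) (EFin \o H).
  by apply: integrableS iH => //; move=> x /andP[].
have E1 : \int[lam]_(y in pb 1) H y =
    \int[lam]_(y in pb r) H y + \int[lam]_(y in shell r) H y.
  rewrite E Rintegral_setU//; first exact: measurable_shell.
    by rewrite -E.
  apply/disj_setPS => x [/andP[_ xr] /andP[rx _]].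
  by move: rx; rewrite ltNge xr.
have E2 : \int[lam]_(y in pb r) H y = r ^+ n.+1 * \int[lam]_(y in pb 1) H y.
  rewrite (@Rintegral_affine _ _ r 0)//; last first.
    by apply: integrableS ipb => //; rewrite E; exact: subsetUl.
  congr (_ * _).
  have -> : (fun x : 'rV[R]_n.+1 => r *: x + 0) @^-1` (pb r) = pb 1.
    apply/seteqP; split => x; rewrite /pb /= addr0 enormZ gtr0_norm//;
    by rewrite pmulr_rgt0// ger_pMr.
  apply: eq_Rintegral => x _; rewrite addr0 /H /radial_proj enormZ gtr0_norm//.
  by rewrite scalerA invfM mulrAC mulVf ?mul1r// gt_eqF.
rewrite -/(pb 1); move: E1; rewrite E2; set J := \int[lam]_(y in pb 1) H y.
move=> JK.
by rewrite mulrBl mul1r [X in _ = X - _]JK addrAC subrr add0r.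
Qed.

(** The error must be small relative to the volume of the shell, because the factor 2 / (1 - q^2) in
    front of the shell integral blows up. *)
Lemma shell_average_error (e : R) : 0 < e ->
  \forall k \near \oo,
    `|\int[lam]_(y in shell (q k)) F y - \int[lam]_(y in shell (q k)) H y| <=
    e * ((1 - q k ^+ n.+1) * fine (lam (eball 1))).
Proof.
move=> e0.
have [d /= d0 Hd] := near_radial_continuous cF e0.
near=> k.
have /andP[q0 q1] := q01 k.
have ish f : lam.-integrable (eball 1) (EFin \o f) ->
    lam.-integrable (shell (q k)) (EFin \o f).
  apply: integrableS => //; [exact: measurable_shell|exact: shell_sub].
rewrite -RintegralB; [|exact: measurable_shell|exact/ish/i1|exact: ish].
rewrite -lebesgue_shell//; apply: le_normr_Rintegral_bound.
- exact: measurable_shell.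
- apply: le_lt_trans B1oo; apply: le_measure; rewrite ?inE//.
    exact: measurable_shell.
  exact: shell_sub.
- by apply: RintegrableB; [exact: measurable_shell|exact/ish/i1|exact: ish].
- move=> y /andP[qy y1]; rewrite /H.
  have y0 : 0 < enorm y by exact: lt_trans q0 qy.
  have {1}-> : y = enorm y *: radial_proj y.
    by rewrite /radial_proj scalerA mulfV ?scale1r// gt_eqF.
  apply/ltW/Hd; last first.
    by rewrite /unit_sphere /= enorm_radial_proj// -enorm_eq0 gt_eqF.
  rewrite /= ger0_norm ?subr_ge0// ltrBlDr -ltrBlDl; apply: lt_trans qy.
  by near: k; apply: (cvgr_gt (1 : R) cvgq); rewrite ltrBlDr ltrDl.
Unshelve. all: by end_near. Qed.

(** Both powers share the factor 1 - q. The limit is the [n.+1] that normalizes [sphere_measure]. *)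
Let cvg_ratio : 2 / (1 - q k ^+ 2) * (1 - q k ^+ n.+1) @[k --> \oo] --> (n.+1%:R : R).
Proof.
have -> : (fun k => 2 / (1 - q k ^+ 2) * (1 - q k ^+ n.+1)) =
  (fun k => 2 / (1 + q k) * (\sum_(j < n.+1) q k ^+ j)).
  apply/funext => k; have /andP[q0 q1] := q01 k.
  rewrite -[1 - q k ^+ n.+1]opprB subrX1.
  have n1 : 1 - q k ^+ 2 != 0 by rewrite gt_eqF// subr_gt0 expr_lt1// ltW.
  have n2 : 1 + q k != 0 by rewrite gt_eqF// addr_gt0.
  by field; rewrite ?n1 ?n2.
have -> : n.+1%:R = 2 / (1 + 1) * \sum_(j < n.+1) 1 ^+ j :> R.
  rewrite divff ?gt_eqF ?addr_gt0// mul1r.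
  by under eq_bigr do rewrite expr1n; rewrite sumr_const card_ord.
apply: cvgM.
  apply: cvgM; first exact: cvg_cst.
  apply: cvgV; first by rewrite gt_eqF ?addr_gt0.
  by apply: cvgD => //; exact: cvg_cst.
apply: cvg_big => [|j _]; first exact: add_continuous.
exact: (cvg_comp _ _ cvgq (@exprn_continuous R j 1)).
Qed.

Theorem divergence_unit_ball :
  \int[lam]_(y in eball 1) dg y = \int[sigma]_(y in S) (y 0 i * g y).
Proof.
pose c k := 2 / (1 - q k ^+ 2).
have iF : sigma.-integrable S (EFin \o F).
  have [M FM] := continuous_bounded_eball 1 cF.
  apply: (@bounded_integrable _ _ _ _ _ _ M) => //.
  - exact: measurable_unit_sphere.
  - exact: sphere_measure_lty.
  - exact: measurable_funTS.
  - by move=> x Sx; apply: FM; rewrite Sx.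
rewrite [RHS](Rintegral_sphere iF).
pose I := \int[lam]_(y in @punctured_ball R n.+1) H y.
rewrite -[RHS]/(n.+1%:R * I).
have cv : c k * \int[lam]_(y in shell (q k)) F y @[k --> \oo] --> n.+1%:R * I.
  have E : (fun k => c k * \int[lam]_(y in shell (q k)) F y) =
    (fun k => c k * (1 - q k ^+ n.+1) * I +
      c k * (\int[lam]_(y in shell (q k)) F y - \int[lam]_(y in shell (q k)) H y)).
    by apply/funext => k; rewrite Rintegral_shell_homogeneous// /I; ring.
  rewrite E -[X in _ --> X]addr0; apply: cvgD.
    by apply: cvgM; [exact: cvg_ratio|exact: cvg_cst].
  apply/cvgrPdist_le => e e0.
  pose V := fine (lam (eball 1)).
  have V0 : 0 <= V by exact: fine_ge0.
  (* [n.+2] eventually bounds the ratio, whose limit is [n.+1]; V + 1 replaces V to be nonzero. *)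
  pose e' := e / (n.+2%:R * (V + 1)).
  have e'0 : 0 < e' by rewrite divr_gt0// mulr_gt0// ltr_wpDl.
  near=> k; rewrite sub0r normrN normrM.
  have /andP[q0 q1] := q01 k.
  have ck0 : 0 <= c k by rewrite divr_ge0// subr_ge0 expr_le1// ltW.
  rewrite ger0_norm//.
  have le1 : `|\int[lam]_(y in shell (q k)) F y - \int[lam]_(y in shell (q k)) H y| <=
    e' * ((1 - q k ^+ n.+1) * V) by near: k; exact: shell_average_error.
  apply: (le_trans (ler_wpM2l ck0 le1)).
  have le2 : c k * (1 - q k ^+ n.+1) <= n.+2%:R.
    by near: k; apply: (cvgr_le (n.+1%:R : R) cvg_ratio); rewrite ltr_nat.
  rewrite (_ : c k * _ = e' * V * (c k * (1 - q k ^+ n.+1))); last by ring.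
  apply: (le_trans (ler_wpM2l _ le2)); first by rewrite mulr_ge0// ltW.
  have n1 : V + 1 != 0 by rewrite gt_eqF// ltr_wpDl.
  have n2 : n.+2%:R != 0 :> R by rewrite pnatr_eq0.
  rewrite /e' [leLHS](_ : _ = e * (V / (V + 1))); last first.
    by move: (n.+2%:R) n2 (V + 1) n1 => N n2 W n1; field; rewrite ?n1 ?n2.
  rewrite -[leRHS]mulr1 ler_pM2l// ler_pdivrMr ?mul1r ?lerDl// ltr_wpDl//.
apply: (cvg_unique (@Rhausdorff R) cvg_Rintegral_cutoffM).
rewrite /= (_ : (fun k : nat => _) = fun k => c k * \int[lam]_(y in shell (q k)) F y)//.
by apply/funext => k; exact: Rintegral_cutoffM.
Unshelve. all: by end_near. Qed.

End divergence_theorem.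

(** * Regularized kernels and Green's identity *)

Section weak_singularity.
Variables (R : realType) (n : nat).
Local Notation lam := (lebesgue_rV R n.+2).
Local Notation V := 'rV[R]_n.+2.
Implicit Types (x y : V).

(** The critical size |y|^(1-dim), in dimension n + 2; its value at 0 is 0, by [0^-1 = 0]. *)
Definition weak_singularity y : R := (enorm y)^-1 ^+ n.+1.
Local Notation w := weak_singularity.

Lemma weak_singularity_ge0 y : 0 <= w y.
Proof. by rewrite exprn_ge0// invr_ge0 enorm_ge0. Qed.

Lemma measurable_weak_singularity : measurable_fun setT w.
Proof.
apply: measurable_funX; under eq_fun do rewrite -powR_inv1 ?sqrtr_ge0//.
exact: (measurableT_comp (measurable_powR _) (@measurable_enorm R n.+2)).
Qed.

Lemma weak_singularityZ (r : R) y : 0 < r -> w (r *: y) = r^-1 ^+ n.+1 * w y.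
Proof. by move=> r0; rewrite /w enormZ gtr0_norm// invfM exprMn. Qed.

Let A k := @shell R n.+2 (2^-1 ^+ k).
Let mA k : measurable (A k). Proof. exact: measurable_shell. Qed.
Let mwE D : measurable_fun D (EFin \o w).
Proof.
apply/measurable_EFinP; apply: measurable_funTS; exact: measurable_weak_singularity.
Qed.

Let h0 : 0 < 2^-1 :> R. Proof. by rewrite invr_gt0. Qed.

Let C : R := 2 ^+ n.+1 * fine (lam (eball 1)).

Let int_shell1 : (\int[lam]_(y in A 1) (w y)%:E <= C%:E)%E.
Proof.
have le y : A 1 y -> w y <= 2 ^+ n.+1.
  rewrite /A /shell /= expr1 => /andP[y0 y1]; apply: lerXn2r.
  - by rewrite nnegrE invr_ge0 enorm_ge0.
  - by rewrite nnegrE.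
  - by rewrite -[leRHS]invrK lef_pV2 ?posrE// ?ltW// (lt_trans h0).
apply: (@le_trans _ _ (\int[lam]_(y in A 1) (cst (2 ^+ n.+1)%:E y))%E).
  apply: ge0_le_integral => //.
  - by move=> y _; rewrite lee_fin weak_singularity_ge0.
rewrite integral_cst// EFinM lee_pmul//.
rewrite fineK; last by rewrite ge0_fin_numE//; exact: lebesgue_unit_ball_lty.
apply: le_measure; rewrite ?inE//; first exact: measurable_eball.
exact: shell_sub.
Qed.

(** Split off the outer dyadic shell, which contributes at most [C]. Halving maps the shell [A k]
    onto the rest and multiplies the integral by 2^(-n-2) 2^(n+1) = 1/2. Thus I_(k+1) <= C + I_k /
    2, which preserves the bound 2 C. *)
Let int_shell k : (\int[lam]_(y in A k) (w y)%:E <= (2 * C)%:E)%E.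
Proof.
have C0 : 0 <= C by rewrite mulr_ge0// ?exprn_ge0// fine_ge0.
elim: k => [|k IHk].
  rewrite (_ : A 0 = set0); first by rewrite integral_set0 lee_fin mulr_ge0.
  apply/seteqP; split => y //; rewrite /A /shell /= expr0.
  by rewrite ltNge => /andP[/negP].
pose D := [set y : V | 2^-1 ^+ k.+1 < enorm y <= 2^-1].
have AE : A k.+1 = A 1 `|` D.
  apply/seteqP; split => y; rewrite /A /shell /D /= expr1.
    by move=> /andP[y0 y1]; have [|] := leP (enorm y) 2^-1; [right|left]; rewrite ?y0 ?y1.
  move=> [/andP[y0 ->]|/andP[-> y1]] /=; last by rewrite (le_trans y1)// invf_le1// ler1n.
  rewrite andbT exprS; apply: le_lt_trans y0; rewrite ger_pMr//.
  by rewrite exprn_ile1// ?invr_ge0// invf_le1// ler1n.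
have mD : measurable D.
  rewrite (_ : D = setT `&` @enorm R n.+2 @^-1` `]2^-1 ^+ k.+1, 2^-1]%classic).
    by apply: measurable_enorm => //; exact: measurable_itv.
  by apply/seteqP; split => y /=; rewrite /D /= in_itv /= => // -[].
rewrite AE ge0_integral_setU//; last 2 first.
- by move=> y _; rewrite lee_fin weak_singularity_ge0.
- apply/disj_setPS => y [/andP[+ _] /andP[_ +]].
  by rewrite expr1 => /lt_le_trans h /h; rewrite ltxx.
rewrite (_ : 2 * C = C + C); last by ring.
rewrite EFinD leeD//.
rewrite (@ge0_integral_affine _ _ 2^-1 0 D)//; last first.
  by move=> y _; rewrite lee_fin weak_singularity_ge0.
rewrite (_ : _ @^-1` D = A k); last first.
  apply/seteqP; split => y; rewrite /A /shell /D /= addr0 enormZ gtr0_norm//;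
  by rewrite exprS ltr_pM2l// ger_pMr.
under eq_integral do rewrite addr0 weak_singularityZ// EFinM.
rewrite ge0_integralZl//; last first.
  by move=> y _; rewrite lee_fin weak_singularity_ge0.
rewrite muleA -EFinM exprS -mulrA -exprMn mulfV ?expr1n ?mulr1 ?invr_eq0//.
apply: (@le_trans _ _ ((2^-1)%:E * (2 * C)%:E)%E).
  by rewrite lee_pmul2l// lte_fin.
by rewrite -EFinM mulrA mulVf// mul1r.
Qed.

Lemma integrable_weak_singularity_unit : lam.-integrable (eball 1) (EFin \o w).
Proof.
apply/integrableP; split; first exact: mwE.
under eq_integral do rewrite /= ger0_norm ?weak_singularity_ge0//.
have -> : (\int[lam]_(y in eball 1) (w y)%:E =
    \int[lam]_(y in \bigcup_k A k) (w y)%:E)%E.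
  have sub : \bigcup_k A k `<=` eball 1 by apply: bigcup_sub => k _; exact: shell_sub.
  rewrite -[in RHS](setIidr sub) integral_mkcondr.
  apply: eq_integral => y; rewrite inE /eball /= => y1; rewrite patchE.
  case: ifPn => // /negP; rewrite inE => nA.
  (* The origin lies in no shell, but the integrand is 0 there by the convention on inverses. *)
  have [y0|y0] := eqVneq (enorm y) 0.
    by rewrite /w y0 invr0 expr0n.
  exfalso; apply: nA.
  have {}y0 : 0 < enorm y by rewrite lt_neqAle eq_sym y0 enorm_ge0.
  have : (2^-1 : R) ^+ k @[k --> \oo] --> (0 : R).
    by apply: cvg_expr; rewrite gtr0_norm// invf_lt1// ltr1n.
  move=> /cvgr_lt/(_ _ y0)[k _ /(_ k (leqnn k))] ky.
  by exists k => //; rewrite /A /shell /= ky.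
apply: (@le_lt_trans _ _ (2 * C)%:E); last by rewrite ltry.
have ndA : nondecreasing_seq A.
  apply/nondecreasing_seqP => k; rewrite subsetEset => y.
  rewrite /A /shell /= => /andP[ky ->]; rewrite andbT; apply: le_lt_trans ky.
  by rewrite exprS ger_pMl ?exprn_gt0// invf_le1// ler1n.
have w0 k y : A k y -> (0 <= (EFin \o w) y)%E.
  by rewrite lee_fin weak_singularity_ge0.
have cv := @ge0_nondecreasing_set_cvg_integral _ _ _ A (EFin \o w) lam ndA mA
  (fun k => @mwE (A k)) w0.
rewrite -(cvg_lim _ cv)//.
apply: lime_le; last by apply: nearW => k; exact: int_shell.
apply/cvg_ex; eexists; apply: cv.
Qed.

(** Translation by [- x] sends the unit ball into the ball of radius 2, on which integrability
    follows from the unit ball by scaling. *)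
Lemma integrable_weak_singularity x : enorm x <= 1 ->
  lam.-integrable (eball 1) (EFin \o (fun y => w (y - x))).
Proof.
move=> x1.
have h1 : 0 < 2^-1 :> R by rewrite invr_gt0.
have m1 := @measurable_eball R n.+2 1.
have m2 := @measurable_eball R n.+2 2.
have i2 : lam.-integrable (eball 2) (EFin \o w).
  have /(integrable_affine 0 h1 m1) [/(_ integrable_weak_singularity_unit) + _] := @mwE (eball 1).
  rewrite (_ : _ @^-1` eball 1 = eball 2); last first.
    apply/seteqP; split => y; rewrite /eball /= addr0 enormZ gtr0_norm//;
    by rewrite mulrC ler_pdivrMr// mul1r.
  move=> /(RintegrableZl (2^-1 ^+ n.+1) m2).
  congr (lam.-integrable _ _); apply/funext => y /=.
  by rewrite addr0 weak_singularityZ// mulrA -exprMn mulfV ?invr_eq0// expr1n mul1r.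
have /(integrable_affine (- x) ltr01 m2) [/(_ i2) + _] := @mwE (eball 2).
under eq_fun do rewrite /= scale1r.
apply: integrableS => //.
  rewrite (_ : +%R^~ (- x) = (fun y => 1 *: y + - x)).
    exact: measurable_preimage_affine.
  by apply/funext => y; rewrite scale1r.
move=> y; rewrite /eball /= => y1.
rewrite enorm_le_ssq//.
apply: (@le_trans _ _ (2 * ssq y + 2 * ssq x)).
  rewrite /ssq !mulr_sumr -big_split; apply: ler_sum => j _ /=; rewrite !mxE.
  have : 0 <= (y 0 j + x 0 j) ^+ 2 by exact: sqr_ge0.
  by rewrite !expr2; lra.
move: x1 y1; rewrite !enorm_le_ssq// expr1n; lra.
Qed.

End weak_singularity.

(** * The kernels regularized by e *)

Section kernel.
Variables (R : realType) (n : nat) (x : 'rV[R]_n).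
Implicit Types (y : 'rV[R]_n) (i l : 'I_n) (p : nat) (e : R).

Definition rinv e y : R := (ssq (y - x) + e)^-1.

(* z_i (|z|^2 + e)^-(p+1) with z = y - x: for e = 0, up to constants, the i-th
   component of the iterated Laplacians of the kernel; for e > 0, a smooth
   regularization. *)
Definition ker p e i y : R := (y 0 i - x 0 i) * rinv e y ^+ p.+1.

Definition dker p e i l y : R :=
  (i == l)%:R * rinv e y ^+ p.+1
  - 2 * p.+1%:R * (y 0 i - x 0 i) * (y 0 l - x 0 l) * rinv e y ^+ p.+2.

Definition d2ker p e i l y : R :=
  - 2 * p.+1%:R * (2 * (i == l)%:R * (y 0 l - x 0 l) + (y 0 i - x 0 i)) * rinv e y ^+ p.+2
  + 4 * p.+1%:R * p.+2%:R * (y 0 i - x 0 i) * (y 0 l - x 0 l) ^+ 2 * rinv e y ^+ p.+3.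

(** The Laplacian of [ker p e i], by [sum_d2ker], arranged as the kernel of order p + 1 times a
    factor bounded uniformly in e, since |z|^2 [rinv] lies in [0, 1]. *)
Definition lapker p e i y : R :=
  2 * p.+1%:R * (y 0 i - x 0 i) * rinv e y ^+ p.+2 *
  (2 * p.+2%:R * (ssq (y - x) * rinv e y) - n.+2%:R).

Lemma ssq_subE y : ssq (y - x) = \sum_i (y 0 i - x 0 i) ^+ 2.
Proof. by apply: eq_bigr => i _; rewrite !mxE. Qed.

Lemma rinv_ge0 e y : 0 <= e -> 0 <= rinv e y.
Proof. by move=> e0; rewrite invr_ge0 addr_ge0// ssq_ge0. Qed.

Section derivatives.
Variables (e : R) (y : 'rV[R]_n).
Hypothesis y0 : ssq (y - x) + e != 0.

Lemma is_derive_coordB i l : is_derive y (delta_mx 0 l)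
  (fun z : 'rV[R]_n => z 0 i - x 0 i) (i == l)%:R.
Proof.
have := isdB (is_derive_coord y (delta_mx 0 l) i) (isd_cst y (delta_mx 0 l) (x 0 i)).
by rewrite mxE eqxx /= subr0.
Qed.

Lemma is_derive_ssq_sub l : is_derive y (delta_mx 0 l)
  (fun z : 'rV[R]_n => ssq (z - x)) (2 * (y 0 l - x 0 l)).
Proof.
have := isd_sum (fun j => isdX 1 (is_derive_coordB j l)).
rewrite (_ : (fun z => _) = (fun z : 'rV[R]_n => ssq (z - x))); last first.
  by apply/funext => z; rewrite ssq_subE.
move=> /is_derive_eq; apply.
rewrite (bigD1 l)//= big1 => [|j ji]; last by rewrite (negbTE ji) mulr0.
by rewrite eqxx expr1 mulr1 addr0.
Qed.

Lemma is_derive_rinv l : is_derive y (delta_mx 0 l) (rinv e)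
  (- 2 * (y 0 l - x 0 l) * rinv e y ^+ 2).
Proof.
have := isdV y0 (isdD (is_derive_ssq_sub l) (isd_cst y (delta_mx 0 l) e)).
by move=> /is_derive_eq; apply; rewrite /rinv; ring.
Qed.

Lemma is_derive_ker p i l :
  is_derive y (delta_mx 0 l) (ker p e i) (dker p e i l y).
Proof.
have := isdM (is_derive_coordB i l) (isdX p (is_derive_rinv l)).
by move=> /is_derive_eq; apply; rewrite /dker !exprS; ring.
Qed.

Lemma is_derive_dker p i l :
  is_derive y (delta_mx 0 l) (dker p e i l) (d2ker p e i l y).
Proof.
have d1 := isdM (isd_cst y (delta_mx 0 l) (i == l)%:R) (isdX p (is_derive_rinv l)).
have d2 := isdM (isdM (isdM (isd_cst y (delta_mx 0 l) (2 * p.+1%:R))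
  (is_derive_coordB i l)) (is_derive_coordB l l)) (isdX p.+1 (is_derive_rinv l)).
move: (isdB d1 d2) => /is_derive_eq; apply.
rewrite /d2ker eqxx !exprS -(natr1 p.+1) -(natr1 p) /=.
move: (rinv e y ^+ p) (p%:R) (rinv e y) => r q s.
have [->|il] := eqVneq i l; rewrite /= ?mulr1n ?mulr0n; ring.
Qed.

Lemma sum_d2ker p i : \sum_l d2ker p e i l y = lapker p e i y.
Proof.
rewrite /d2ker big_split /= -!mulr_suml -!mulr_sumr big_split /=.
rewrite sumr_const card_ord (bigD1 i)//= big1 ?addr0 => [|l li]; last first.
  by rewrite eq_sym (negbTE li) mulr0 mul0r.
rewrite -ssq_subE eqxx /lapker !exprS -[_ *+ n]mulr_natl mulr1n.
by move: (rinv e y ^+ p) => r; ring.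
Qed.

End derivatives.

(** For e = 0 the product |z|^2 [rinv] equals 1 off the pole; at the pole both sides are 0 by the
    convention on inverses, so no point has to be excluded. *)
Lemma lapker0 p i y :
  lapker p 0 i y = 2 * p.+1%:R * (2 * p.+1%:R - n%:R) * ker p.+1 0 i y.
Proof.
rewrite /lapker /ker /rinv addr0; have [yx|yx] := eqVneq (ssq (y - x)) 0.
  by rewrite yx invr0 !exprS !(mul0r, mulr0).
by rewrite mulfV// -(natr1 p.+1) -!natr1; ring.
Qed.

Lemma continuous_coordB i : continuous (fun y : 'rV[R]_n => y 0 i - x 0 i).
Proof. by apply: ctsB; [exact: coord_continuous|exact: cst_continuous]. Qed.

Lemma continuous_ssq_sub : continuous (fun y : 'rV[R]_n => ssq (y - x)).
Proof.
under eq_fun do rewrite ssq_subE.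
by apply: cts_sum => i _; apply: ctsX; exact: continuous_coordB.
Qed.

Section continuity.
Variables (e : R).
Hypothesis e0 : 0 < e.

Lemma ssq_sub_addr_neq0 y : ssq (y - x) + e != 0.
Proof. by rewrite gt_eqF// ltr_wpDl// ssq_ge0. Qed.

Lemma continuous_rinv : continuous (rinv e).
Proof.
apply: ctsV; first exact: ssq_sub_addr_neq0.
by apply: ctsD; [exact: continuous_ssq_sub|exact: cst_continuous].
Qed.

Lemma continuous_ker p i : continuous (ker p e i).
Proof.
apply: ctsM; first exact: continuous_coordB.
by apply: ctsX; exact: continuous_rinv.
Qed.

Lemma continuous_dker p i l : continuous (dker p e i l).
Proof.
apply: ctsB; apply: ctsM; do ?[by apply: ctsX; exact: continuous_rinv].
  exact: cst_continuous.
apply: ctsM; last exact: continuous_coordB.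
by apply: ctsM; [exact: cst_continuous|exact: continuous_coordB].
Qed.

Lemma continuous_d2ker p i l : continuous (d2ker p e i l).
Proof.
apply: ctsD; apply: ctsM; do ?[by apply: ctsX; exact: continuous_rinv].
  apply: ctsM; first exact: cst_continuous.
  apply: ctsD; last exact: continuous_coordB.
  by apply: ctsM; [exact: cst_continuous|exact: continuous_coordB].
apply: ctsM; last by apply: ctsX; exact: continuous_coordB.
by apply: ctsM; [exact: cst_continuous|exact: continuous_coordB].
Qed.

Lemma continuous_lapker p i : continuous (lapker p e i).
Proof.
rewrite (_ : lapker p e i = fun y => \sum_l d2ker p e i l y); last first.
  by apply/funext => y; rewrite sum_d2ker.
by apply: cts_sum => l _; exact: continuous_d2ker.
Qed.

End continuity.

Lemma rinv_le e y : 0 <= e -> y != x -> rinv e y <= (ssq (y - x))^-1.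
Proof.
move=> e0 yx; have s0 : 0 < ssq (y - x).
  by rewrite lt_neqAle ssq_ge0 eq_sym ssq_eq0 subr_eq0 yx.
by rewrite lef_pV2 ?posrE ?lerDl// ltr_pwDl.
Qed.

Lemma coordB_le i y : `|y 0 i - x 0 i| <= enorm (y - x).
Proof. by have := normr_coord_le (y - x) i; rewrite !mxE. Qed.

(** The bound does not depend on e: one function dominates the whole regularized family. *)
Lemma ker_le p e i y : 0 <= e ->
  `|ker p e i y| <= (enorm (y - x))^-1 ^+ p.*2.+1.
Proof.
move=> e0; have [->|yx] := eqVneq y x.
  by rewrite /ker subrr mul0r normr0 exprn_ge0// invr_ge0 enorm_ge0.
have z0 : enorm (y - x) != 0 by rewrite enorm_eq0 subr_eq0.
rewrite /ker normrM (ger0_norm (exprn_ge0 _ (rinv_ge0 y e0))).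
apply: (@le_trans _ _ (enorm (y - x) * (ssq (y - x))^-1 ^+ p.+1)).
  apply: ler_pM => //; [by rewrite exprn_ge0// rinv_ge0|exact: coordB_le|].
  by apply: lerXn2r; rewrite ?nnegrE ?rinv_ge0 ?invr_ge0 ?ssq_ge0// rinv_le.
rewrite -enorm_sqr -exprVn -exprM mul2n doubleS exprS mulrA mulfV// mul1r.
by rewrite exprS.
Qed.

Lemma ssqM_rinv_le1 e y : 0 <= e -> 0 <= ssq (y - x) * rinv e y <= 1.
Proof.
move=> e0; rewrite mulr_ge0 ?ssq_ge0 ?rinv_ge0//= /rinv.
have [->|s0] := eqVneq (ssq (y - x) + e) 0; first by rewrite invr0 mulr0.
by rewrite ler_pdivrMr ?mul1r ?lerDl// lt_neqAle eq_sym s0 addr_ge0// ssq_ge0.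
Qed.

Lemma lapker_le p e i y : 0 <= e ->
  `|lapker p e i y| <= 2 * p.+1%:R * (2 * p.+2%:R + n.+2%:R) *
    (enorm (y - x))^-1 ^+ p.*2.+3.
Proof.
move=> e0.
have -> : lapker p e i y = 2 * p.+1%:R * (2 * p.+2%:R * (ssq (y - x) * rinv e y) - n.+2%:R)
    * ker p.+1 e i y by rewrite /lapker /ker; ring.
rewrite normrM; apply: ler_pM => //; last exact: ker_le.
rewrite normrM ger0_norm; last by rewrite mulr_ge0.
apply: ler_wpM2l; first by rewrite mulr_ge0.
apply: le_trans (ler_normB _ _) _; rewrite [`|n.+2%:R|]ger0_norm// lerD2r.
have /andP[a0 a1] := ssqM_rinv_le1 y e0.
rewrite ger0_norm; last by rewrite !mulr_ge0// (ssq_ge0, rinv_ge0).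
by rewrite -[leRHS]mulr1 ler_wpM2l// mulr_ge0.
Qed.

End kernel.

Section kernel_limits.
Variables (R : realType) (n : nat) (x : 'rV[R]_n.+2).
Hypothesis x1 : enorm x < 1.
Local Notation lam := (lebesgue_rV R n.+2).
Local Notation sigma := (sphere_measure R n.+2).
Local Notation S := (unit_sphere R n.+2).
Local Notation V := 'rV[R]_n.+2.
Implicit Types (y : V) (i l : 'I_n.+2) (p : nat).

Lemma measurable_rinv (e : R) : 0 <= e -> measurable_fun setT (rinv x e).
Proof.
move=> e0; rewrite /rinv.
under eq_fun do rewrite -powR_inv1 ?addr_ge0 ?ssq_ge0//.
apply: (measurableT_comp (measurable_powR _)).
apply: measurable_continuous_rV; apply: ctsD; last exact: cst_continuous.
exact: continuous_ssq_sub.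
Qed.

Lemma measurable_coordB i : measurable_fun setT (fun y : V => y 0 i - x 0 i).
Proof. by apply: measurable_continuous_rV; exact: continuous_coordB. Qed.

Lemma measurable_ker p (e : R) i : 0 <= e -> measurable_fun setT (ker x p e i).
Proof.
move=> e0; apply: measurable_funM; first exact: measurable_coordB.
by apply: measurable_funX; exact: measurable_rinv.
Qed.

Lemma measurable_dker p (e : R) i l : 0 <= e ->
  measurable_fun setT (dker x p e i l).
Proof.
move=> e0; apply: measurable_funB; apply: measurable_funM => //;
  do ?[by apply: measurable_funX; exact: measurable_rinv].
by do 2![apply: measurable_funM => //; last exact: measurable_coordB].
Qed.

Lemma measurable_lapker p (e : R) i : 0 <= e ->
  measurable_fun setT (lapker x p e i).
Proof.
move=> e0; apply: measurable_funM; [apply: measurable_funM|apply: measurable_funB => //].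
- by apply: measurable_funM => //; exact: measurable_coordB.
- by apply: measurable_funX; exact: measurable_rinv.
apply: measurable_funM => //; apply: measurable_funM; last exact: measurable_rinv.
by apply: measurable_continuous_rV; exact: continuous_ssq_sub.
Qed.

Lemma cvg_rinv y : y != x ->
  rinv x k.+1%:R^-1 y @[k --> \oo] --> rinv x 0 y.
Proof.
move=> yx; apply: cvgV; first by rewrite addr0 ssq_eq0 subr_eq0.
apply: cvgD; first exact: cvg_cst.
exact: cvg_harmonic.
Qed.

Lemma cvg_rinvX y p : y != x ->
  rinv x k.+1%:R^-1 y ^+ p @[k --> \oo] --> rinv x 0 y ^+ p.
Proof.
by move=> yx; exact: (cvg_comp _ _ (cvg_rinv yx) (@exprn_continuous R p _)).
Qed.

Lemma cvg_ker p i y : ker x p k.+1%:R^-1 i y @[k --> \oo] --> ker x p 0 i y.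
Proof.
have [->|yx] := eqVneq y x.
  by rewrite /ker subrr; under eq_fun do rewrite mul0r; rewrite mul0r; exact: cvg_cst.
by apply: cvgM; [exact: cvg_cst|exact: cvg_rinvX].
Qed.

Lemma cvg_lapker p i y :
  lapker x p k.+1%:R^-1 i y @[k --> \oo] --> lapker x p 0 i y.
Proof.
have [->|yx] := eqVneq y x.
  rewrite /lapker subrr; under eq_fun do rewrite !(mulr0, mul0r).
  by rewrite !(mulr0, mul0r); exact: cvg_cst.
apply: cvgM; first by apply: cvgM; [exact: cvg_cst|exact: cvg_rinvX].
apply: cvgB; last exact: cvg_cst.
apply: cvgM; first exact: cvg_cst.
by apply: cvgM; [exact: cvg_cst|exact: cvg_rinv].
Qed.

Lemma cvg_dker p i l y : y != x ->
  dker x p k.+1%:R^-1 i l y @[k --> \oo] --> dker x p 0 i l y.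
Proof.
by move=> yx; apply: cvgB; apply: cvgM; do ?[exact: cvg_cst|exact: cvg_rinvX].
Qed.

Lemma enorm_sub_le2 y : enorm y <= 1 -> enorm (y - x) <= 2.
Proof.
move: (ltW x1); rewrite !enorm_le_ssq// expr1n => x2 y1.
apply: (@le_trans _ _ (2 * ssq y + 2 * ssq x)); last by lra.
rewrite /ssq !mulr_sumr -big_split; apply: ler_sum => j _ /=; rewrite !mxE.
have : 0 <= (y 0 j + x 0 j) ^+ 2 by exact: sqr_ge0.
by rewrite !expr2; lra.
Qed.

(** Lower orders are absorbed by the critical one because |y - x| <= 2 on the ball. The exponent is
    positive, so that both sides vanish at the pole. *)
Lemma invX_enorm_le y q : enorm y <= 1 -> (q.+1 <= n.+1)%N ->
  (enorm (y - x))^-1 ^+ q.+1 <= 2 ^+ n.+1 * weak_singularity (y - x).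
Proof.
move=> /enorm_sub_le2 y2 qn; rewrite /weak_singularity.
set t := enorm (y - x) in y2 *.
have t0 : 0 <= t by exact: enorm_ge0.
have [->|tn0] := eqVneq t 0; first by rewrite invr0 !expr0n/= mulr0.
rewrite -(subnK qn) !exprD [leRHS]mulrACA -[leLHS]mul1r.
apply: ler_pM => //; first by rewrite exprn_ge0// invr_ge0.
  rewrite -exprMn exprn_ege1//.
  by rewrite ler_pdivlMr ?mul1r// lt_neqAle eq_sym tn0.
by rewrite -[leLHS]mul1r ler_wpM2r ?exprn_ge0 ?invr_ge0// exprn_ege1// ler1n.
Qed.

Lemma volume_dominated_cvg (F_ : nat -> V -> R) (F : V -> R) (C : R) q :
  (q.+1 <= n.+1)%N -> 0 <= C ->
  (forall k, measurable_fun setT (F_ k)) -> measurable_fun setT F ->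
  (forall y, enorm y <= 1 -> F_ k y @[k --> \oo] --> F y) ->
  (forall k y, enorm y <= 1 -> `|F_ k y| <= C * (enorm (y - x))^-1 ^+ q.+1) ->
  lam.-integrable (eball 1) (EFin \o F) /\
  \int[lam]_(y in eball 1) F_ k y @[k --> \oo] --> \int[lam]_(y in eball 1) F y.
Proof.
move=> qn C0 mF_ mF cF leF.
have mB := @measurable_eball R n.+2 1.
apply: (@Rintegral_dominated_cvg _ _ _ lam _ F_ F
  (fun y => C * 2 ^+ n.+1 * weak_singularity (y - x))) => //.
- by move=> k; exact: measurable_funTS.
- exact: measurable_funTS.
- by apply: aeW => y; exact: cF.
- by apply: RintegrableZl => //; exact: integrable_weak_singularity (ltW x1).
- move=> k y y1; apply: (le_trans (leF k y y1)).
  by rewrite -mulrA ler_wpM2l//; exact: invX_enorm_le.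
Qed.

Lemma sphere_dominated_cvg (F_ : nat -> V -> R) (F : V -> R) (M : R) :
  (forall k, measurable_fun setT (F_ k)) -> measurable_fun setT F ->
  (forall y, S y -> F_ k y @[k --> \oo] --> F y) ->
  (forall k y, S y -> `|F_ k y| <= M) ->
  sigma.-integrable S (EFin \o F) /\
  \int[sigma]_(y in S) F_ k y @[k --> \oo] --> \int[sigma]_(y in S) F y.
Proof.
move=> mF_ mF cF leF.
have mS := @measurable_unit_sphere R n.+1.
apply: (@Rintegral_dominated_cvg _ _ _ sigma _ F_ F (fun y => M)) => //.
- by move=> k; exact: measurable_funTS.
- exact: measurable_funTS.
- by apply: aeW => y; exact: cF.
- apply: (@bounded_integrable _ _ _ _ _ _ `|M|) => //.
  exact: sphere_measure_lty.
Qed.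

(** The reverse triangle inequality for the Euclidean norm. Cauchy-Schwarz is obtained by expanding
    the sum of the squares (x_j - t y_j)^2 >= 0 at t = |x|. *)
Lemma ssq_sub_sphere_ge y : S y -> (1 - enorm x) ^+ 2 <= ssq (y - x).
Proof.
move=> Sy; have y1 : ssq y = 1 by rewrite -enorm_sqr Sy expr1n.
pose dot := \sum_j y 0 j * x 0 j.
have E t : \sum_j (x 0 j - t * y 0 j) ^+ 2 = ssq x - 2 * t * dot + t ^+ 2 * ssq y.
  rewrite /ssq /dot !mulr_sumr -sumrN -!big_split; apply: eq_bigr => j _ /=; ring.
have dot_le : dot <= enorm x.
  have [x0|x0] := eqVneq (enorm x) 0.
    move/eqP: (x0); rewrite enorm_eq0 => /eqP x00.
    by rewrite x0 /dot big1// => j _; rewrite x00 mxE mulr0.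
  have := E (enorm x); rewrite y1 mulr1 enorm_sqr => E1.
  have : 0 <= ssq x - 2 * enorm x * dot + ssq x.
    by rewrite -E1 sumr_ge0// => j _; exact: sqr_ge0.
  rewrite -enorm_sqr => E2.
  have e0 : 0 < enorm x by rewrite lt_neqAle eq_sym x0 enorm_ge0.
  by rewrite -(ler_pM2l e0); move: E2; rewrite !expr2; lra.
have -> : ssq (y - x) = 1 - 2 * dot + ssq x.
  rewrite (_ : _ + ssq x = ssq x - 2 * 1 * dot + 1 ^+ 2 * ssq y); last first.
    by rewrite y1; ring.
  by rewrite -E ssq_subE; apply: eq_bigr => j _; ring.
by rewrite -enorm_sqr !expr2; lra.
Qed.

Let b : R := ((1 - enorm x) ^+ 2)^-1.

Let x0 : 0 < (1 - enorm x) ^+ 2.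
Proof. by rewrite exprn_gt0// subr_gt0. Qed.

Lemma sphere_neq y : S y -> y != x.
Proof.
by move=> Sy; apply/eqP => yx; move: x1; rewrite -yx Sy ltxx.
Qed.

Lemma rinv_sphere_le (e : R) y : 0 <= e -> S y -> rinv x e y <= b.
Proof.
move=> e0 Sy; apply: (le_trans (rinv_le e0 (sphere_neq Sy))).
rewrite lef_pV2 ?posrE ?ssq_sub_sphere_ge//.
exact: lt_le_trans (ssq_sub_sphere_ge Sy).
Qed.

Lemma ker_sphere_le p (e : R) i y : 0 <= e -> S y ->
  `|ker x p e i y| <= 2 * b ^+ p.+1.
Proof.
move=> e0 Sy; rewrite normrM ler_pM//.
  apply: le_trans (coordB_le x i y) _; apply: enorm_sub_le2.
  by rewrite Sy.
rewrite ger0_norm ?exprn_ge0 ?rinv_ge0//.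
apply: lerXn2r; rewrite ?nnegrE ?rinv_ge0 ?rinv_sphere_le//.
by rewrite invr_ge0 ltW.
Qed.

Lemma dker_sphere_le p (e : R) i l y : 0 <= e -> S y ->
  `|dker x p e i l y| <= b ^+ p.+1 + 2 * p.+1%:R * 4 * b ^+ p.+2.
Proof.
move=> e0 Sy; have b0 : 0 <= b by rewrite invr_ge0 ltW.
have rb q : rinv x e y ^+ q <= b ^+ q.
  by apply: lerXn2r; rewrite ?nnegrE ?rinv_ge0 ?rinv_sphere_le.
have r0 q : 0 <= rinv x e y ^+ q by rewrite exprn_ge0// rinv_ge0.
have z2 j : `|y 0 j - x 0 j| <= 2.
  apply: le_trans (coordB_le x j y) _; apply: enorm_sub_le2.
  by rewrite Sy.
apply: le_trans (ler_normB _ _) _; apply: lerD.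
  rewrite normrM -[leRHS]mul1r ler_pM//; first by case: eqP; rewrite ?normr1 ?normr0.
  by rewrite ger0_norm.
rewrite normrM ler_pM//; last by rewrite ger0_norm.
rewrite !normrM -mulrA; apply: ler_pM => //; first by rewrite -normrM ger0_norm.
rewrite (_ : 4 = 2 * 2); last by ring.
by apply: ler_pM.
Qed.

End kernel_limits.

Section continuous_integrable.
Variables (R : realType) (n : nat).
Implicit Types f : 'rV[R]_n.+1 -> R.

Lemma continuous_integrable_ball f : continuous f ->
  (lebesgue_rV R n.+1).-integrable (eball 1) (EFin \o f).
Proof.
move=> cf; have [M fM] := continuous_bounded_eball 1 cf.
apply: (@bounded_integrable _ _ _ _ _ _ M) => //.
- exact: measurable_eball.
- exact: lebesgue_unit_ball_lty.
- exact: measurable_funTS (measurable_continuous_rV cf).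
Qed.

Lemma continuous_integrable_sphere f : continuous f ->
  (sphere_measure R n.+1).-integrable (unit_sphere R n.+1) (EFin \o f).
Proof.
move=> cf; have [M fM] := continuous_bounded_eball 1 cf.
apply: (@bounded_integrable _ _ _ _ _ _ M) => //.
- exact: measurable_unit_sphere.
- exact: sphere_measure_lty.
- exact: measurable_funTS (measurable_continuous_rV cf).
- by move=> y Sy; apply: fM; rewrite Sy.
Qed.

End continuous_integrable.

(** * Green's second identity on the ball *)

Section green.
Variables (R : realType) (n : nat) (x : 'rV[R]_n.+2).
Hypothesis x1 : enorm x < 1.
Local Notation lam := (lebesgue_rV R n.+2).
Local Notation sigma := (sphere_measure R n.+2).
Local Notation S := (unit_sphere R n.+2).
Local Notation V := 'rV[R]_n.+2.
Variables (v : V -> R) (dv d2v : 'I_n.+2 -> V -> R).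
Hypotheses (vc : continuous v) (dvc : forall l, continuous (dv l)).
Hypothesis d2vc : forall l, continuous (d2v l).
Hypothesis vd : forall l y, is_derive y (delta_mx 0 l) v (dv l y).
Hypothesis dvd : forall l y, is_derive y (delta_mx 0 l) (dv l) (d2v l y).

Let Lv (y : V) := \sum_l d2v l y.
(** The outward normal at a point of the unit sphere is the point itself, so on the sphere [dn] and
    [dkn] are normal derivatives. *)
Let dn (y : V) := \sum_l y 0 l * dv l y.
Let dkn p e i (y : V) := \sum_l y 0 l * dker x p e i l y.

Let cLv : continuous Lv. Proof. by apply: cts_sum => l _; exact: d2vc. Qed.
Let cdn : continuous dn.
Proof.
by apply: cts_sum => l _; apply: ctsM => //; exact: coord_continuous.
Qed.

Let mS := @measurable_unit_sphere R n.+1.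
Let mB := @measurable_eball R n.+2 1.

(** Gauss' theorem for the field k grad v - v grad k, in whose divergence the products of first
    derivatives cancel. *)
Lemma green_regularized p (e : R) i : 0 < e ->
  \int[lam]_(y in eball 1) (ker x p e i y * Lv y - lapker x p e i y * v y) =
  \int[sigma]_(y in S) (ker x p e i y * dn y - dkn p e i y * v y).
Proof.
move=> e0.
pose g l y := ker x p e i y * dv l y - dker x p e i l y * v y.
pose dg l y := ker x p e i y * d2v l y - d2ker x p e i l y * v y.
have gc l : continuous (g l).
  by apply: ctsB; apply: ctsM => //; [exact: continuous_ker|exact: continuous_dker].
have dgc l : continuous (dg l).
  by apply: ctsB; apply: ctsM => //; [exact: continuous_ker|exact: continuous_d2ker].
have gd l y : is_derive y (delta_mx 0 l) (g l) (dg l y).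
  have yx := ssq_sub_addr_neq0 x e0 y.
  have := isdB (isdM (is_derive_ker yx p i l) (dvd l y))
    (isdM (is_derive_dker yx p i l) (vd l y)).
  by move=> /is_derive_eq; apply; rewrite /dg; ring.
have E l := divergence_unit_ball (gc l) (dgc l) (gd l).
transitivity (\sum_l \int[lam]_(y in eball 1) dg l y).
  rewrite -Rintegral_sum//; last by move=> l _; exact: continuous_integrable_ball.
  apply: eq_Rintegral => y _; rewrite /dg sumrB -mulr_sumr -mulr_suml sum_d2ker//.
under eq_bigr do rewrite E.
rewrite -Rintegral_sum//; last first.
  move=> l _; apply: continuous_integrable_sphere; apply: ctsM => //.
  exact: coord_continuous.
apply: eq_Rintegral => y _; rewrite /dn /dkn mulr_sumr mulr_suml -sumrB.
by apply: eq_bigr => l _; rewrite /g; ring.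
Qed.

Let mdkn p (e : R) i : 0 <= e -> measurable_fun setT (dkn p e i).
Proof.
move=> e0; apply: measurable_sum => l; apply: measurable_funM.
  exact: measurable_rV_coord.
exact: measurable_dker.
Qed.

(** The condition says that the order 2p + 1 of the kernel is at most dim - 1 = n + 1; for [lapker],
    of order 2p + 3, it becomes [p.*2.+2 <= n]. *)
Lemma cvg_volume_ker p i (phi : V -> R) : continuous phi -> (p.*2 <= n)%N ->
  lam.-integrable (eball 1) (EFin \o (fun y => ker x p 0 i y * phi y)) /\
  \int[lam]_(y in eball 1) (ker x p k.+1%:R^-1 i y * phi y) @[k --> \oo] -->
  \int[lam]_(y in eball 1) (ker x p 0 i y * phi y).
Proof.
move=> cphi pn; have [M phiM] := continuous_bounded_eball 1 cphi.
have mphi := measurable_continuous_rV cphi.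
have M0 : 0 <= M by apply: le_trans (phiM 0 _); rewrite // (eqP (_ : enorm 0 == 0)) ?enorm_eq0.
apply: (@volume_dominated_cvg _ _ _ x1 _ _ M p.*2) => //.
- by move=> k; apply: measurable_funM => //; exact: measurable_ker.
- by apply: measurable_funM => //; exact: measurable_ker.
- by move=> y _; apply: cvgM; [exact: cvg_ker|exact: cvg_cst].
- move=> k y y1; rewrite normrM mulrC ler_pM//; first exact: phiM.
  exact: ker_le.
Qed.

Lemma cvg_volume_lapker p i (phi : V -> R) : continuous phi -> (p.*2.+2 <= n)%N ->
  lam.-integrable (eball 1) (EFin \o (fun y => lapker x p 0 i y * phi y)) /\
  \int[lam]_(y in eball 1) (lapker x p k.+1%:R^-1 i y * phi y) @[k --> \oo] -->
  \int[lam]_(y in eball 1) (lapker x p 0 i y * phi y).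
Proof.
move=> cphi pn; have [M phiM] := continuous_bounded_eball 1 cphi.
have mphi := measurable_continuous_rV cphi.
have M0 : 0 <= M by apply: le_trans (phiM 0 _); rewrite // (eqP (_ : enorm 0 == 0)) ?enorm_eq0.
pose C : R := 2 * p.+1%:R * (2 * p.+2%:R + n.+4%:R).
have C0 : 0 <= C by rewrite !mulr_ge0// addr_ge0// mulr_ge0.
apply: (@volume_dominated_cvg _ _ _ x1 _ _ (M * C) p.*2.+2) => //.
- exact: mulr_ge0.
- by move=> k; apply: measurable_funM => //; exact: measurable_lapker.
- by apply: measurable_funM => //; exact: measurable_lapker.
- by move=> y _; apply: cvgM; [exact: cvg_lapker|exact: cvg_cst].
- move=> k y y1; rewrite normrM mulrC -mulrA ler_pM//; first exact: phiM.
  exact: lapker_le.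
Qed.

Lemma cvg_sphere_ker p i (phi : V -> R) : continuous phi ->
  sigma.-integrable S (EFin \o (fun y => ker x p 0 i y * phi y)) /\
  \int[sigma]_(y in S) (ker x p k.+1%:R^-1 i y * phi y) @[k --> \oo] -->
  \int[sigma]_(y in S) (ker x p 0 i y * phi y).
Proof.
move=> cphi; have [M phiM] := continuous_bounded_eball 1 cphi.
have mphi := measurable_continuous_rV cphi.
apply: (@sphere_dominated_cvg _ _ _ _ (2 * ((1 - enorm x) ^+ 2)^-1 ^+ p.+1 * M)) => //.
- by move=> k; apply: measurable_funM => //; exact: measurable_ker.
- by apply: measurable_funM => //; exact: measurable_ker.
- by move=> y _; apply: cvgM; [exact: cvg_ker|exact: cvg_cst].
- move=> k y Sy; rewrite normrM ler_pM//; first exact: ker_sphere_le.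
  by apply: phiM; rewrite Sy.
Qed.

Lemma cvg_sphere_dker p i (phi : V -> R) : continuous phi ->
  sigma.-integrable S (EFin \o (fun y => dkn p 0 i y * phi y)) /\
  \int[sigma]_(y in S) (dkn p k.+1%:R^-1 i y * phi y) @[k --> \oo] -->
  \int[sigma]_(y in S) (dkn p 0 i y * phi y).
Proof.
move=> cphi; have [M phiM] := continuous_bounded_eball 1 cphi.
have mphi := measurable_continuous_rV cphi.
pose b : R := ((1 - enorm x) ^+ 2)^-1.
pose C : R := b ^+ p.+1 + 2 * p.+1%:R * 4 * b ^+ p.+2.
apply: (@sphere_dominated_cvg _ _ _ _ ((\sum_(l < n.+2) C) * M)) => //.
- by move=> k; apply: measurable_funM => //; exact: mdkn.
- by apply: measurable_funM => //; exact: mdkn.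
- move=> y Sy; apply: cvgM; last exact: cvg_cst.
  apply: cvg_big => [|l _]; first exact: add_continuous.
  apply: cvgM; first exact: cvg_cst.
  have yx := sphere_neq x1 Sy.
  exact: cvg_dker.
- move=> k y Sy; rewrite normrM ler_pM//; last by apply: phiM; rewrite Sy.
  apply: (le_trans (ler_norm_sum _ _ _)); apply: ler_sum => l _.
  rewrite normrM -[leRHS]mul1r ler_pM//; last exact: dker_sphere_le.
  by rewrite -Sy; exact: normr_coord_le.
Qed.

(* The identity for e > 0 passes to the limit, since the kernel and its Laplacian
   are O(|z|^(1-dim)). *)
Lemma green_ker p i : (p.*2.+2 <= n)%N ->
  \int[lam]_(y in eball 1) (ker x p 0 i y * Lv y) -
    \int[lam]_(y in eball 1) (lapker x p 0 i y * v y) =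
  \int[sigma]_(y in S) (ker x p 0 i y * dn y) -
    \int[sigma]_(y in S) (dkn p 0 i y * v y).
Proof.
move=> pn; have pn' : (p.*2 <= n)%N by apply: leq_trans pn; rewrite !leqW.
have [_ c1] := cvg_volume_ker i cLv pn'.
have [_ c2] := cvg_volume_lapker i vc pn.
have [_ c3] := cvg_sphere_ker p i cdn.
have [_ c4] := cvg_sphere_dker p i vc.
have c12 : \int[lam]_(y in eball 1) (ker x p k.+1%:R^-1 i y * Lv y) -
      \int[lam]_(y in eball 1) (lapker x p k.+1%:R^-1 i y * v y) @[k --> \oo] -->
    \int[lam]_(y in eball 1) (ker x p 0 i y * Lv y) -
      \int[lam]_(y in eball 1) (lapker x p 0 i y * v y) by apply: cvgB.
have c34 : \int[sigma]_(y in S) (ker x p k.+1%:R^-1 i y * dn y) -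
      \int[sigma]_(y in S) (dkn p k.+1%:R^-1 i y * v y) @[k --> \oo] -->
    \int[sigma]_(y in S) (ker x p 0 i y * dn y) -
      \int[sigma]_(y in S) (dkn p 0 i y * v y) by apply: cvgB.
apply: (cvg_unique (@Rhausdorff R) c12).
rewrite /= (_ : (fun k : nat => _) = (fun k : nat =>
   \int[sigma]_(y in S) (ker x p k.+1%:R^-1 i y * dn y) -
   \int[sigma]_(y in S) (dkn p k.+1%:R^-1 i y * v y)))//.
apply/funext => k.
have ek : 0 < k.+1%:R^-1 :> R by rewrite invr_gt0.
have ck : continuous (ker x p k.+1%:R^-1 i) by exact: continuous_ker.
have cl : continuous (lapker x p k.+1%:R^-1 i) by exact: continuous_lapker.
have i1 := continuous_integrable_ball (ctsM ck cLv).
have i2 := continuous_integrable_ball (ctsM cl vc).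
have i3 := continuous_integrable_sphere (ctsM ck cdn).
have cdkn : continuous (dkn p k.+1%:R^-1 i).
  apply: cts_sum => l _; apply: ctsM; first exact: coord_continuous.
  exact: continuous_dker.
have i4 := continuous_integrable_sphere (ctsM cdkn vc).
have := green_regularized p i ek.
by rewrite (RintegralB mB i1 i2) (RintegralB mS i3 i4).
Qed.

End green.

(** * Approximate identity *)

Section approximate_identity.
Variables (R : realType) (m : nat).
Local Notation N := m.*2.+2.
Local Notation lam := (lebesgue_rV R N).
Local Notation sigma := (sphere_measure R N).
Local Notation S := (unit_sphere R N).
Local Notation V := 'rV[R]_N.
Implicit Types (x y w : V) (e : R).

Definition mollifier x e y : R := N%:R * e * rinv x e y ^+ m.+2.

(** As 2 (m+1) = N, the trace is N [rinv]^(m+2) ((|z|^2 + e) - |z|^2): only the term with e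
    survives. *)
Lemma sum_dker_diag x e y : ssq (y - x) + e != 0 ->
  \sum_l dker x m e l l y = mollifier x e y.
Proof.
move=> s0; rewrite /dker sumrB.
rewrite (eq_bigr (fun=> rinv x e y ^+ m.+1)) => [|l _]; last by rewrite eqxx mul1r.
rewrite sumr_const card_ord.
rewrite (eq_bigr (fun l => 2 * m.+1%:R * (y 0 l - x 0 l) ^+ 2 * rinv x e y ^+ m.+2));
  last by move=> l _; ring.
rewrite -mulr_suml -mulr_sumr -ssq_subE /mollifier.
have E : ssq (y - x) * rinv x e y = 1 - e * rinv x e y.
  by rewrite /rinv; field.
rewrite (_ : _ * ssq (y - x) * _ = 2 * m.+1%:R * rinv x e y ^+ m.+1 * (ssq (y - x) * rinv x e y));
  last by rewrite (exprS _ m.+1); ring.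
have E0 : N%:R = 2 * m.+1%:R :> R by rewrite -doubleS -muln2 natrM mulrC.
by rewrite E (exprS _ m.+1) -[X in X - _]mulr_natl E0; ring.
Qed.

Lemma mollifier_ge0 x e y : 0 <= e -> 0 <= mollifier x e y.
Proof. by move=> e0; apply: mulr_ge0; [exact: mulr_ge0|rewrite exprn_ge0// rinv_ge0]. Qed.

Lemma measurable_mollifier x e : 0 <= e -> measurable_fun setT (mollifier x e).
Proof.
by move=> e0; apply: measurable_funM => //; apply: measurable_funX;
  exact: measurable_rinv.
Qed.

Lemma continuous_mollifier x e : 0 < e -> continuous (mollifier x e).
Proof.
move=> e0; apply: ctsM; first exact: cst_continuous.
by apply: ctsX; exact: continuous_rinv.
Qed.

(** The parameter e scales like a squared length, hence the [r ^+ 2]; the power of r in front is the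
    Jacobian. *)
Lemma mollifier_scale x (r : R) w : 0 < r ->
  r ^+ N * mollifier x (r ^+ 2) (r *: w + x) = mollifier 0 1 w.
Proof.
move=> r0; rewrite /mollifier /rinv addrK subr0.
have -> : ssq (r *: w) = r ^+ 2 * ssq w.
  by rewrite -!enorm_sqr enormZ exprMn gtr0_norm.
rewrite -[X in _ + X]mulr1 -mulrDr invfM exprMn -exprVn -exprM.
have r1 : r != 0 by rewrite gt_eqF.
rewrite (_ : (2 * m.+2)%N = (N + 2)%N); last by rewrite mul2n !doubleS addn2.
rewrite exprD; move: (ssq w + 1)^-1 => u.
have : r ^+ N * r^-1 ^+ N = 1 by rewrite -exprMn mulfV// expr1n.
have : r ^+ 2 * r^-1 ^+ 2 = 1 by rewrite -exprMn mulfV// expr1n.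
move: (r ^+ 2) (r^-1 ^+ 2) (r ^+ N) (r^-1 ^+ N) => a b c d ab cd.
rewrite (_ : _ * _ = (c * d) * (a * b) * (N%:R * u ^+ m.+2)); last by ring.
by rewrite ab cd; ring.
Qed.

Lemma sphere_measure_fin : (sigma S \is a fin_num)%E.
Proof. by rewrite ge0_fin_numE//; exact: sphere_measure_lty. Qed.

(** Being a divergence, the mollifier integrates to the flux of the kernel through the sphere, where
    the normal component is the constant (1 + e)^(-m-1). *)
Lemma Rintegral_mollifier_unit e : 0 < e ->
  \int[lam]_(y in eball 1) mollifier 0 e y = (1 + e) ^- m.+1 * fine (sigma S).
Proof.
move=> e0; have mB := @measurable_eball R N 1.
have mS := @measurable_unit_sphere R m.*2.+1.
have E l := divergence_unit_ball (continuous_ker (x := 0) e0 (p := m) (i := l))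
  (continuous_dker (x := 0) e0 (p := m) (i := l) (l := l))
  (fun y => is_derive_ker (ssq_sub_addr_neq0 0 e0 y) m l l).
transitivity (\sum_l \int[lam]_(y in eball 1) dker 0 m e l l y).
  rewrite -Rintegral_sum//; last first.
    by move=> l _; apply: continuous_integrable_ball; exact: continuous_dker.
  by apply: eq_Rintegral => y _; rewrite sum_dker_diag// ssq_sub_addr_neq0.
under eq_bigr do rewrite E.
rewrite -Rintegral_sum//; last first.
  move=> l _; apply: continuous_integrable_sphere; apply: ctsM.
    exact: coord_continuous.
  exact: continuous_ker.
rewrite -(Rintegral_cst sigma mS); apply: eq_Rintegral => y; rewrite inE => Sy.
rewrite (eq_bigr (fun l => y 0 l ^+ 2 * rinv 0 e y ^+ m.+1)) => [|l _]; last first.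
  by rewrite /ker mxE subr0; ring.
rewrite -mulr_suml -/(ssq y) /rinv subr0 -enorm_sqr Sy expr1n mul1r.
by rewrite exprVn.
Qed.

Lemma integral_mollifier :
  (\int[lam]_w (mollifier 0 1 w)%:E = sigma S)%E.
Proof.
have m0 w : (0 <= (mollifier 0 1 w)%:E)%E by rewrite lee_fin mollifier_ge0.
have mm : measurable_fun setT (EFin \o mollifier 0 1).
  by apply/measurable_EFinP; exact: measurable_mollifier.
pose B k := @eball R N k.+1%:R.
have mB k : measurable (B k) by exact: measurable_eball.
have ndB : nondecreasing_seq B.
  move=> k l kl; rewrite subsetEset => y; rewrite /B /eball /= => /le_trans; apply.
  by rewrite ler_nat ltnS.
have UB : \bigcup_k B k = setT.
  apply/seteqP; split => // y _; exists (Num.truncn (enorm y)) => //.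
  by rewrite /B /eball /= ltW// truncnS_gt.
have cv := @ge0_nondecreasing_set_cvg_integral _ _ _ B (EFin \o mollifier 0 1) lam ndB mB
  (fun k => measurable_funTS mm) (fun k y _ => m0 y).
rewrite UB in cv.
have E k : (\int[lam]_(w in B k) (mollifier 0 1 w)%:E =
    ((1 + k.+1%:R^-1 ^+ 2) ^- m.+1 * fine (sigma S))%:E)%E.
  have k0 : 0 < k.+1%:R :> R by [].
  have kV0 : 0 < k.+1%:R^-1 :> R by rewrite invr_gt0.
  rewrite -Rintegral_mollifier_unit ?exprn_gt0//.
  rewrite (@ge0_integral_affine _ _ k.+1%:R 0)//; last exact: measurable_funTS.
  have -> : (fun w : V => k.+1%:R *: w + 0) @^-1` B k = eball 1.
    apply/seteqP; split => w; rewrite /B /eball /= addr0 enormZ gtr0_norm//;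
    by rewrite ger_pMr.
  rewrite -ge0_integralZl//; last 2 first.
  - exact: measurable_eball.
  - apply: measurable_funTS; apply/measurable_EFinP.
    apply: measurableT_comp; first exact: measurable_mollifier.
    exact: measurable_affine_rV.
  rewrite /Rintegral fineK; last first.
    apply: integrable_fin_num; first exact: measurable_eball.
    by apply: continuous_integrable_ball; apply: continuous_mollifier; rewrite exprn_gt0.
  apply: eq_integral => w _; rewrite -EFinM; congr (_%:E).
  rewrite addr0 -(mollifier_scale 0 (k.+1%:R *: w) kV0) addr0 scalerA mulVf ?gt_eqF//.
  by rewrite scale1r mulrA -exprMn mulfV ?gt_eqF// expr1n mul1r.
rewrite -(cvg_lim _ cv)//.
under eq_fun do rewrite E.
rewrite -[RHS](fineK sphere_measure_fin); apply/cvg_lim => //.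
apply: cvg_EFin; first exact: nearW.
rewrite -[X in _ --> X]mul1r; apply: cvgM; last exact: cvg_cst.
have c1 : 1 + k.+1%:R^-1 ^+ 2 @[k --> \oo] --> (1 + 0 ^+ 2 : R).
  apply: cvgD; first exact: cvg_cst.
  exact: (cvg_comp _ _ (@cvg_harmonic R) (@exprn_continuous R 2 _)).
have c2 : (1 + k.+1%:R^-1 ^+ 2) ^- m.+1 @[k --> \oo] --> ((1 + 0 ^+ 2) ^- m.+1 : R).
  apply: cvgV; first by rewrite expr0n/= addr0 expr1n oner_eq0.
  exact: (cvg_comp _ _ c1 (@exprn_continuous R m.+1 _)).
by move: c2; rewrite expr0n/= addr0 expr1n invr1.
Qed.

Lemma integrable_mollifier : lam.-integrable setT (EFin \o mollifier 0 1).
Proof.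
apply/integrableP; split.
  by apply/measurable_EFinP; exact: measurable_mollifier.
under eq_integral do rewrite /= ger0_norm ?mollifier_ge0//.
by rewrite integral_mollifier; exact: sphere_measure_lty.
Qed.

(** After the substitution y = w / (k+1) + x the mollifier no longer depends on k, and serves as
    dominating function up to the bound of [phi]. The domains [D k] eventually contain every w
    because [x] is interior to the ball. *)
Lemma approximate_identity x (phi : V -> R) : enorm x < 1 -> continuous phi ->
  \int[lam]_(y in eball 1) (mollifier x (k.+1%:R^-1 ^+ 2) y * phi y) @[k --> \oo]
    --> fine (sigma S) * phi x.
Proof.
move=> x1 cphi; have mB := @measurable_eball R N 1.
have [M phiM] := continuous_bounded_eball 1 cphi.
have mphi := measurable_continuous_rV cphi.
have M0 : 0 <= M by apply: le_trans (phiM x (ltW x1)).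
pose T k (w : V) := k.+1%:R^-1 *: w + x.
have mT k : measurable_fun setT (T k) by exact: measurable_affine_rV.
have r0 k : 0 < k.+1%:R^-1 :> R by rewrite invr_gt0.
pose D k := T k @^-1` eball 1.
have mD k : measurable (D k) by exact: measurable_preimage_affine.
pose F k w := \1_(D k) w * (mollifier 0 1 w * phi (T k w)).
have E k : \int[lam]_(y in eball 1) (mollifier x (k.+1%:R^-1 ^+ 2) y * phi y) =
    \int[lam]_w F k w.
  rewrite (Rintegral_affine x (r0 k) mB); last first.
    by apply: continuous_integrable_ball; apply: ctsM => //;
      apply: continuous_mollifier; rewrite exprn_gt0.
  rewrite (@Rintegral_support _ _ _ _ (D k)); last first.
    by move=> w Dw; rewrite /F indicE memNset// mul0r.
  have iD : lam.-integrable (D k) (EFin \o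
      (fun w => mollifier x (k.+1%:R^-1 ^+ 2) (T k w) * phi (T k w))).
    have ci : continuous (fun y => mollifier x (k.+1%:R^-1 ^+ 2) y * phi y).
      by apply: ctsM => //; apply: continuous_mollifier; rewrite exprn_gt0.
    have mi := measurable_int _ (continuous_integrable_ball ci).
    have /(integrable_affine x (r0 k) mB) [+ _] := mi.
    by apply; exact: continuous_integrable_ball.
  rewrite -RintegralZl//; last exact: mD.
  apply: eq_Rintegral => w Dw; rewrite /F indicE Dw mul1r mulrA.
  by rewrite mollifier_scale.
under eq_fun do rewrite E.
have cT w : T k w @[k --> \oo] --> x.
  rewrite -[X in _ --> X]add0r; apply: cvgD; last exact: cvg_cst.
  rewrite -(scale0r w); apply: cvgZ; last exact: cvg_cst.
  exact: cvg_harmonic.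
have -> : fine (sigma S) * phi x = \int[lam]_w (phi x * mollifier 0 1 w).
  rewrite RintegralZl//; last exact: integrable_mollifier.
  by rewrite mulrC /Rintegral integral_mollifier.
apply: (proj2 (@Rintegral_dominated_cvg _ _ _ lam setT F _
  (fun w => M * mollifier 0 1 w) _ _ _ _ _ _)) => //.
- move=> k; apply: measurable_funM; first exact: measurable_indic.
  apply: measurable_funM; first exact: measurable_mollifier.
  exact: (measurableT_comp mphi (mT k)).
- by apply: measurable_funM => //; exact: measurable_mollifier.
- apply: aeW => w _.
  have c1 : mollifier 0 1 w * phi (T k w) @[k --> \oo] --> mollifier 0 1 w * phi x.
    by apply: cvgM; [exact: cvg_cst|exact: (cvg_comp _ _ (cT w) (cphi x))].
  rewrite [X in _ --> X]mulrC; apply: cvg_trans c1; apply: near_eq_cvg.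
  near=> k; rewrite /F indicE mem_set ?mul1r//.
  rewrite /D /eball /=; apply: ltW; near: k.
  exact: (cT w _ (near_enorm_lt x1)).
- by apply: RintegrableZl => //; exact: integrable_mollifier.
- move=> k w _; rewrite /F indicE; case: (boolP (w \in D k)) => [|_].
    rewrite inE => Dw; rewrite mul1r normrM mulrC ler_pM//; first exact: phiM.
    by rewrite ger0_norm// mollifier_ge0.
  by rewrite mul0r normr0 mulr_ge0// mollifier_ge0.
Unshelve. all: by end_near. Qed.

End approximate_identity.

(** * Area of the sphere *)

Section gamma_integral.
Variable R : realType.
Local Notation mu := (@lebesgue_measure R).

(* - exp(-t) P_k(t) is an antiderivative of t^k exp(-t). *)
Fixpoint gamma_poly (k : nat) (t : R) : R :=
  if k is k'.+1 then t ^+ k + k%:R * gamma_poly k' t else 1.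

Lemma is_derive_expRN (t : R) : is_derive t 1 (fun t => expR (- t)) (- expR (- t)).
Proof.
have := is_derive1_comp (is_derive_expR (- t)) (is_deriveNid t 1).
by rewrite mulrN1.
Qed.

Lemma is_derive_gamma_poly k (t : R) :
  is_derive t 1 (gamma_poly k : R -> R) (gamma_poly k t - t ^+ k).
Proof.
elim: k => [|k IHk] /=.
  by rewrite expr0 subrr; exact: is_derive_cst.
have d1 := @is_deriveX _ _ (@id R) k.+1 t 1 1 (is_derive_id _ _).
have d2 := @is_deriveM _ _ (cst k.+1%:R) (gamma_poly k) t 1 _ _ (is_derive_cst _ _ _) IHk.
have := is_deriveD d1 d2.
rewrite exprfctE => /is_derive_eq; apply.
change (k.+1%:R * t ^+ k * 1 + (k.+1%:R * (gamma_poly k t - t ^+ k) + gamma_poly k t * 0)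
  = t ^+ k.+1 + k.+1%:R * gamma_poly k t - t ^+ k.+1).
by ring.
Qed.

Lemma cvg_expRN_gamma_poly k : expR (- t) * gamma_poly k t @[t --> +oo] --> (0 : R).
Proof.
(* The comparison with (j+1)! / t comes from exp t >= t^(j+1) / (j+1)!. *)
have cX j : expR (- t) * t ^+ j @[t --> +oo] --> (0 : R).
  apply: (@squeeze_cvgr _ _ _ _ (fun=> 0) (fun t => j.+1`!%:R * t^-1)).
  - near=> t; have t0 : 0 < t by [].
    rewrite mulr_ge0 ?expR_ge0 ?exprn_ge0 ?(ltW t0)//=.
    rewrite expRN ler_pdivrMl ?expR_gt0// mulrCA.
    rewrite mulrA ler_pdivlMr// -exprSr -ler_pdivrMl ?ltr0n ?fact_gt0// mulrC.
    have := expR_ge1Dxn j (ltW t0); apply: le_trans.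
    by rewrite lerDr.
  - exact: cvg_cst.
  - rewrite -[X in _ --> X](mulr0 j.+1`!%:R); apply: cvgM; first exact: cvg_cst.
    by apply/gtr0_cvgV0; [near=> t|exact: cvg_id].
elim: k => [|k IHk].
  by under eq_fun do rewrite mulr1; exact: cvgr_expR.
have -> : (fun t => expR (- t) * gamma_poly k.+1 t) =
    (fun t => expR (- t) * t ^+ k.+1 + k.+1%:R * (expR (- t) * gamma_poly k t)).
  by apply/funext => t /=; ring.
rewrite -[X in _ --> X]addr0; apply: cvgD => //.
by rewrite -[X in _ --> X](mulr0 k.+1%:R); apply: cvgM => //; exact: cvg_cst.
Unshelve. all: by end_near. Qed.

Lemma continuous_expRN : continuous (fun t : R => expR (- t)).
Proof.
move=> t; apply: (cvg_comp (fun t : R => - t) expR); last exact: continuous_expR.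
by apply: cvgN; exact: cvg_id.
Qed.

(** Used twice: with k = 0 and a = |y|^2 to write the Gaussian as an integral over levels, and with
    a = 0 to produce the factorial. *)
Lemma integral_expRN_gamma k (a : R) : 0 <= a ->
  (\int[mu]_(t in `[a, +oo[) (expR (- t) * t ^+ k)%:E =
   (expR (- a) * gamma_poly k a)%:E)%E.
Proof.
move=> a0; pose F t := - (expR (- t) * gamma_poly k t).
have dF (t : R) : is_derive t (1 : R) F (expR (- t) * t ^+ k).
  have := is_deriveN (is_deriveM (is_derive_expRN t) (is_derive_gamma_poly k t)).
  by move=> /is_derive_eq; apply; rewrite ![_ *: _]mulrC; ring.
have Fc : continuous F.
  by move=> t; apply: differentiable_continuous; apply/derivable1_diffP; case: (dF t).
rewrite (@ge0_continuous_FTC2y _ (fun t => expR (- t) * t ^+ k) F a 0).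
- by rewrite -EFinB /F sub0r opprK.
- by move=> t at_; rewrite mulr_ge0 ?expR_ge0// exprn_ge0// (le_trans a0).
- apply: continuous_subspaceT => t; apply: cvgM; first exact: continuous_expRN.
  exact: exprn_continuous.
- by rewrite -oppr0; apply: cvgN; exact: cvg_expRN_gamma_poly.
- by move=> t _; case: (dF t).
- by apply: cvg_at_right_filter; exact: Fc.
- by move=> t _; rewrite derive1E; case: (dF t).
Qed.

Lemma gamma_poly0 k : gamma_poly k 0 = k`!%:R.
Proof.
by elim: k => //= k ->; rewrite expr0n add0r factS natrM.
Qed.

End gamma_integral.

Section gaussian.
Variable R : realType.

Lemma integral_gaussian n :
  (\int[lebesgue_rV R n]_y (expR (- ssq y))%:E = (Num.sqrt pi ^+ n)%:E)%E.
Proof.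
have mg k : measurable_fun setT (fun y : 'rV[R]_k => (expR (- ssq y))%:E).
  apply/measurable_EFinP; apply: (measurableT_comp (@measurable_expR R)).
  by apply: measurableT_comp => //; exact: measurable_ssq.
elim: n => [|n IHn].
  transitivity ((\d_(0%R : 'rV[R]_0) [set: 'rV[R]_0] : \bar R) * (expR (- ssq (0 : 'rV[R]_0)))%:E)%E.
    exact: (integral_dirac _ measurableT (mg 0)).
  by rewrite diracT mul1e /ssq big_ord0 oppr0 expR0 expr0.
rewrite (@ge0_integral_pushforward_scale _ _ _ _ _
  (lebesgue_measure \x lebesgue_rV R n)%E _ (@rV_cons R n) 1)//; last 3 first.
- exact: measurable_rV_cons.
- by move=> A mA _; rewrite mul1e.
- exact: mg.
rewrite mul1e preimage_setT fubini_tonelli1//; last first.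
- by apply: (measurableT_comp (mg n.+1)); exact: measurable_rV_cons.
have E t u : (expR (- ssq (rV_cons (t, u))))%:E = ((expR (- t ^+ 2))%:E * (expR (- ssq u))%:E)%E.
  rewrite -EFinM -expRD; congr (expR _)%:E.
  rewrite /ssq big_ord_recl opprD; congr (- _ ^+ 2 - _).
    by rewrite mxE unlift_none.
  by apply: eq_bigr => i _; rewrite mxE liftK.
rewrite /fubini_F.
under eq_integral => t _.
  under eq_integral do rewrite E.
  rewrite ge0_integralZl//; last exact: mg.
  rewrite IHn; over.
rewrite ge0_integralZr//; last first.
- by apply/measurable_EFinP; exact: (@measurable_gauss_fun R).
by have := @integralT_gauss R; rewrite /gauss_fun => ->; rewrite -EFinM -exprS.
Qed.

End gaussian.

Section volume.
Variables (R : realType) (m : nat).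
Local Notation N := m.*2.+2.
Local Notation lam := (lebesgue_rV R N).
Local Notation mu := (@lebesgue_measure R).
Local Notation V := 'rV[R]_N.

(** This set is the origin, which halving leaves invariant; its measure is finite and equals 2^N
    times itself. *)
Lemma lebesgue_eball0 : lam (eball 0) = 0%E.
Proof.
have h0 : 0 < 2^-1 :> R by rewrite invr_gt0.
have mB := @measurable_eball R N.
have lefin : lam (eball 0) \is a fin_num.
  rewrite ge0_fin_numE//; apply: le_lt_trans (lebesgue_unit_ball_lty R N).
  by apply: le_measure; rewrite ?inE// => y /le_trans; apply.
have := lebesgue_rV_affine 0 h0 (mB 0).
rewrite (_ : _ @^-1` eball 0 = eball 0); last first.
  apply/seteqP; split => y; rewrite /eball /= addr0 enormZ gtr0_norm//;
  by rewrite pmulr_rle0.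
move=> E; have := congr1 fine E; rewrite fineM// /= exprVn invrK => /eqP.
rewrite -subr_eq0 -[X in X - _]mul1r -mulrBl mulf_eq0 => /orP[|/eqP E0].
  by rewrite subr_eq0 eq_sym gt_eqF// exprn_egt1// ltr1n.
by rewrite -(fineK lefin) E0.
Qed.

Lemma lebesgue_ssq_le (t : R) : 0 <= t ->
  lam [set y | ssq y <= t] = (t ^+ m.+1 * fine (lam (eball 1)))%:E.
Proof.
move=> t0; have V1 : lam (eball 1) \is a fin_num.
  by rewrite ge0_fin_numE//; exact: lebesgue_unit_ball_lty.
have -> : [set y : V | ssq y <= t] = eball (Num.sqrt t).
  apply/seteqP; split => y; rewrite /eball /= enorm_le_ssq ?sqrtr_ge0//;
  by rewrite sqr_sqrtr.
have [->|tn0] := eqVneq t 0; first by rewrite sqrtr0 lebesgue_eball0 expr0n mul0r.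
rewrite [LHS]lebesgue_eball; last by rewrite sqrtr_gt0 lt_neqAle eq_sym tn0.
rewrite [RHS]EFinM (fineK V1); congr (_%:E * _)%E.
by rewrite (_ : N = (2 * m.+1)%N) ?mul2n// -mul2n exprM sqr_sqrtr.
Qed.

(* Integrating the Gaussian over its superlevel sets, which are balls. *)
Lemma gaussian_layer_cake :
  (\int[lam]_y (expR (- ssq y))%:E = (m.+1`!%:R * fine (lam (eball 1)))%:E)%E.
Proof.
(* Integrating exp(-t) over the pairs (y, t) with |y|^2 <= t gives the Gaussian integral in one
   order, and in the other the ball volumes, proportional to t^(m+1). *)
pose A := [set p : V * measurableTypeR R | ssq p.1 <= p.2].
have mA : measurable A.
  rewrite (_ : A = setT `&` (fun p : V * measurableTypeR R => p.2 - ssq p.1) @^-1` `[0, +oo[%classic).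
    have mf : measurable_fun setT (fun p : V * measurableTypeR R => p.2 - ssq p.1).
      by apply: measurable_funB => //; exact: (measurableT_comp (@measurable_ssq R N)).
    by apply: mf => //; exact: measurable_itv.
  by apply/seteqP; split => p; rewrite /A /= in_itv /= andbT subr_ge0 => // -[].
pose G (p : V * measurableTypeR R) := (\1_A p * expR (- p.2))%:E.
have mG : measurable_fun setT G.
  apply/measurable_EFinP; apply: measurable_funM; first exact: measurable_indic.
  apply: (measurableT_comp (@measurable_expR R)).
  by apply: measurableT_comp.
have G0 p : (0 <= G p)%E by rewrite lee_fin mulr_ge0// expR_ge0.
have := @fubini_tonelli _ _ _ _ R lam mu G mG G0.
have -> : (\int[lam]_y \int[mu]_t G (y, t) = \int[lam]_y (expR (- ssq y))%:E)%E.
  apply: eq_integral => y _.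
  have := integral_expRN_gamma 0 (ssq_ge0 y); rewrite mulr1 => <-.
  rewrite [RHS]integral_mkcond; apply: eq_integral => t _.
  rewrite /G patchE indicE expr0 mulr1.
  have -> : ((y, t) \in A) = (t \in `[ssq y, +oo[%classic).
    by apply/idP/idP; rewrite !inE /A /= in_itv /= andbT.
  by case: ifPn; rewrite ?mul1r ?mul0r.
move=> ->.
transitivity (\int[mu]_(t in `[0%R, +oo[) ((expR (- t) * t ^+ m.+1)%:E * (fine (lam (eball 1)))%:E))%E.
  rewrite [RHS]integral_mkcond; apply: eq_integral => t _.
  pose At := [set y : V | ssq y <= t].
  have mAt : measurable At.
    rewrite (_ : At = setT `&` (@ssq R N) @^-1` `]-oo, t]%classic).
      by apply: measurable_ssq => //; exact: measurable_itv.
    by apply/seteqP; split => y; rewrite /At /= in_itv /= => // -[].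
  have -> : (\int[lam]_y G (y, t) = (expR (- t))%:E * lam At)%E.
    rewrite -[At]setIT -(integral_indic _ measurableT mAt) -ge0_integralZl//.
    - apply: eq_integral => y _; rewrite /G /= EFinM muleC !indicE.
      by congr (_ * (_)%:R%:E)%E; apply/idP/idP; rewrite !inE.
    - by apply/measurable_EFinP; exact: measurable_indic.
  rewrite /At patchE; case: (leP 0 t) => t0.
    rewrite ifT; last by rewrite in_setE /= in_itv /= andbT.
    by rewrite lebesgue_ssq_le// !EFinM muleA.
  rewrite ifF; last by apply/negP; rewrite in_setE /= in_itv /= andbT leNgt t0.
  rewrite (_ : mkset _ = set0) ?measure0 ?mule0//.
  apply/seteqP; split => // y /= yt.
  by have := le_lt_trans (le_trans (ssq_ge0 y) yt) t0; rewrite ltxx.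
rewrite ge0_integralZr//.
- by rewrite integral_expRN_gamma// gamma_poly0 oppr0 expR0 mul1r -EFinM.
- apply/measurable_EFinP; apply: measurable_funM.
    by apply: measurable_funTS; apply: (measurableT_comp (@measurable_expR R)).
  by apply: measurable_funTS; exact: measurable_funX.
- by move=> t; rewrite /= in_itv /= andbT => t0; rewrite lee_fin mulr_ge0 ?expR_ge0 ?exprn_ge0.
- by rewrite lee_fin fine_ge0.
Qed.

(** By definition the area is N times the volume of the punctured unit ball. Comparing the two
    evaluations of the Gaussian integral gives the volume pi^(m+1) / (m+1)!. *)
Lemma sphere_area : fine (sphere_measure R N (unit_sphere R N)) =
  2 * pi ^+ m.+1 / m`!%:R.
Proof.
have V1 : lam (eball 1) \is a fin_num.
  by rewrite ge0_fin_numE//; exact: lebesgue_unit_ball_lty.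
have vol : m.+1`!%:R * fine (lam (eball 1)) = pi ^+ m.+1 :> R.
  have := gaussian_layer_cake; rewrite integral_gaussian => -[<-].
  by rewrite (_ : N = (2 * m.+1)%N) ?mul2n// -mul2n exprM sqr_sqrtr ?pi_ge0.
have E1 : @punctured_ball R N `&` @radial_proj R N @^-1` unit_sphere R N =
    eball 1 `\` eball 0.
  apply/seteqP; split => y; rewrite /punctured_ball /eball /=.
    by move=> [/andP[y0 y1] _]; split => //; apply/negP; rewrite -ltNge.
  move=> [y1 /negP]; rewrite -ltNge => y0; split; first by rewrite y0.
  by apply: radial_proj_sphere; rewrite /punctured_ball /= y0.
have E2 : lam (eball 1 `\` eball 0) = lam (eball 1).
  rewrite measureD; [|exact: measurable_eball|exact: measurable_eball|].
    rewrite setIidr; last by move=> y /le_trans; apply.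
    by rewrite [X in (_ - X)%E]lebesgue_eball0 sube0.
  exact: lebesgue_unit_ball_lty.
change (fine (N%:R%:E * lam (@punctured_ball R N `&` @radial_proj R N @^-1` unit_sphere R N))%E
  = 2 * pi ^+ m.+1 / m`!%:R).
rewrite E1 E2.
have -> : fine (N%:R%:E * lam (eball 1))%E = N%:R * fine (lam (eball 1)).
  by rewrite -[in LHS](fineK V1).
rewrite -vol factS natrM -doubleS -muln2 natrM.
by field; rewrite pnatr_eq0 -lt0n fact_gt0.
Qed.

End volume.

(** * Partial derivatives *)

Section smooth_calculus.
Variables (R : realType) (n : nat).
Local Notation V := 'rV[R]_n.
Local Notation "'e_ l" := (delta_mx 0 l : V) (at level 8, l at level 2).
Implicit Types (g dg : V -> R) (y v z : V).

Lemma is_derive_small_steps g y v (d : R) :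
  (forall e, 0 < e -> exists2 r, 0 < r & forall h, h != 0 -> `|h| < r ->
     `|h^-1 * (g (y + h *: v) - g y) - d| <= e) <-> is_derive y v g d.
Proof.
have E h : h^-1 *: ((g \o shift y) (h *: v) - g y) = h^-1 * (g (y + h *: v) - g y).
  by rewrite /= [h *: v + y]addrC.
split => [H|[gd <-] e e0].
  have cd : h^-1 *: ((g \o shift y) (h *: v) - g y) @[h --> 0^'] --> d.
    apply/cvgrPdist_le => e /H[r r0 Hr]; rewrite -nbhs_nearE.
    apply/nbhs_ballP; exists r => //= h; rewrite /ball /= sub0r normrN => hr h0.
    by rewrite distrC E Hr.
  by apply: DeriveDef; [exact: (cvgP d)|exact: cvg_lim].
have /cvgrPdist_le/(_ _ e0) : h^-1 *: ((g \o shift y) (h *: v) - g y) @[h --> 0^'] --> 'D_v g y.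
  exact: gd.
rewrite -nbhs_nearE => /nbhs_ballP[r /= r0 Hr]; exists r => // h h0 hr.
by rewrite -E distrC; apply: Hr => //; rewrite /ball /= sub0r normrN.
Qed.

Lemma partial_mean_value g dg l : (forall y, is_derive y 'e_l g (dg y)) ->
  forall y s, exists2 t, `|t| <= `|s| &
    g (y + s *: 'e_l) - g y = s * dg (y + t *: 'e_l).
Proof.
move=> gd y s; pose G t := g (y + t *: 'e_l).
have dG (t : R) : is_derive t (1 : R) G (dg (y + t *: 'e_l)) by exact: is_derive_line.
have cG (a b : R) : {within `[a, b], continuous G}.
  by apply: derivable_within_continuous => t _; case: (dG t).
have -> : g y = G 0 by rewrite /G scale0r addr0.
rewrite -/(G s); have [s0|/ltW s0] := leP 0 s.
  have [c] := MVT_segment s0 (fun t _ => dG t) (cG 0 s).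
  rewrite in_itv /= => /andP[c0 cs] ->; exists c; last by rewrite subr0 mulrC.
  by rewrite !ger0_norm.
have [c] := MVT_segment s0 (fun t _ => dG t) (cG s 0).
rewrite in_itv /= => /andP[cs c0] E; exists c; first by rewrite !ler0_norm// lerN2.
by rewrite -opprB E sub0r mulrN opprK mulrC.
Qed.

Lemma continuous_small_shift g y (e : R) : continuous g -> 0 < e ->
  exists2 r, 0 < r & forall u v a b, `|a| < r -> `|b| < r ->
    `|u| <= 1 -> `|v| <= 1 -> `|g (y + a *: u + b *: v) - g y| <= e.
Proof.
move=> gc e0; have /cvgrPdist_le/(_ _ e0) := gc y.
rewrite -nbhs_nearE => /nbhs_ballP[r /= r0 Hr].
exists (r / 2) => [|u v a b ar br u1 v1]; first by rewrite divr_gt0.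
rewrite distrC; apply: Hr; rewrite -ball_normE /= -addrA opprD addNKr normrN.
apply: le_lt_trans (ler_normD _ _) _; rewrite [r]splitr !normrZ.
have le1 (c w : R) : 0 <= c -> w <= 1 -> c * w <= c by move=> c0 w1; exact: ler_piMr.
by rewrite (le_lt_trans (lerD (le1 _ _ _ u1) (le1 _ _ _ v1)))// ltrD.
Qed.
End smooth_calculus.

Section partial_derivatives.
Variables (R : realType) (n : nat).
Local Notation V := 'rV[R]_n.
Local Notation "'e_ l" := (delta_mx 0 l : V) (at level 8, l at level 2).
Implicit Types (g : V -> R) (y v z : V).

Lemma normr_delta_le1 (l : 'I_n) : `|'e_l| <= 1.
Proof.
rewrite /Num.norm /= mx_normrE; apply: bigmax_le => // -[i j] _ /=.
by rewrite mxE; case: (_ && _); rewrite ?normr1 ?normr0.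
Qed.

(* Moving along u first leaves a one-coordinate increment, controlled by the mean
   value theorem and the continuity of dg. *)
Lemma is_derive_add_coord g dg l y u (c a : R) :
  continuous dg -> (forall y, is_derive y 'e_l g (dg y)) ->
  is_derive y u g a -> is_derive y (u + c *: 'e_l) g (a + c * dg y).
Proof.
move=> dgc gd ga; apply/is_derive_small_steps => e e0.
have e20 : 0 < e / 2 by rewrite divr_gt0.
(* K bounds both |u| and |c|: then h u = (h K) (u / K) with |u / K| <= 1, the form
   [continuous_small_shift] asks for, and |t| <= |h c| <= |h| K. *)
pose K := 1 + `|u| + `|c|.
have K0 : 0 < K by rewrite /K -addrA ltr_wpDr// addr_ge0.
have c1 : 0 < 1 + `|c| by rewrite ltr_wpDr.
have [r1 r10 H1] := (is_derive_small_steps g y u a).2 ga _ e20.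
have [r2 r20 H2] := continuous_small_shift y dgc (divr_gt0 e20 c1).
exists (Num.min r1 (r2 / K)) => [|h h0]; first by rewrite lt_min r10 divr_gt0.
rewrite lt_min => /andP[hr1 hr2].
have [t th Et] := partial_mean_value gd (y + h *: u) (h * c).
have -> : h^-1 * (g (y + h *: (u + c *: 'e_l)) - g y) - (a + c * dg y) =
    (h^-1 * (g (y + h *: u) - g y) - a) +
    c * (dg (y + h *: u + t *: 'e_l) - dg y).
  rewrite scalerDr scalerA addrA.
  have -> : g (y + h *: u + (h * c) *: 'e_l) =
    g (y + h *: u) + h * c * dg (y + h *: u + t *: 'e_l) by rewrite -Et [RHS]addrC subrK.
  by field.
apply: le_trans (ler_normD _ _) _; rewrite [e]splitr; apply: lerD; first exact: H1.
rewrite normrM.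
have hK : `|h| * K < r2 by rewrite -ltr_pdivlMr.
have := H2 (K^-1 *: u) 'e_l (h * K) t; rewrite scalerA -mulrA divff ?gt_eqF// mulr1.
have -> : `|h * K| < r2 by rewrite normrM (gtr0_norm K0).
have -> : `|t| < r2.
  apply: le_lt_trans th (le_lt_trans _ hK); rewrite normrM ler_wpM2l// /K.
  by rewrite lerDr addr_ge0.
have -> : `|K^-1 *: u| <= 1.
  rewrite normrZ normfV gtr0_norm// mulrC ler_pdivrMr// mul1r /K addrAC.
  by rewrite lerDr addr_ge0.
move=> /(_ isT isT isT (normr_delta_le1 l)) H; apply: le_trans (ler_wpM2l _ H) _ => //.
rewrite mulrA ler_pdivrMr// mulrC ler_wpM2l//; first exact: ltW.
by rewrite lerDr.
Qed.

(** [classC] provides only coordinate derivatives, whereas the normal derivative is taken along y.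
    The direction is built up one coordinate at a time. *)
Lemma is_derive_direction g (dg : 'I_n -> V -> R) y v :
  (forall l, continuous (dg l)) -> (forall l y, is_derive y 'e_l g (dg l y)) ->
  is_derive y v g (\sum_l v 0 l * dg l y).
Proof.
move=> dgc gd; rewrite [v]row_sum_delta.
under [X in is_derive _ _ _ X]eq_bigr => l _ do
  rewrite -row_sum_delta.
elim: (index_enum _) => [|l s IH].
  rewrite !big_nil; apply/is_derive_small_steps => e e0; exists 1 => // h _ _.
  by rewrite scaler0 addr0 !subrr mulr0 subr0 normr0 ltW.
by rewrite !big_cons addrC [X in is_derive _ _ _ X]addrC; exact: is_derive_add_coord.
Qed.

(** The mean value theorem along e_i, applied to the increment along e_j, and then along e_j. The
    second difference is symmetric in i and j, so the same quotient approximates both mixed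
    derivatives. *)
Lemma mixed_difference_quotient g (gi gij : V -> R) i j :
  continuous gij -> (forall y, is_derive y 'e_i g (gi y)) ->
  (forall y, is_derive y 'e_j gi (gij y)) -> forall y e, 0 < e ->
  exists2 r, 0 < r & forall h, 0 < h -> h < r ->
    `|(h ^+ 2)^-1 * (g (y + h *: 'e_i + h *: 'e_j) - g (y + h *: 'e_i)
       - g (y + h *: 'e_j) + g y) - gij y| <= e.
Proof.
move=> gijc gd gid y e e0.
have [r r0 Hr] := continuous_small_shift y gijc e0.
exists r => // h h0 hr.
pose G z := g (z + h *: 'e_j) - g z.
have dG z : is_derive z 'e_i G (gi (z + h *: 'e_j) - gi z).
  apply: isdB => //; have [d1 d2] := gd (z + h *: 'e_j).
  have E : (fun t : R => t^-1 *: (((fun z => g (z + h *: 'e_j)) \o shift z) (t *: 'e_i) -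
      g (z + h *: 'e_j))) = (fun t => t^-1 *: ((g \o shift (z + h *: 'e_j)) (t *: 'e_i)
      - g (z + h *: 'e_j))).
    by apply/funext => t /=; rewrite addrA.
  by rewrite -d2; apply: DeriveDef; rewrite /derivable /derive E.
have [t th Et] := partial_mean_value dG y h.
have [s sh Es] := partial_mean_value gid (y + t *: 'e_i) h.
have -> : g (y + h *: 'e_i + h *: 'e_j) - g (y + h *: 'e_i) - g (y + h *: 'e_j) + g y
    = h ^+ 2 * gij (y + t *: 'e_i + s *: 'e_j).
  by rewrite expr2 -mulrA -Es -Et /G opprB -addrA [- _ + _]addrC.
rewrite mulKf ?expf_neq0 ?gt_eqF//.
have hh : `|h| < r by rewrite gtr0_norm.
by apply: Hr; rewrite ?normr_delta_le1//; exact: le_lt_trans hh.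
Qed.

Lemma mixed_partials_eq g (gi gj gij gji : V -> R) i j :
  continuous gij -> continuous gji ->
  (forall y, is_derive y 'e_i g (gi y)) -> (forall y, is_derive y 'e_j g (gj y)) ->
  (forall y, is_derive y 'e_j gi (gij y)) -> (forall y, is_derive y 'e_i gj (gji y)) ->
  gij = gji.
Proof.
move=> gijc gjic gid gjd gijd gjid; apply/funext => y.
apply/eqP; rewrite -subr_eq0 -normr_le0; apply/ler_addgt0Pr => e e0; rewrite add0r.
have e20 : 0 < e / 2 by rewrite divr_gt0.
have [r r0 Hr] := mixed_difference_quotient gijc gid gijd y e20.
have [s s0 Hs] := mixed_difference_quotient gjic gjd gjid y e20.
pose h := Num.min r s / 2.
have rs0 : 0 < Num.min r s by rewrite lt_min r0.
have h0 : 0 < h by rewrite divr_gt0.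
have : h < Num.min r s by rewrite /h ltr_pdivrMr// mulrC ltr_pMl// ltr1n.
rewrite lt_min => /andP[hr hs].
have := Hr h h0 hr; have := Hs h h0 hs.
rewrite [y + h *: 'e_j + _]addrAC.
rewrite [g (y + h *: _ + _) - g (y + h *: 'e_j) - _]addrAC.
set Q := (h ^+ 2)^-1 * _ => Q1 Q2.
by rewrite -(subrKA Q) (le_trans (ler_normD _ _))// [e]splitr lerD// distrC.
Qed.

End partial_derivatives.

Section differentiability_classes.
Variables (R : realType) (n : nat).
Local Notation V := 'rV[R]_n.+1.
Local Notation "'e_ l" := (delta_mx 0 l : V) (at level 8, l at level 2).
Implicit Types (f w : V -> cliff R n) (y v : V) (k : nat).

Lemma classC_continuous k f A : classC k f -> continuous (fun y => f y A : R).
Proof. by case: k => [|k] [fc _]; exact: fc. Qed.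

Lemma classC_cpartial k f i : classC k.+1 f -> classC k (cpartial i f).
Proof. by case=> _ [_ H]; exact: H. Qed.

Lemma classC_le k k' f : (k <= k')%N -> classC k' f -> classC k f.
Proof.
elim: k k' f => [|k IH] [|k'] f //; first by move=> _ [].
by move=> kk [fc [fd fp]]; split=> //; split=> // i; exact: IH (fp i).
Qed.

Lemma is_derive_cpartial k f A i y : classC k.+1 f ->
  is_derive y 'e_i (fun y => f y A : R) (cpartial i f y A).
Proof. by case=> _ [fd _]; apply: DeriveDef; [exact: fd|rewrite ffunE]. Qed.

Lemma cpartial_eq f w i : 
  (forall A y, is_derive y 'e_i (fun y => f y A : R) (w y A)) -> cpartial i f = w.
Proof. by move=> fd; apply/funext => y; apply/ffunP => A; rewrite ffunE; case: (fd A y). Qed.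

(** Left multiplication by a constant acts on coordinates through a constant real matrix; this
    reduces the calculus of Clifford-valued functions to real ones. *)
Lemma cliffM_coord (c x : cliff R n) A :
  (c * x) A = \sum_B (c * blade R B) A * x B.
Proof.
rewrite {1}(cliffE x) mulr_sumr sum_ffunE; apply: eq_bigr => B _.
by rewrite -scalerAr ffunE mulrC.
Qed.

Section combination.
Variables (J : Type) (s : seq J) (c : J -> cliff R n) (F : J -> V -> cliff R n).

Lemma is_derive_big (I : Type) (r : seq I) (h : I -> V -> R) (dh : I -> R) y v :
  (forall i, is_derive y v (h i) (dh i)) ->
  is_derive y v (fun z => \sum_(i <- r) h i z) (\sum_(i <- r) dh i).
Proof.
move=> hd; elim: r => [|i r IH].
  by rewrite big_nil; under eq_fun do rewrite big_nil; exact: isd_cst.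
by rewrite big_cons; under eq_fun do rewrite big_cons; exact: isdD.
Qed.

Lemma combinationE A y :
  (\sum_(j <- s) c j * F j y) A = \sum_(j <- s) \sum_B (c j * blade R B) A * F j y B.
Proof. by rewrite sum_ffunE; apply: eq_bigr => j _; exact: cliffM_coord. Qed.

Lemma continuous_combination A :
  (forall j B, continuous (fun y => F j y B : R)) ->
  continuous (fun y => (\sum_(j <- s) c j * F j y) A : R).
Proof.
move=> Fc; under eq_fun do rewrite combinationE.
apply: cts_sum => j _; apply: cts_sum => B _; apply: ctsM => //.
by move=> y; exact: cst_continuous.
Qed.

Lemma is_derive_combination A y v (dF : J -> V -> cliff R n) :
  (forall j B, is_derive y v (fun y => F j y B : R) (dF j y B)) ->
  is_derive y v (fun y => (\sum_(j <- s) c j * F j y) A : R)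
    ((\sum_(j <- s) c j * dF j y) A).
Proof.
move=> Fd; under eq_fun do rewrite combinationE.
rewrite sum_ffunE; under eq_bigr do rewrite cliffM_coord.
apply: is_derive_big => j; apply: is_derive_big => B.
Qed.
End combination.

Lemma cpartial_combination (J : Type) (s : seq J) (c : J -> cliff R n) F k i :
  (forall j, classC k.+1 (F j)) ->
  cpartial i (fun y => \sum_(j <- s) c j * F j y) =
  fun y => \sum_(j <- s) c j * cpartial i (F j) y.
Proof.
move=> Fk; apply: cpartial_eq => A y; apply: (@is_derive_combination _ s c F A y _ (fun j => cpartial i (F j))) => j B.
exact: is_derive_cpartial (Fk j).
Qed.

Lemma classC_combination (J : Type) (s : seq J) (c : J -> cliff R n) F k :
  (forall j, classC k (F j)) -> classC k (fun y => \sum_(j <- s) c j * F j y).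
Proof.
elim: k F => [|k IH] F Fk; split=> //.
- by move=> A; apply: continuous_combination => j B; exact: classC_continuous (Fk j).
- by move=> A; apply: continuous_combination => j B; exact: classC_continuous (Fk j).
split=> [A i x|i].
  have D j B := is_derive_cpartial B i x (Fk j).
  by case: (@is_derive_combination _ s c F A x _ (fun j => cpartial i (F j)) D).
by rewrite (cpartial_combination _ _ _ Fk); apply: IH => j; exact: classC_cpartial.
Qed.

Lemma classC_dirac k f : classC k.+1 f -> classC k (dirac_op f).
Proof. by move=> fk; apply: classC_combination => i; exact: classC_cpartial. Qed.

Lemma laplacianE f :
  laplacian f = fun y => \sum_i 1 * cpartial i (cpartial i f) y.
Proof. by apply/funext => y; apply: eq_bigr => i _; rewrite mul1r. Qed.

Lemma classC_laplacian k f : classC k.+2 f -> classC k (laplacian f).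
Proof.
move=> fk; rewrite laplacianE; apply: classC_combination => i.
by do 2!apply: classC_cpartial.
Qed.

Lemma classC_laplacian_iter j k f : classC (k + j.*2) f ->
  classC k (laplacian_iter j f).
Proof.
elim: j k => [|j IH] k; first by rewrite addn0.
by rewrite doubleS !addnS => fk; apply: classC_laplacian; apply: IH; rewrite !addSn.
Qed.

Lemma cpartialC f i j : classC 2 f ->
  cpartial i (cpartial j f) = cpartial j (cpartial i f).
Proof.
move=> f2; apply/funext => y; apply/ffunP => A.
have H a b : forall y, is_derive y 'e_b (fun y => cpartial a f y A : R)
    (cpartial b (cpartial a f) y A).
  by move=> z; exact: is_derive_cpartial (classC_cpartial a f2).
have C a b : continuous (fun y => cpartial b (cpartial a f) y A : R).
  by apply: (@classC_continuous 0); do 2!apply: classC_cpartial.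
have D a : forall y, is_derive y 'e_a (fun y => f y A : R) (cpartial a f y A).
  by move=> z; exact: is_derive_cpartial f2.
exact: (congr1 (fun g => g y) (mixed_partials_eq (C j i) (C i j) (D j) (D i) (H j i) (H i j))).
Qed.

Lemma dirac_laplacian f : classC 3 f ->
  dirac_op (laplacian f) = laplacian (dirac_op f).
Proof.
move=> f3; have f2 := classC_le (leqnSn 2) f3.
have p2 i : classC 2 (cpartial i f) := classC_cpartial i f3.
have pp1 i j : classC 1 (cpartial j (cpartial i f)) := classC_cpartial j (p2 i).
have Dl l : cpartial l (cpartial l (dirac_op f)) =
    fun y => \sum_i cliff_basis R i * cpartial l (cpartial l (cpartial i f)) y.
  by rewrite (cpartial_combination _ _ _ p2) (cpartial_combination _ _ _ (fun i => pp1 i l)).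
apply/funext => y.
change (\sum_i cliff_basis R i * cpartial i (laplacian f) y =
  \sum_l cpartial l (cpartial l (dirac_op f)) y).
under [RHS]eq_bigr => l _ do rewrite Dl.
rewrite [RHS]exchange_big /=; apply: eq_bigr => i _.
rewrite -mulr_sumr; congr (_ * _).
rewrite laplacianE (cpartial_combination _ _ _ (fun j => pp1 j j)).
apply: eq_bigr => l _; rewrite mul1r.
by rewrite (cpartialC i l (p2 l)) (cpartialC i l f2).
Qed.

Lemma normal_derive_combination f y : classC 1 f ->
  normal_derive f y = \sum_l y 0 l *: cpartial l f y.
Proof.
move=> f1; apply/ffunP => A; rewrite ffunE sum_ffunE.
have /(_ y y)[] := @is_derive_direction _ _ (fun y => f y A : R)
   (fun l y => cpartial l f y A : R).
  by move=> l; apply: (@classC_continuous 0); exact: classC_cpartial.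
  by move=> l z; exact: is_derive_cpartial f1.
by move=> _ E; rewrite [LHS]E; apply: eq_bigr => l _; rewrite [RHS]ffunE.
Qed.

End differentiability_classes.

(** * Clifford algebra and oriented frames *)

Section conjugate_basis.
Variables (R : realType) (n : nat).
Implicit Types (i l : 'I_n.+1).
Local Notation e_ := (@cliff_basis R n).

Definition conj_basis i : cliff R n :=
  oapp (fun j => - cliff_gen R j) 1 (unlift ord0 i).

Lemma paravector_conjE (x : 'rV[R]_n.+1) :
  paravector_conj x = \sum_i x 0 i *: conj_basis i.
Proof.
rewrite /paravector_conj big_ord_recl /conj_basis unlift_none -sumrN; congr (_ + _).
by apply: eq_bigr => i _; rewrite liftK /= scalerN.
Qed.

(** Polarization of the identity x^* x = |x|^2 on basis vectors. *)
Lemma conj_basis_polarization i l :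
  conj_basis i * e_ l + conj_basis l * e_ i = ((i == l)%:R *+ 2) *: 1.
Proof.
rewrite /conj_basis /cliff_basis.
case: unliftP => [i'|] ->; case: unliftP => [l'|] -> /=.
- rewrite (inj_eq (@lift_inj _ _)) !mulNr.
  have [->|il] := eqVneq i' l'.
    by rewrite !cliff_gen_sqr !opprK scaler_nat.
  by rewrite (cliff_gen_anticomm _ il) opprK subrr mul0rn scale0r.
- by rewrite mulr1 mul1r addNr mul0rn scale0r.
- by rewrite mulr1 mul1r subrr mul0rn scale0r.
- by rewrite !mulr1 scaler_nat.
Qed.

(* Only the diagonal survives: the off-diagonal products are antisymmetric. *)
Lemma sum_conj_basisM (a : 'I_n.+1 -> 'I_n.+1 -> R) :
  (forall i l, a i l = a l i) ->
  \sum_i \sum_l a i l *: (conj_basis i * e_ l) = (\sum_l a l l) *: 1.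
Proof.
move=> aC; set T := LHS.
have : T + T = (\sum_l a l l *+ 2) *: 1.
  rewrite {2}/T exchange_big /= -big_split /= scaler_suml; apply: eq_bigr => i _.
  rewrite -big_split /= (bigD1 i)//= big1 ?addr0 => [|l li].
    by rewrite -scalerDr conj_basis_polarization eqxx scalerA mulr_natr.
  rewrite (aC l i) -scalerDr conj_basis_polarization eq_sym (negbTE li) mul0rn.
  by rewrite scale0r scaler0.
move=> TT; have -> : T = 2^-1 *: (T + T).
  rewrite scalerDr -scalerDl (_ : 2^-1 + 2^-1 = 1) ?scale1r//.
  by field.
by rewrite TT scalerA sumrMnl -[X in _ * X]mulr_natl mulKf ?pnatr_eq0.
Qed.
End conjugate_basis.

Section oriented_frames.
Variables (R : realType) (n : nat).
Implicit Types (y : 'rV[R]_n.+1) (V : 'M[R]_(n, n.+1)).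

Lemma enorm1_mul_tr y : enorm y = 1 -> y *m y^T = 1%:M.
Proof.
move=> y1; apply/matrixP => i j; rewrite !ord1 !mxE eqxx.
under eq_bigr do rewrite mxE -expr2.
by have := enorm_sqr y; rewrite y1 expr1n /ssq => ->.
Qed.

Lemma oriented_frame_mul_tr y V : enorm y = 1 -> oriented_frame y V ->
  (col_mx y V : 'M[R]_(1 + n)) *m (col_mx y V)^T = 1%:M.
Proof.
move=> y1 [VV Vy _]; rewrite tr_col_mx mul_col_row (enorm1_mul_tr y1) VV Vy.
by rewrite -[y *m _]trmxK trmx_mul trmxK Vy trmx0 -scalar_mx_block.
Qed.

Lemma det_oriented_frame y V : enorm y = 1 -> oriented_frame y V ->
  \det (col_mx y V : 'M[R]_(1 + n)) = 1.
Proof.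
move=> y1 fV; have := oriented_frame_mul_tr y1 fV.
move/(congr1 determinant); rewrite det_mulmx det_tr det1 -expr2 => /eqP.
rewrite sqrf_eq1 => /orP[/eqP//|/eqP E].
by case: fV => _ _; rewrite [\det _]E oppr_gt0 ltr10.
Qed.

(* For an orthogonal matrix of determinant 1 the first row equals its cofactors. *)
Lemma gamma_form_oriented_frame y V : enorm y = 1 -> oriented_frame y V ->
  gamma_form V = \sum_i y 0 i *: cliff_basis R i.
Proof.
move=> y1 fV; have Q := oriented_frame_mul_tr y1 fV.
have d1 := det_oriented_frame y1 fV.
have adj : \adj (col_mx y V : 'M[R]_(1 + n)) = (col_mx y V)^T.
  rewrite -[LHS]mulmx1 -Q mulmxA mul_adj_mx d1; exact: mul1mx.
apply: eq_bigr => i _; congr (_ *: _).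
transitivity (\adj (col_mx y V : 'M[R]_(1 + n)) i 0); last first.
  rewrite adj [LHS]mxE -[RHS](col_mxEu y V).
  by congr (col_mx y V _ _); exact: val_inj.
rewrite mxE /cofactor add0n; congr (_ * \det _).
apply/matrixP => a b; rewrite !mxE.
by case: splitP => [[[]]//|k]; rewrite /= => /eqP; rewrite eqSS => /eqP/val_inj ->.
Qed.

End oriented_frames.

Section frame_existence.
Variables (R : realType) (n : nat).

(** The Householder reflection 1 - (2/c) w^T w, with w = y - e_0 and c = |w|^2, is symmetric and
    orthogonal and exchanges y and e_0, so its first row is y. For y = e_0, where c = 0, the
    identity serves. *)
Lemma orthogonal_completion (y : 'rV[R]_n.+1) : enorm y = 1 ->
  exists V : 'M[R]_(n, n.+1), (col_mx y V : 'M[R]_(1 + n)) *m (col_mx y V)^T = 1%:M.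
Proof.
move=> y1; suff [H HH Hy] : exists2 H : 'M[R]_(1 + n, n.+1),
    H *m H^T = 1%:M & row (lshift n 0) H = y.
  exists (dsubmx H); rewrite (_ : col_mx _ _ = H)//.
  rewrite -[RHS]vsubmxK; congr col_mx; rewrite -Hy; apply/rowP => j.
  by rewrite !mxE.
have l0 : lshift n (0 : 'I_1) = (0 : 'I_n.+1) by exact: val_inj.
have [ye|ye] := eqVneq y (delta_mx 0 0).
  exists (1%:M : 'M[R]_n.+1); first by rewrite trmx1 mulmx1.
  by rewrite [lshift n 0]l0 row1 ye.
pose w := y - delta_mx 0 0; pose c := (w *m w^T) 0 0.
have wwE : w *m w^T = c%:M by rewrite [LHS]mx11_scalar.
have yy := enorm1_mul_tr y1.
have w0 : w 0 0 = y 0 0 - 1 by rewrite !mxE !eqxx.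
have cE : c = 2 - 2 * y 0 0.
  rewrite /c /w linearB/= mulmxBl !mulmxBr yy trmx_delta !mxE !eqxx.
  rewrite (bigD1 0)//= big1 ?addr0 => [|j j0]; last by rewrite !mxE (negbTE j0) mulr0.
  rewrite (bigD1 0)//= big1 ?addr0 => [|j j0]; last by rewrite !mxE (negbTE j0) mul0r.
  rewrite (bigD1 0)//= big1 ?addr0 => [|j j0]; last by rewrite !mxE (negbTE j0) mul0r.
  by rewrite !mxE !eqxx /=; ring.
have c0 : c != 0.
  rewrite /c (_ : (w *m w^T) 0 0 = ssq w).
    by rewrite ssq_eq0 subr_eq0.
  by rewrite [LHS]mxE; apply: eq_bigr => j _; rewrite [w^T _ _]mxE expr2.
pose P := w^T *m w.
have PP : P *m P = c *: P.
  by rewrite /P -mulmxA (mulmxA w) wwE mul_scalar_mx -scalemxAr.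
exists (1%:M - (2 / c) *: P : 'M[R]_n.+1).
  have PT : P^T = P by rewrite /P trmx_mul trmxK.
  have HT : (1%:M - (2 / c) *: P)^T = 1%:M - (2 / c) *: P.
    by rewrite linearB linearZ /= trmx1 PT.
  rewrite [X in _ *m X]HT mulmxBl !mulmxBr !mul1mx !mulmx1.
  rewrite -scalemxAl -scalemxAr PP !scalerA.
  have -> : 2 / c * (2 / c) * c = 2 / c + 2 / c by field.
  by rewrite scalerDl opprB addrK subrK.
rewrite [lshift n 0]l0; apply/rowP => j.
rewrite !mxE big_ord1 !mxE !eqxx mulrA.
have -> : 2 / c * (y 0 0 - 1) = -1.
  by rewrite cE in c0 *; field; apply: contraNneq c0 => ?; lra.
by rewrite eq_sym; ring.
Qed.

End frame_existence.

(** A frame of the wrong orientation is corrected by changing the sign of its first vector, which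
    requires dimension at least 2. Existence ensures that [tangent_frame] is an actual frame and not
    the default 0 of [xget]. *)
Lemma oriented_frame_exists (R : realType) n (y : 'rV[R]_n.+2) : enorm y = 1 ->
  exists V, oriented_frame y V.
Proof.
move=> y1; have [V VV] := orthogonal_completion y1.
have [VVT Vy] : V *m V^T = 1%:M /\ V *m y^T = 0.
  move: VV; rewrite tr_col_mx mul_col_row scalar_mx_block => /eq_block_mx[_ _ ? ?].
  by split.
pose d := \det (col_mx y V : 'M[R]_(1 + n.+1)).
have dd : d ^+ 2 = 1.
  by have := congr1 determinant VV; rewrite det_mulmx det_tr det1 -expr2.
have [d0|d0] := ltP 0 d; first by exists V.
pose D := diag_mx (\row_(j < n.+1) (if j == 0 then -1 else 1 : R)).
have DD : D *m D^T = 1%:M.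
  rewrite tr_diag_mx mulmx_diag; apply/matrixP => i j; rewrite !mxE.
  by case: (i == 0); rewrite ?mulrNN mulr1.
exists (D *m V); split.
- by rewrite trmx_mul mulmxA -(mulmxA D) VVT mulmx1 DD.
- by rewrite -mulmxA Vy mulmx0.
have -> : col_mx (outer_normal y) (D *m V) =
    (block_mx 1%:M 0 0 D : 'M[R]_(1 + n.+1)) *m col_mx y V.
  by rewrite mul_block_col mul1mx !mul0mx addr0 add0r.
rewrite [\det _](@det_mulmx _ (1 + n.+1)%N) det_ublock det1 mul1r det_diag big_ord_recl mxE eqxx big1 ?mulr1.
  rewrite mulN1r oppr_gt0 lt_neqAle d0 andbT; apply/eqP => d00.
  by move/eqP: dd; rewrite -[\det _]/d in d00; rewrite d00 expr0n eq_sym oner_eq0.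
by move=> i _; rewrite mxE.
Qed.

(** * Integral formulas *)

Section kernel_laplacians.
Variables (R : realType) (m : nat).
Local Notation N := m.*2.+2.
Local Notation V := 'rV[R]_N.
Local Notation b_ := (@conj_basis R m.*2.+1).
Local Notation "'e_ l" := (delta_mx 0 l : V) (at level 8, l at level 2).
Variable x : V.
Implicit Types (y v : V) (i l : 'I_N) (j : nat).

Definition conj_comb (a : R) (k : 'I_N -> R) : cliff R m.*2.+1 :=
  a *: \sum_i k i *: b_ i.

Lemma conj_combE a k A : conj_comb a k A = \sum_i (a * b_ i A) * k i.
Proof.
rewrite ffunE sum_ffunE scaler_sumr; apply: eq_bigr => i _.
by rewrite ffunE [LHS]mulrCA mulrC.
Qed.

Lemma is_derive_conj_comb a (k : 'I_N -> V -> R) (dk : 'I_N -> R) y v A :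
  (forall i, is_derive y v (k i) (dk i)) ->
  is_derive y v (fun z => conj_comb a (k^~ z) A : R) (conj_comb a dk A).
Proof.
move=> kd; rewrite conj_combE; under eq_fun do rewrite conj_combE.
apply: is_derive_big => i.
Qed.

(** The closed forms of the iterated Laplacians hold off the pole only; the complement of the pole
    being open, they may still be differentiated there. *)
Lemma cderive_near (G H : V -> cliff R m.*2.+1) y v (dH : cliff R m.*2.+1) :
  (forall z, z != x -> G z = H z) -> y != x ->
  (forall A, is_derive y v (fun z => H z A : R) (dH A)) -> cderive v G y = dH.
Proof.
move=> GH yx Hd; apply/ffunP => A; rewrite ffunE.
case: (Hd A) => _ <-; apply: near_eq_derive.
have yx0 : ssq (y - x) != 0 by rewrite ssq_eq0 subr_eq0.
have := cvgr_neq0 _ (@continuous_ssq_sub R N x y) yx0 => /(_ _).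
by apply: filterS => z; rewrite ssq_eq0 subr_eq0 => zx; rewrite GH.
Qed.

Lemma kernel_N_conj_comb y :
  kernel_N (y - x) = conj_comb (epsilon R m) (fun i => ker x 0 0 i y).
Proof.
rewrite /kernel_N /paravector_inv paravector_conjE; congr (_ *: _).
rewrite scaler_sumr; apply: eq_bigr => i _; rewrite scalerA; congr (_ *: _).
by rewrite /ker /rinv addr0 expr1 enorm_sqr mulrC !mxE.
Qed.

(** Each Laplacian contributes one factor, by [lapker0_even]. The factor k = m would be 0: Delta^m N
    is harmonic off the pole. *)
Definition laplacian_coef j : R :=
  epsilon R m * \prod_(k < j) (4 * k.+1%:R * (k%:R - m%:R)).

Lemma laplacian_coefS j : laplacian_coef j.+1 =
  laplacian_coef j * (4 * j.+1%:R * (j%:R - m%:R)).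
Proof. by rewrite /laplacian_coef big_ord_recr mulrA. Qed.

Lemma lapker0_even j i y :
  lapker x j 0 i y = 4 * j.+1%:R * (j%:R - m%:R) * ker x j.+1 0 i y.
Proof.
rewrite lapker0; congr (_ * _).
have -> : N%:R = 2 * m.+1%:R :> R by rewrite -doubleS -muln2 natrM mulrC.
by rewrite -[j.+1]addn1 -[m.+1]addn1 !natrD; ring.
Qed.

Lemma laplacian_iter_kernel j y : y != x ->
  laplacian_iter j (fun z => kernel_N (z - x)) y =
  conj_comb (laplacian_coef j) (fun i => ker x j 0 i y).
Proof.
elim: j y => [|j IH] y yx.
  by rewrite /laplacian_coef big_ord0 mulr1 -kernel_N_conj_comb.
have y0 z : z != x -> ssq (z - x) + 0 != 0.
  by rewrite addr0 ssq_eq0 subr_eq0.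
have d1 l z : z != x ->
    cpartial l (laplacian_iter j (fun z => kernel_N (z - x))) z =
    conj_comb (laplacian_coef j) (fun i => dker x j 0 i l z).
  move=> zx; apply: (cderive_near IH zx) => A.
  by apply: is_derive_conj_comb => i; apply: is_derive_ker; exact: y0.
rewrite /laplacian_iter iterS -/(laplacian_iter j _) /laplacian.
rewrite (eq_bigr (fun l => conj_comb (laplacian_coef j) (fun i => d2ker x j 0 i l y))).
  rewrite /conj_comb -scaler_sumr exchange_big /= laplacian_coefS -scalerA.
  congr (_ *: _); rewrite scaler_sumr; apply: eq_bigr => i _.
  by rewrite -scaler_suml sum_d2ker ?y0// lapker0_even scalerA.
move=> l _; apply: (cderive_near (d1 l) yx) => A.
by apply: is_derive_conj_comb => i; apply: is_derive_dker; exact: y0.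
Qed.

(** Computed directly, because [is_derive_direction] requires continuous partial derivatives
    everywhere, while here e = 0 and its pole must be allowed. *)
Lemma is_derive_ker_direction j e i y v : ssq (y - x) + e != 0 ->
  is_derive y v (ker x j e i) (\sum_l v 0 l * dker x j e i l y).
Proof.
move=> y0.
have dB l : is_derive y v (fun z : V => z 0 l - x 0 l) (v 0 l).
  by have := isdB (is_derive_coord y v l) (isd_cst y v (x 0 l)); rewrite subr0.
have dS : is_derive y v (fun z => ssq (z - x) + e)
    (\sum_l 2 * (y 0 l - x 0 l) * v 0 l).
  suff dS0 : is_derive y v (fun z => ssq (z - x)) (\sum_l 2 * (y 0 l - x 0 l) * v 0 l).
    by have := isdD dS0 (isd_cst y v e); rewrite addr0.
  under eq_fun do rewrite ssq_subE.
  apply: (isd_sum (dh := fun l => 2 * (y 0 l - x 0 l) * v 0 l)) => l.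
  by have := isdX 1 (dB l); rewrite expr1.
have := isdM (dB i) (isdX j (isdV y0 dS)) => /is_derive_eq; apply.
rewrite -/(rinv x e y) /dker.
under [RHS]eq_bigr => l _ do rewrite mulrBr.
rewrite [RHS]sumrB [X in _ = X - _](bigD1 i)//= eqxx [X in _ + X - _]big1 ?addr0 => [|l li]; last first.
  by rewrite eq_sym (negbTE li) mul0r mulr0.
rewrite mul1r addrC [v 0 i * _]mulrC; congr (_ + _).
rewrite mulr_sumr !mulr_sumr -sumrN; apply: eq_bigr => l _.
by rewrite !exprS; ring.
Qed.

Lemma normal_derive_kernel j y : y != x ->
  normal_derive (laplacian_iter j (fun z => kernel_N (z - x))) y =
  conj_comb (laplacian_coef j) (fun i => \sum_l y 0 l * dker x j 0 i l y).
Proof.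
move=> yx; apply: (cderive_near (@laplacian_iter_kernel j) yx) => A.
apply: is_derive_conj_comb => i; apply: is_derive_ker_direction.
by rewrite addr0 ssq_eq0 subr_eq0.
Qed.

Lemma laplacian_coef_top :
  laplacian_coef m * fine (sphere_measure R N (unit_sphere R N)) = 1.
Proof.
(* The product is (-4)^j j! m! / (m-j)!; keeping (m-j)! on the left avoids divisions in the
   induction. *)
have c j : (j <= m)%N -> \prod_(k < j) (4 * k.+1%:R * (k%:R - m%:R)) * (m - j)`!%:R =
    (-4) ^+ j * j`!%:R * m`!%:R :> R.
  elim: j => [|j IH] jm; first by rewrite big_ord0 subn0 !mul1r.
  have E : (m - j)`!%:R = (m%:R - j%:R) * (m - j.+1)`!%:R :> R.
    by rewrite -(subnSK jm) factS natrM subnSK// natrB 1?ltnW.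
  have := IH (ltnW jm); rewrite {}E big_ord_recr /= exprS factS natrM => E.
  transitivity (- 4 * j.+1%:R * (\prod_(k < j) (4 * k.+1%:R * (k%:R - m%:R)) *
     ((m%:R - j%:R) * (m - j.+1)`!%:R)) : R); first by ring.
  by rewrite E; ring.
rewrite /laplacian_coef sphere_area.
have := c m (leqnn m); rewrite subnn mulr1 => ->.
have m0 : m`!%:R != 0 :> R by rewrite pnatr_eq0 -lt0n fact_gt0.
have p0 : pi ^+ m.+1 != 0 :> R by rewrite expf_neq0// gt_eqF// pi_gt0.
rewrite /epsilon.
have -> : (-4) ^+ m = (-1) ^+ m * 2 ^+ m.*2 :> R.
  by rewrite -mul2n exprM -exprMn; congr (_ ^+ _); ring.
rewrite exprS.
have t0 : 2 ^+ m.*2 != 0 :> R by rewrite expf_neq0.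
have s1 : (-1) ^+ m * (-1) ^+ m = 1 :> R by rewrite -exprMn mulrNN mulr1 expr1n.
transitivity ((-1) ^+ m * (-1) ^+ m : R); last exact: s1.
by field; rewrite m0 p0 t0.
Qed.

End kernel_laplacians.

Lemma cvg_sumr (R : realType) (I : Type) (s : seq I) (F : I -> nat -> R) (l : I -> R) :
  (forall i, F i k @[k --> \oo] --> l i) ->
  \sum_(i <- s) F i k @[k --> \oo] --> \sum_(i <- s) l i.
Proof.
move=> Fl; elim: s => [|i s IH].
  by rewrite big_nil; under eq_fun do rewrite big_nil; exact: cvg_cst.
by rewrite big_cons; under eq_fun do rewrite big_cons; exact: cvgD.
Qed.

(** * Green and Cauchy-Pompeiu formulas, coordinate by coordinate *)

Section cauchy_pompeiu.
Variables (R : realType) (m : nat).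
Local Notation N := m.*2.+2.
Local Notation V := 'rV[R]_N.
Local Notation Cl := (cliff R m.*2.+1).
Local Notation lam := (lebesgue_rV R N).
Local Notation sigma := (sphere_measure R N).
Local Notation S := (unit_sphere R N).
Local Notation b_ := (@conj_basis R m.*2.+1).
Local Notation g_ := (@cliff_basis R m.*2.+1).
Variables (x : V) (C : {set 'I_m.*2.+1}).
Hypothesis x1 : enorm x < 1.
Implicit Types (w : V -> Cl) (y : V) (i l : 'I_N) (j : nat).

Let mB : measurable (@eball R N 1) := @measurable_eball R N 1.
Let mS := @measurable_unit_sphere R m.*2.+1.

Lemma cintegral_conj_comb (mu : {measure set V -> \bar R}) (D : set V) a
    (k : 'I_N -> V -> R) w : measurable D ->
  (forall i, mu.-integrable D (EFin \o (fun y => k i y * (b_ i * w y) C))) ->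
  cintegral mu D (fun y => conj_comb a (k^~ y) * w y) C =
  a * \sum_i \int[mu]_(y in D) (k i y * (b_ i * w y) C).
Proof.
move=> mD ik; rewrite ffunE -Rintegral_sum// -RintegralZl//; last first.
  exact: Rintegrable_sum.
apply: eq_Rintegral => y _; rewrite /conj_comb -scalerAl ffunE; congr (_ * _).
by rewrite mulr_suml sum_ffunE; apply: eq_bigr => i _; rewrite -scalerAl ffunE.
Qed.

Lemma continuous_cliffMl (c : Cl) w : 
  (forall A, continuous (fun y => w y A : R)) ->
  continuous (fun y => (c * w y) C : R).
Proof.
move=> wc; under eq_fun do rewrite cliffM_coord.
by apply: cts_sum => B _; apply: ctsM => //; move=> ?; exact: cst_continuous.
Qed.

Lemma is_derive_cliffMl k (c : Cl) w l y : classC k.+1 w ->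
  is_derive y (delta_mx 0 l) (fun y => (c * w y) C : R) ((c * cpartial l w y) C).
Proof.
move=> wk; rewrite cliffM_coord; under eq_fun do rewrite cliffM_coord.
apply: is_derive_big => B.
have := isdM (isd_cst y (delta_mx 0 l) ((c * blade R B) C)) (is_derive_cpartial B l y wk).
by rewrite mulr0 addr0.
Qed.

(** Coordinate [C] of the integral of Delta^j N times w, without the scalar [laplacian_coef j];
    likewise for the two sphere terms below. *)
Definition ball_term j w := \sum_i \int[lam]_(y in eball 1) (ker x j 0 i y * (b_ i * w y) C).
Definition sphere_term j w := \sum_i \int[sigma]_(y in S) (ker x j 0 i y * (b_ i * w y) C).
Definition sphere_normal_term j w := \sum_i
  \int[sigma]_(y in S) ((\sum_l y 0 l * dker x j 0 i l y) * (b_ i * w y) C).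

(** [green_ker] is applied, for each i, to the real function formed by coordinate [C] of e_i^* w; as
    e_i^* is constant, it commutes with all derivatives. *)
Lemma green_conj_comb j w : (j < m)%N -> classC 2 w ->
  ball_term j (laplacian w) - 4 * j.+1%:R * (j%:R - m%:R) * ball_term j.+1 w =
  sphere_term j (normal_derive w) - sphere_normal_term j w.
Proof.
move=> jm w2; have w1 := classC_le (leqnSn 1) w2.
have p1 l : classC 1 (cpartial l w) := classC_cpartial l w2.
have p2 l k : classC 0 (cpartial k (cpartial l w)) := classC_cpartial k (p1 l).
rewrite /ball_term /sphere_term /sphere_normal_term mulr_sumr -!sumrB.
apply: eq_bigr => i _.
have j2 : (j.*2.+2 <= m.*2)%N by rewrite -doubleS leq_double.
have ctsb k v : classC k v -> continuous (fun y => (b_ i * v y) C : R).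
  by move=> vk; apply: continuous_cliffMl => A; exact: classC_continuous vk.
have := @green_ker R m.*2 x x1 (fun y => (b_ i * w y) C)
  (fun l y => (b_ i * cpartial l w y) C)
  (fun l y => (b_ i * cpartial l (cpartial l w) y) C)
  (ctsb 2 w w2) (fun l => ctsb 1 _ (p1 l)) (fun l => ctsb 0 _ (p2 l l))
  (fun l y => is_derive_cliffMl _ l y w2)
  (fun l y => is_derive_cliffMl _ l y (p1 l)) j i j2.
have [ilap _] := @cvg_volume_ker R m.*2 x x1 j.+1 i (fun y => (b_ i * w y) C)
  (ctsb 2 w w2) j2.
have -> : \int[lam]_(y in eball 1) (lapker x j 0 i y * (b_ i * w y) C) =
    4 * j.+1%:R * (j%:R - m%:R) *
    \int[lam]_(y in eball 1) (ker x j.+1 0 i y * (b_ i * w y) C).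
  rewrite -RintegralZl//.
  by apply: eq_Rintegral => y _; rewrite lapker0_even mulrA.
have -> : (fun y => ker x j 0 i y * \sum_l (b_ i * cpartial l (cpartial l w) y) C) =
    (fun y => ker x j 0 i y * (b_ i * laplacian w y) C).
  by apply/funext => y; rewrite [b_ i * _]mulr_sumr sum_ffunE.
move=> ->; congr (_ - _); apply: eq_Rintegral => y _; congr (_ * _).
rewrite (normal_derive_combination _ w1) mulr_sumr sum_ffunE.
by apply: eq_bigr => l _; rewrite -scalerAr ffunE.
Qed.

(** The outward normal, as a paravector, times w: the density that gamma times w induces on the
    sphere. *)
Definition normal_mul w y : Cl := (\sum_l y 0 l *: g_ l) * w y.

Lemma continuous_normal_mul w A : (forall A, continuous (fun y => w y A : R)) ->
  continuous (fun y => normal_mul w y A : R).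
Proof.
move=> wc; rewrite /normal_mul; under eq_fun do rewrite mulr_suml sum_ffunE.
apply: cts_sum => l _; under eq_fun do rewrite -scalerAl ffunE cliffM_coord.
apply: ctsM; first exact: coord_continuous.
by apply: cts_sum => B _; apply: ctsM => //; move=> ?; exact: cst_continuous.
Qed.

Section regularized.
Variables (w : V -> Cl).
Hypothesis wC1 : classC 1 w.
Let wc A : continuous (fun y => w y A : R).
Proof. exact: classC_continuous wC1. Qed.
Let dwc l A : continuous (fun y => cpartial l w y A : R).
Proof. exact: classC_continuous (classC_cpartial l wC1). Qed.
Let Dwc A : continuous (fun y => dirac_op w y A : R).
Proof. exact: classC_continuous (classC_dirac wC1). Qed.

(** Gauss' theorem for the field with components [ker] times coordinate [C] of e_i^* e_l w, summed
    over i. Derivatives of w reassemble into D w; derivatives of the kernel are symmetric in i and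
    l, so [sum_conj_basisM] keeps only their trace, the mollifier. *)
Lemma cauchy_pompeiu_regularized (e : R) : 0 < e ->
  \int[lam]_(y in eball 1) (mollifier x e y * w y C) +
    \sum_i \int[lam]_(y in eball 1) (ker x m e i y * (b_ i * dirac_op w y) C) =
  \sum_i \int[sigma]_(y in S) (ker x m e i y * (b_ i * normal_mul w y) C).
Proof.
move=> e0.
pose g i l y := ker x m e i y * (b_ i * g_ l * w y) C.
pose dg i l y := ker x m e i y * (b_ i * g_ l * cpartial l w y) C +
  (b_ i * g_ l * w y) C * dker x m e i l y.
have gc i l : continuous (g i l).
  by apply: ctsM; [exact: continuous_ker|exact: continuous_cliffMl].
have dgc i l : continuous (dg i l).
  apply: ctsD; apply: ctsM;
    by [exact: continuous_ker|exact: continuous_dker|exact: continuous_cliffMl].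
have gd i l y : is_derive y (delta_mx 0 l) (g i l) (dg i l y).
  by apply: isdM; [apply: is_derive_ker; exact: ssq_sub_addr_neq0|exact: is_derive_cliffMl wC1].
have igB i l := continuous_integrable_ball (dgc i l).
have ig i l : sigma.-integrable S (EFin \o (fun y => y 0 l * g i l y)).
  by apply: continuous_integrable_sphere; apply: ctsM => //; exact: coord_continuous.
transitivity (\sum_i \sum_l \int[lam]_(y in eball 1) dg i l y); last first.
  apply: eq_bigr => i _; under eq_bigr do rewrite (divergence_unit_ball (gc _ _) (dgc _ _) (gd _ _)).
  rewrite -Rintegral_sum//; apply: eq_Rintegral => y _.
  rewrite /normal_mul mulr_suml mulr_sumr sum_ffunE mulr_sumr; apply: eq_bigr => l _.
  rewrite (_ : b_ i * _ = y 0 l *: (b_ i * g_ l * w y)); last first.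
    by rewrite -scalerAl -scalerAr mulrA.
  by rewrite ffunE /g mulrCA.
have im : lam.-integrable (eball 1) (EFin \o (fun y => mollifier x e y * w y C)).
  by apply: continuous_integrable_ball; apply: ctsM => //; exact: continuous_mollifier.
have iD i : lam.-integrable (eball 1) (EFin \o (fun y => ker x m e i y * (b_ i * dirac_op w y) C)).
  apply: continuous_integrable_ball; apply: ctsM; first exact: continuous_ker.
  exact: continuous_cliffMl.
rewrite -Rintegral_sum// -RintegralD//; last exact: Rintegrable_sum.
under [RHS]eq_bigr do rewrite -Rintegral_sum//.
rewrite -Rintegral_sum//; last by move=> i _; exact: Rintegrable_sum.
apply: eq_Rintegral => y _.
have y0 := ssq_sub_addr_neq0 x e0 y.
have dsym i l : dker x m e i l y = dker x m e l i y.
  by rewrite /dker eq_sym; congr (_ - _ * _); rewrite mulrAC.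
have sc : \sum_i \sum_l (b_ i * g_ l * w y) C * dker x m e i l y = mollifier x e y * w y C.
  rewrite -(sum_dker_diag y0).
  have := sum_conj_basisM dsym => /(congr1 (fun z => (z * w y) C)).
  rewrite -scalerAl mul1r ffunE => E; apply: (etrans _ E).
  rewrite mulr_suml sum_ffunE; apply: eq_bigr => i _.
  rewrite mulr_suml sum_ffunE; apply: eq_bigr => l _.
  by rewrite -scalerAl ffunE mulrC.
rewrite -sc -big_split; apply: eq_bigr => i _ /=.
rewrite addrC /dg big_split /=; congr (_ + _).
rewrite /dirac_op mulr_sumr sum_ffunE mulr_sumr; apply: eq_bigr => l _.
by rewrite mulrA.
Qed.

Lemma cauchy_pompeiu :
  fine (sigma S) * w x C + ball_term m (dirac_op w) =
  sphere_term m (normal_mul w).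
Proof.
(* [approximate_identity] runs along e = (k+1)^(-2), the dominated limits along e = 1/(k+1); [u]
   selects the common subsequence. *)
pose u k := (k.+1 ^ 2).-1%N.
have uE k : (u k).+1%:R^-1 = k.+1%:R^-1 ^+ 2 :> R.
  by rewrite /u prednK ?expn_gt0// natrX exprVn.
have u_cvg : u k @[k --> \oo] --> \oo.
  move=> P [n _ nP]; exists n => // k /= nk; apply: nP => /=.
  by apply: leq_trans nk _; rewrite /u -ltnS prednK ?expn_gt0// -mulnn leq_pmulr.
have cB : (\int[lam]_(y in eball 1) (mollifier x (k.+1%:R^-1 ^+ 2) y * w y C) +
    \sum_i \int[lam]_(y in eball 1) (ker x m (k.+1%:R^-1 ^+ 2) i y * (b_ i * dirac_op w y) C))
    @[k --> \oo] --> fine (sigma S) * w x C + ball_term m (dirac_op w).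
  have c1 := @approximate_identity R m x (fun y => w y C) x1 (@wc C).
  apply: (cvgD c1); apply: cvg_sumr => i.
  have [_ c] := @cvg_volume_ker R m.*2 x x1 m i (fun y => (b_ i * dirac_op w y) C)
    (@continuous_cliffMl _ _ Dwc) (leqnn _).
  under eq_fun do rewrite -uE.
  by move: (cvg_comp _ _ u_cvg c); rewrite /comp.
have cS : (\sum_i \int[sigma]_(y in S) (ker x m (k.+1%:R^-1 ^+ 2) i y * (b_ i * normal_mul w y) C))
    @[k --> \oo] --> sphere_term m (normal_mul w).
  apply: cvg_sumr => i.
  have [_ c] := @cvg_sphere_ker R m.*2 x x1 m i (fun y => (b_ i * normal_mul w y) C)
    (@continuous_cliffMl _ _ (fun A => @continuous_normal_mul _ A wc)).
  under eq_fun do rewrite -uE.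
  by move: (cvg_comp _ _ u_cvg c); rewrite /comp.
apply: cvg_unique cB _ => //.
rewrite (_ : (fun k : nat => _) = (fun k : nat =>
  \sum_i \int[sigma]_(y in S) (ker x m (k.+1%:R^-1 ^+ 2) i y * (b_ i * normal_mul w y) C)))//.
apply/funext => k; apply: cauchy_pompeiu_regularized.
by rewrite exprn_gt0// invr_gt0.
Qed.
End regularized.

Lemma cintegral_eq (mu : {measure set V -> \bar R}) (D : set V) (w w' : V -> Cl) :
  (forall y, D y -> w y = w' y) -> cintegral mu D w = cintegral mu D w'.
Proof.
move=> ww; apply/ffunP => A; rewrite !ffunE; apply: eq_Rintegral => y.
by rewrite inE => Dy; rewrite ww.
Qed.

Section kernel_integrability.
Variables (w : V -> Cl).
Hypothesis wc : forall A, continuous (fun y => w y A : R).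

Lemma ball_termE (g : V -> Cl) j a : (j <= m)%N ->
  (forall y, g y = conj_comb a (fun i => ker x j 0 i y) * w y) ->
  cintegral lam (unit_ball R N) g C = a * ball_term j w.
Proof.
move=> jm gE; rewrite (funext gE).
apply: (@cintegral_conj_comb _ _ a (fun i y => ker x j 0 i y)) => // i.
have j2 : (j.*2 <= m.*2)%N by rewrite leq_double.
by have [] := @cvg_volume_ker R m.*2 x x1 j i (fun y => (b_ i * w y) C)
  (@continuous_cliffMl _ _ wc) j2.
Qed.

Lemma sphere_termE (g : V -> Cl) j a :
  (forall y, S y -> g y = conj_comb a (fun i => ker x j 0 i y) * w y) ->
  cintegral sigma S g C = a * sphere_term j w.
Proof.
move=> gE; rewrite (cintegral_eq _ gE).
apply: (@cintegral_conj_comb _ _ a (fun i y => ker x j 0 i y)) => // i.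
by have [] := @cvg_sphere_ker R m.*2 x x1 j i (fun y => (b_ i * w y) C)
  (@continuous_cliffMl _ _ wc).
Qed.

Lemma sphere_normal_termE (g : V -> Cl) j a :
  (forall y, S y ->
    g y = conj_comb a (fun i => \sum_l y 0 l * dker x j 0 i l y) * w y) ->
  cintegral sigma S g C = a * sphere_normal_term j w.
Proof.
move=> gE; rewrite (cintegral_eq _ gE).
apply: (@cintegral_conj_comb _ _ a (fun i y => \sum_l y 0 l * dker x j 0 i l y)) => // i.
by have [] := @cvg_sphere_dker R m.*2 x x1 j i (fun y => (b_ i * w y) C)
  (@continuous_cliffMl _ _ wc).
Qed.
End kernel_integrability.

End cauchy_pompeiu.

Lemma interior_unit_ball (R : realType) n (x : 'rV[R]_n) :
  (unit_ball R n)° x -> enorm x < 1.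
Proof.
move=> /nbhs_ballP[r /= r0 xr].
have k0 : 0 < 1 + `|x| by rewrite ltr_wpDr.
(* The interior is that of the sup norm topology; t is chosen with t [|x|] < r, so that x can be
   pushed outwards to (1 + t) x inside the ball, whence |x| <= 1 / (1 + t) < 1 for the Euclidean
   norm. *)
pose t := r / 2 / (1 + `|x|).
have t0 : 0 < t by rewrite !divr_gt0.
have : unit_ball R n ((1 + t) *: x).
  apply: xr; rewrite -ball_normE /= scalerDl scale1r opprD addNKr normrN normrZ.
  rewrite gtr0_norm// /t mulrAC ltr_pdivrMr//.
  apply: (@le_lt_trans _ _ (r / 2 * (1 + `|x|))).
    by apply: ler_wpM2l; [rewrite divr_ge0 ?ltW|rewrite lerDr].
  by rewrite ltr_pM2r// ltr_pdivrMr// ltr_pMr// ltr1n.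
have t1 : 0 < 1 + t by rewrite addr_gt0.
rewrite /unit_ball /= enormZ gtr0_norm// -ler_pdivlMl// mulr1 => /le_lt_trans; apply.
by rewrite invf_lt1// ltrDl.
Qed.

(** Absorbs the index shift between the sums over 1 <= k <= n and the differences of [u] over 0 <= k
    < n. *)
Lemma telescoped_coord (R : realType) n p (T W : cliff R p)
    (F G : nat -> cliff R p) (u : nat -> R) (C : {set 'I_p}) :
  (forall k, (k < n)%N -> G k.+1 C - F k.+1 C = u k.+1 - u k) ->
  (T - \sum_(1 <= k < n.+1) F k + \sum_(1 <= k < n.+1) G k - W) C =
  T C + (u n - u 0) - W C.
Proof.
move=> FG; rewrite !ffunE !sum_ffunE !big_add1 /= -(telescope_sumr u (leq0n n)).
congr (_ - _); rewrite -addrA [- _ + _]addrC -sumrB; congr (_ + _).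
by apply: eq_big_nat => k /andP[_ kn]; rewrite FG.
Qed.

(** * Assembling the integral formula *)

Section integral_formula.
Variables (R : realType) (m : nat).
Local Notation N := m.*2.+2.
Local Notation V := 'rV[R]_N.
Local Notation Cl := (cliff R m.*2.+1).
Local Notation lam := (lebesgue_rV R N).
Local Notation sigma := (sphere_measure R N).
Local Notation S := (unit_sphere R N).
Variables (f : V -> Cl) (x : V).
Hypotheses (fC : classC m.*2.+1 f) (x1 : enorm x < 1).
Local Notation L := laplacian_iter.
Local Notation K j := (L j (fun z => kernel_N (z - x))).
Let w k := dirac_op (L k f).
Let a := laplacian_coef R m.

Let sphere_neq_x y : S y -> y != x. Proof. exact: sphere_neq. Qed.

Let classC_w k : (k < m)%N -> classC 2 (w k).
Proof.
move=> km; apply: classC_dirac; apply: classC_laplacian_iter.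
apply: classC_le fC; rewrite !addSn add0n !ltnS -doubleS leq_double //.
Qed.

Let w_continuous k A : (k <= m)%N -> continuous (fun y => w k y A : R).
Proof.
move=> km; apply: (@classC_continuous _ _ 0); apply: classC_dirac.
by apply: classC_laplacian_iter; apply: classC_le fC; rewrite add1n ltnS leq_double.
Qed.

Let laplacian_w k : (k < m)%N -> laplacian (w k) = w k.+1.
Proof.
move=> km; rewrite /w {2}/laplacian_iter iterS -dirac_laplacian//.
apply: classC_laplacian_iter.
by apply: classC_le fC; rewrite !addSn add0n !ltnS -doubleS leq_double.
Qed.

Let sphere_form_term C :
  sphere_form_integral (fun y V => K m y * gamma_form V * f y) C =
  a m * sphere_term x C m (normal_mul f).
Proof.
have fc A : continuous (fun y => f y A : R) by exact: classC_continuous fC.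
have nc A : continuous (fun y => normal_mul f y A : R).
  exact: (@continuous_normal_mul R m f A fc).
apply: (sphere_termE C x1 nc) => y Sy.
have E := laplacian_iter_kernel m (sphere_neq_x Sy).
have [V oV] := oriented_frame_exists Sy.
have G := gamma_form_oriented_frame Sy (xgetPex 0 (ex_intro _ V oV)).
by rewrite E [gamma_form _]G; exact: (esym (mulrA _ _ _)).
Qed.

(** Green's identity for j = m - k - 1, multiplied by [a j]: the Laplacian falling on [w k] gives
    [w k.+1], the one falling on the kernel turns [a j] into [a j.+1]. The index [k] here is one
    less than in the statement. *)
Let green_step C k : (k < m)%N ->
  cintegral sigma S (fun y => K (m - k.+1) y * normal_derive (w k) y) C -
  cintegral sigma S (fun y => normal_derive (K (m - k.+1)) y * w k y) C =
  a (m - k.+1) * ball_term x C (m - k.+1) (w k.+1) -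
  a (m - k) * ball_term x C (m - k) (w k).
Proof.
move=> km; have w2 := classC_w km; have w1 := classC_le (leqnSn 1) w2.
have jm : (m - k.+1 < m)%N by rewrite ltn_subrL (leq_ltn_trans _ km).
have G := green_conj_comb C x1 jm w2.
rewrite -(laplacian_w km) -(subnSK km) {2}/a laplacian_coefS -mulrA -mulrBr {}G mulrBr.
congr (_ - _).
  have nc A : continuous (fun y => normal_derive (w k) y A : R).
    under eq_fun do rewrite (normal_derive_combination _ w1) sum_ffunE.
    apply: cts_sum => l _; under eq_fun do rewrite ffunE.
    apply: ctsM; first exact: coord_continuous.
    by apply: (@classC_continuous _ _ 0); exact: classC_cpartial.
  apply: (sphere_termE C x1 nc) => y Sy.
  by rewrite (laplacian_iter_kernel _ (sphere_neq_x Sy)).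
have wc A : continuous (fun y => w k y A : R) by exact: classC_continuous w2.
apply: (sphere_normal_termE C x1 wc) => y Sy.
by rewrite (normal_derive_kernel _ (sphere_neq_x Sy)).
Qed.

Let volume_term C :
  cintegral lam (unit_ball R N) (fun y => kernel_N (y - x) * w m y) C =
  a 0 * ball_term x C 0 (w m).
Proof.
have wc A : continuous (fun y => w m y A : R) by exact: w_continuous.
apply: (ball_termE C x1 wc (leq0n m)) => y.
by rewrite kernel_N_conj_comb /a /laplacian_coef big_ord0 mulr1.
Qed.

Lemma cliffordian_integral_formula : f x =
      sphere_form_integral (fun y V => K m y * gamma_form V * f y)
      - \sum_(1 <= k < m.+1)
          cintegral sigma S
            (fun y => normal_derive (K (m - k)) y * dirac_op (L k.-1 f) y)
      + \sum_(1 <= k < m.+1)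
          cintegral sigma S
            (fun y => K (m - k) y * normal_derive (dirac_op (L k.-1 f)) y)
      - cintegral lam (unit_ball R N)
          (fun y => kernel_N (y - x) * dirac_op (L m f) y).
Proof.
apply/ffunP => C.
(* [u 0] is the volume term of the Cauchy-Pompeiu formula for f and cancels against it; [u m] is the
   volume integral of N times D Delta^m f and cancels against the last term. *)
pose u k := a (m - k) * ball_term x C (m - k) (w k).
apply: etrans (esym (telescoped_coord (u := u) _ _ (fun k km => green_step C km))).
rewrite sphere_form_term volume_term /u subnn subn0.
have f1 : classC 1 f by apply: classC_le fC.
rewrite -(cauchy_pompeiu C x1 f1) mulrDr mulrA laplacian_coef_top mul1r.
rewrite -[dirac_op f]/(w 0); set A0 := a 0 * _; set Am := a m * _.
by ring.
Qed.

End integral_formula.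

Theorem mainTheorem1 (R : realType) (m : nat)
    (f : 'rV[R]_m.*2.+2 -> cliff R m.*2.+1) (fC : classC m.*2.+1 f) :
  (forall x : 'rV[R]_m.*2.+2, (unit_ball R m.*2.+2)° x ->
    f x =
      sphere_form_integral (fun y V =>
        laplacian_iter m (fun z => kernel_N (z - x)) y * gamma_form V * f y)
      - \sum_(1 <= k < m.+1)
          cintegral (sphere_measure R m.*2.+2) (unit_sphere R m.*2.+2)
            (fun y =>
              normal_derive
                (laplacian_iter (m - k) (fun z => kernel_N (z - x))) y
              * dirac_op (laplacian_iter k.-1 f) y)
      + \sum_(1 <= k < m.+1)
          cintegral (sphere_measure R m.*2.+2) (unit_sphere R m.*2.+2)
            (fun y =>
              laplacian_iter (m - k) (fun z => kernel_N (z - x)) y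
              * normal_derive (dirac_op (laplacian_iter k.-1 f)) y)
      - cintegral (lebesgue_rV R m.*2.+2) (unit_ball R m.*2.+2)
          (fun y => kernel_N (y - x) * dirac_op (laplacian_iter m f) y))
  /\
  (holomorphic_cliffordian setT f ->
   forall x : 'rV[R]_m.*2.+2, (unit_ball R m.*2.+2)° x ->
    f x =
      sphere_form_integral (fun y V =>
        laplacian_iter m (fun z => kernel_N (z - x)) y * gamma_form V * f y)
      - \sum_(1 <= k < m.+1)
          cintegral (sphere_measure R m.*2.+2) (unit_sphere R m.*2.+2)
            (fun y =>
              normal_derive
                (laplacian_iter (m - k) (fun z => kernel_N (z - x))) y
              * dirac_op (laplacian_iter k.-1 f) y)
      + \sum_(1 <= k < m.+1)
          cintegral (sphere_measure R m.*2.+2) (unit_sphere R m.*2.+2)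
            (fun y =>
              laplacian_iter (m - k) (fun z => kernel_N (z - x)) y
              * normal_derive (dirac_op (laplacian_iter k.-1 f)) y)).
Proof.
split=> [x /interior_unit_ball|fH x /interior_unit_ball]; first exact: cliffordian_integral_formula.
move=> x1; rewrite {1}(cliffordian_integral_formula fC x1).
rewrite [X in _ - X](_ : _ = 0) ?subr0//.
apply/ffunP => A; rewrite !ffunE; under eq_Rintegral do rewrite fH// mulr0 ffunE.
by rewrite /Rintegral integral0.
Qed.
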